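(* Suppose that $(M,\mathbf m)$ is a metric projective structure of dimension $n\ge 2$ with Weyl nullity at $x\in M$. Let $g,\bar g$ be two metrics in the equivalence class $\mathbf m$. Write $\mathsf P_{ab},\bar{\mathsf P}_{ab}$ for the respective projective Schouten tensors and $B,\bar B$ for the respective $B$-scalars at $x$. Then $$\phi_{ab}(x):=\mathsf P_{ab}-Bg_{ab}=\bar{\mathsf P}_{ab}-\bar B\bar g_{ab}\quad\text{at }x.$$ Thus $\phi_{ab}(x)$ is canonically determined by the metric projective structure $(M,\mathbf m)$. If $v\in T_xM$ is in the Weyl nullity at $x$, then $v^a\phi_{ab}=0$ at $x$. The tensor field $\phi_{ab}$ is smooth on any open set where $B$ is smooth. In particular, if the Weyl tensor has constant nullity on an open set $U$ (that is, the dimension of its nullity space is constant and positive on $U$), then $\phi_{ab}$ is a smooth tensor field on $U$. If the dimension $n=2$ then $\phi=0$ and $\mathsf P_{ab}=Bg_{ab}$, with $B$ smooth everywhere.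
   Context: Manifolds are smooth and connected; metrics are smooth, pseudo-Riemannian, of arbitrary signature; indices are abstract indices. Two metrics are projectively equivalent if they have the same geodesics up to reparametrisation; a metric projective structure $\mathbf m$ on $M$ is an equivalence class of projectively equivalent metrics. For the Levi-Civita connection $\nabla$ of a metric $g$: $[\nabla_\ell,\nabla_k]v^j=R^j{}_{i\ell k}v^i$, $R_{jk}=R^a{}_{jak}$, $\mathsf P_{jk}=\frac1{n-1}R_{jk}$ (projective Schouten tensor), $\mathsf P^i{}_j=g^{ik}\mathsf P_{kj}$. The projective Weyl tensor is $W^i{}_{jk\ell}=R^i{}_{jk\ell}+\delta^i_\ell\mathsf P_{jk}-\delta^i_k\mathsf P_{j\ell}$; it is the same for all metrics in $\mathbf m$. $(M,\mathbf m)$ has Weyl nullity at $x$ if there is a nonzero $v\in T_xM$ with $W^i{}_{jk\ell}v^j=0$ at $x$; vectors $v$ with this property are said to be in the Weyl nullity at $x$. If $(M,\mathbf m)$ has Weyl nullity at $x$ and $g\in\mathbf m$, then there is a number $B=B^g(x)$ (the $B$-scalar of $g$ at $x$), the same for all vectors in the nullity, such that $\mathsf P^i{}_jv^j=Bv^i$ for every $v$ in the Weyl nullity at $x$. Where nullity holds at every point, $B$ and $\phi_{ab}$ are thereby a function and a tensor field. *)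

(* Defs.v *)
From HB Require Import structures.
From mathcomp Require Import all_boot all_order all_algebra.
From mathcomp Require Import all_classical all_reals all_analysis.
From mathcomp Require Import ring.

Set Implicit Arguments.
Unset Strict Implicit.
Unset Printing Implicit Defensive.

Import Order.TTheory GRing.Theory Num.Theory.
Import numFieldNormedType.Exports.

Local Open Scope classical_set_scope.
Local Open Scope ring_scope.

(** * Smooth functions *)

Section Smooth.
Context {R : realType} {V : normedModType R}.

(* Iterated directional derivatives.  For V finite dimensional and U open this
   is the usual C^k condition: all partial derivatives of order at most k exist
   and are continuous on U. *)
Fixpoint Ck_on (k : nat) (U : set V) (f : V -> R) : Prop :=
  (forall y, U y -> {for y, continuous f}) /\
  if k is k'.+1 then
    forall v : V, (forall y, U y -> derivable f y v) /\ Ck_on k' U ('D_v f)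
  else True.

Definition smooth_on (U : set V) (f : V -> R) : Prop := forall k, Ck_on k U f.

End Smooth.

(* The partial derivative of f with respect to the i-th coordinate. *)
Definition partial {R : realType} {n : nat} (i : 'I_n) (f : 'rV[R]_n -> R)
  (y : 'rV[R]_n) : R := 'D_(delta_mx 0 i) f y.

(** * Smooth manifolds *)

(* The functions are total; only their restrictions to cdom and ccod matter. *)
Record chart (R : realType) (n : nat) (T : topologicalType) := Chart {
  cdom : set T;
  ccod : set 'rV[R]_n;
  cmap : T -> 'rV[R]_n;
  cinv : 'rV[R]_n -> T;
  cdom_open : open cdom;
  ccod_open : open ccod;
  cmap_fun : forall x, cdom x -> ccod (cmap x);
  cinv_fun : forall y, ccod y -> cdom (cinv y);
  cmapK : forall x, cdom x -> cinv (cmap x) = x;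
  cinvK : forall y, ccod y -> cmap (cinv y) = y;
  cmap_continuous : forall x, cdom x -> {for x, continuous cmap};
  cinv_continuous : forall y, ccod y -> {for y, continuous cinv} }.

Section Transition.
Context {R : realType} {n : nat} {T : topologicalType}.
Implicit Types c d : chart R n T.

(* The part of the image of c lying over the set U. *)
Definition chart_image c (U : set T) : set 'rV[R]_n :=
  ccod c `&` cinv c @^-1` U.

Definition transition c d (y : 'rV[R]_n) : 'rV[R]_n := cmap d (cinv c y).

Definition transition_jacobian c d (y : 'rV[R]_n) : 'M[R]_n :=
  \matrix_(i, j) partial j (fun z => transition c d z 0 i) y.

End Transition.

(* The atlas need not be maximal: it determines the smooth structure. *)
Record smooth_manifold (R : realType) (n : nat) := SmoothManifold {
  points :> topologicalType;
  atlas : set (chart R n points);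
  manifold_hausdorff : hausdorff_space points;
  manifold_second_countable : @second_countable points;
  manifold_connected : connected [set: points];
  atlas_cover : forall x : points, exists2 c, atlas c & cdom c x;
  atlas_smooth : forall c d, atlas c -> atlas d -> forall i : 'I_n,
    smooth_on (chart_image c (cdom d)) (fun y => transition c d y 0 i) }.

Definition chart_at {R : realType} {n : nat} (M : smooth_manifold R n)
  (c : chart R n M) (x : M) : Prop := atlas c /\ cdom c x.

Definition smooth_function {R : realType} {n : nat} (M : smooth_manifold R n)
  (U : set M) (f : M -> R) : Prop :=
  forall c : chart R n M, atlas c ->
    smooth_on (chart_image c U) (fun y => f (cinv c y)).

(* A covariant 2-tensor field is given by its components t c x a b in every
   chart c at x. *)
Definition smooth_2tensor {R : realType} {n : nat} (M : smooth_manifold R n)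
  (U : set M) (t : chart R n M -> M -> 'M[R]_n) : Prop :=
  forall c : chart R n M, atlas c -> forall a b : 'I_n,
    smooth_on (chart_image c U) (fun y => t c (cinv c y) a b).

(** * Pseudo-Riemannian metrics *)

(* gmx c y is the matrix g_{ab} at the point with coordinates y in the chart c;
   the signature is arbitrary (and constant, M being connected). *)
Record metric (R : realType) (n : nat) (M : smooth_manifold R n) := Metric {
  gmx : chart R n M -> 'rV[R]_n -> 'M[R]_n;
  metric_smooth : forall c, atlas c -> forall a b : 'I_n,
    smooth_on (ccod c) (fun y => gmx c y a b);
  metric_sym : forall c, atlas c -> forall y, ccod c y ->
    (gmx c y)^T = gmx c y;
  metric_nondegenerate : forall c, atlas c -> forall y, ccod c y ->
    gmx c y \in unitmx;
  metric_transition : forall c d, atlas c -> atlas d ->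
    forall y, chart_image c (cdom d) y ->
    gmx c y = (transition_jacobian c d y)^T *m gmx d (transition c d y)
              *m transition_jacobian c d y }.

(** * Curvature in coordinates *)

Section Curvature.
Context {R : realType} {n : nat}.
Variable G : 'rV[R]_n -> 'M[R]_n.
Implicit Types (i j k l a : 'I_n) (y : 'rV[R]_n).

(* Gamma^i_{jk}, with nabla_j v^i = d_j v^i + Gamma^i_{jk} v^k *)
Definition christoffel i j k y : R :=
  2^-1 * \sum_a invmx (G y) i a *
    (partial j (fun z => G z a k) y + partial k (fun z => G z j a) y
     - partial a (fun z => G z j k) y).

(* R^i_{jkl}, with the convention [nabla_k, nabla_l] v^i = R^i_{jkl} v^j *)
Definition riemann i j k l y : R :=
  partial k (christoffel i l j) y - partial l (christoffel i k j) y
  + \sum_a (christoffel i k a y * christoffel a l j y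
            - christoffel i l a y * christoffel a k j y).

(* R_{jk} = R^a_{jak} *)
Definition ricci y : 'M[R]_n := \matrix_(j, k) \sum_a riemann a j a k y.

Definition proj_schouten y : 'M[R]_n := (n.-1)%:R^-1 *: ricci y.

Definition proj_weyl i j k l y : R :=
  riemann i j k l y + (i == l)%:R * proj_schouten y j k
  - (i == k)%:R * proj_schouten y j l.

(* The space of the v such that W^i_{jkl} v^j = 0 for all i, k, l *)
Definition proj_weyl_nullity y : {vspace 'cV[R]_n} :=
  (\bigcap_(k < n) \bigcap_(l < n)
     lker (linfun (mulmx (\matrix_(i, j) proj_weyl i j k l y))))%VS.

End Curvature.

(* The Christoffel symbols are those of the Levi-Civita connection. *)
Section LeviCivita.
Context {R : realType} {n : nat}.
Variable G : 'rV[R]_n -> 'M[R]_n.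
Hypothesis Gsym : forall y, (G y)^T = G y.

Let GE (i j : 'I_n) : (fun z => G z i j) = (fun z => G z j i).
Proof. by apply/funext => z; rewrite -[in LHS]Gsym mxE. Qed.

Lemma christoffel_torsion_free (i j k : 'I_n) y :
  christoffel G i j k y = christoffel G i k j y.
Proof.
rewrite /christoffel; congr (_ * _); apply: eq_bigr => a _; congr (_ * _).
by rewrite (GE a k) (GE j a) (GE j k) [X in X - _]addrC.
Qed.

Lemma christoffel_metric (i j k : 'I_n) y : G y \in unitmx ->
  partial k (fun z => G z i j) y =
  \sum_a (christoffel G a k i y * G y a j + christoffel G a k j y * G y i a).
Proof.
move=> Gu.
have low (b d e : 'I_n) : \sum_a G y b a * christoffel G a d e y =
    2^-1 * (partial d (fun z => G z b e) y + partial e (fun z => G z d b) y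
            - partial b (fun z => G z d e) y).
  under eq_bigr => a _ do rewrite mulrCA mulr_sumr.
  rewrite -mulr_sumr exchange_big /=; congr (_ * _).
  under eq_bigr => c _.
    under eq_bigr => a _ do rewrite mulrA.
    rewrite -mulr_suml.
    have -> : \sum_a G y b a * invmx (G y) a c = (1%:M : 'M[R]_n) b c.
      by rewrite -(mulmxV Gu) mxE.
    over.
  rewrite (bigD1 b) //= big1 ?addr0 => [|c cb]; first by rewrite mxE eqxx mul1r.
  by rewrite mxE eq_sym (negbTE cb) mul0r.
rewrite big_split /=.
under eq_bigr => a _ do rewrite -{1}(Gsym y) mxE mulrC.
under [X in _ = _ + X]eq_bigr => a _ do rewrite mulrC.
rewrite !low -mulrDr (GE j i) (GE k j) (GE k i).
apply: (@mulrI _ 2); first by rewrite unitfE pnatr_eq0.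
by rewrite mulrA divff ?pnatr_eq0 // mul1r mulr_natl mulr2n; ring.
Qed.

End LeviCivita.

Section MetricTensors.
Context {R : realType} {n : nat} {M : smooth_manifold R n}.
Implicit Types (g : metric M) (c : chart R n M) (x : M).

(* g_{ab} and P_{ab} at x, in the chart c *)
Definition metric_at g c x : 'M[R]_n := gmx g c (cmap c x).
Definition schouten g c x : 'M[R]_n := proj_schouten (gmx g c) (cmap c x).

(* The components in the chart c of the vectors of the Weyl nullity at x *)
Definition weyl_nullity g c x : {vspace 'cV[R]_n} :=
  proj_weyl_nullity (gmx g c) (cmap c x).

(* P^i_j v^j = B v^i for every v in the Weyl nullity at x *)
Definition is_Bscalar g x (B : R) : Prop :=
  forall c, chart_at c x -> forall v, v \in weyl_nullity g c x ->
    invmx (metric_at g c x) *m schouten g c x *m v = B *: v.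

(* When there is no Weyl nullity at x the value is irrelevant. *)
Definition Bscalar g x : R := xget 0 [set B | is_Bscalar g x B].

Definition phi g c x : 'M[R]_n := schouten g c x - Bscalar g x *: metric_at g c x.

End MetricTensors.

(** * Geodesics and projective equivalence *)

Section Geodesics.
Context {R : realType} {n : nat} {M : smooth_manifold R n}.
Implicit Types (g h : metric M) (I J : set R) (gamma : R -> M).

Definition open_interval I : Prop := [/\ open I, is_interval I & I !=set0].

Definition coord (c : chart R n M) gamma (i : 'I_n) (t : R) : R :=
  cmap c (gamma t) 0 i.

(* An affinely parametrised geodesic defined on I *)
Definition geodesic g I gamma : Prop :=
  (forall t, I t -> {for t, continuous gamma}) /\
  forall c, atlas c ->
    (forall i, smooth_on (I `&` gamma @^-1` cdom c) (coord c gamma i)) /\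
    (forall t, I t -> cdom c (gamma t) -> forall i,
       'D_1 ('D_1 (coord c gamma i)) t
       + \sum_j \sum_k christoffel (gmx g c) i j k (cmap c (gamma t))
                       * 'D_1 (coord c gamma j) t * 'D_1 (coord c gamma k) t
       = 0).

Definition reparametrisation J I (rho : R -> R) : Prop :=
  [/\ set_bij J I rho, smooth_on J rho & forall t, J t -> 'D_1 rho t != 0].

Definition geodesics_included g h : Prop :=
  forall I gamma, open_interval I -> geodesic g I gamma ->
  exists J rho, [/\ open_interval J, reparametrisation J I rho &
                    geodesic h J (gamma \o rho)].

Definition proj_equivalent g h : Prop :=
  geodesics_included g h /\ geodesics_included h g.

End Geodesics.

Record metric_projective_structure (R : realType) (n : nat)
    (M : smooth_manifold R n) := MetricProjectiveStructure {
  mps_class :> set (metric M);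
  mps_classP : exists g, mps_class = [set h | proj_equivalent g h] }.

(* All the metrics of m have the same Weyl tensor, so that any of them may be
   used for the Weyl nullity of m. *)
Section WeylNullity.
Context {R : realType} {n : nat} {M : smooth_manifold R n}.
Variable m : metric_projective_structure M.

(* The tangent vector at x with components v in the chart c is in the Weyl
   nullity of m. *)
Definition in_weyl_nullity (c : chart R n M) (x : M) (v : 'cV[R]_n) : Prop :=
  exists2 g, mps_class m g & v \in weyl_nullity g c x.

Definition has_weyl_nullity (x : M) : Prop :=
  exists c v, [/\ chart_at c x, v != 0 & in_weyl_nullity c x v].

Definition constant_weyl_nullity (U : set M) : Prop :=
  exists2 g, mps_class m g & exists2 d, (0 < d)%N &
    forall c x, U x -> chart_at c x -> \dim (weyl_nullity g c x) = d.

End WeylNullity.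

(* Main.v *)
(* Write W(u, w), R(u, w) for the Weyl and curvature operators.  If v is in the
   Weyl nullity then R(u, w) v = P(v, w) u - P(v, u) w, and the skewness of R with
   respect to g forces P v = B g v, with the same B for all such v.  The pair
   symmetry of R then yields W(v, u) w = - phi(w, u) v for all u, w.  Hence, v being
   nonzero, phi is determined by the Weyl tensor, and it is smooth wherever the
   nullity has a smooth nonvanishing local section, as it does when its dimension
   is constant.

   The Weyl tensor depends only on the projective class: geodesics with arbitrary
   initial velocity exist (Picard iteration), and comparing the geodesic equations
   of the two metrics along them shows that the Christoffel symbols differ by
   delta^i_j U_k + delta^i_k U_j.  The curvatures then differ by terms in
   q_{kj} = nabla_k U_j - U_k U_j, which is symmetric because both Ricci tensors are,
   and these terms cancel in W.  In dimension 2, W = 0. *)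
Require Import Defs.
From HB Require Import structures.
From mathcomp Require Import all_boot all_order all_algebra.
From mathcomp Require Import all_classical all_reals all_analysis.
From mathcomp Require Import ring lra.
Import Order.TTheory GRing.Theory Num.Theory.
Import numFieldNormedType.Exports.
Local Open Scope classical_set_scope.
Local Open Scope ring_scope.
Set Implicit Arguments.
Unset Strict Implicit.
Unset Printing Implicit Defensive.

(** * Calculus of C^k functions *)

(** Charts are the obstacle that shapes the proof. A nullity vector is given in some unspecified
    chart, for some unspecified metric of the class; a B-scalar has to serve all charts at once; a
    geodesic has to satisfy its equation in every chart. So the behaviour of Christoffel symbols,
    curvature and covariant acceleration under transition maps has to be known. For the Christoffel
    symbols it comes from the uniqueness of the torsion-free metric connection, and the other two
    laws follow by differentiation. Since [Ck_on] is built from directional derivatives, the chain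
    rule and the symmetry of second derivatives are obtained from the mean value theorem along
    segments. The numbers $B$ and $\bar B$ are never compared with each other: each $\phi$ is
    compared with the common Weyl tensor. In the same way, for constant nullity, $\phi$ is read off
    from $W$ and a local section, without passing through the smoothness of $B$. *)

Lemma open_near (T : topologicalType) (U : set T) (P : T -> Prop) y :
  open U -> (forall z, U z -> P z) -> U y -> \forall z \near y, P z.
Proof. by move=> oU UP Uy; apply: filterS UP _; exact: open_nbhs_nbhs. Qed.

Section Ck.
Context {R : realType} {V : normedModType R}.
Implicit Types (U : set V) (f g : V -> R) (k : nat) (x y v w : V).

(** The bridge to one real variable, which makes the mean value theorem applicable to directional
    derivatives. *)
Lemma is_derive_lineP f x v (t df : R) :
  is_derive (t *: v + x) v f df <->
  is_derive t 1 (fun h : R => f (h *: v + x)) df.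
Proof.
have E : (fun h : R => h^-1 *: ((f \o shift (t *: v + x)) (h *: v) -
    f (t *: v + x))) =
  (fun h : R => h^-1 *: (((fun h : R => f (h *: v + x)) \o shift t) (h *: 1)
    - f (t *: v + x))).
  by apply/funext => h /=; rewrite [h *: 1]mulr1 scalerDl addrA.
split=> -[d1 d2]; split.
- by move: d1; rewrite /derivable E.
- by move: d2; rewrite /derive E.
- by rewrite /derivable E; exact: d1.
- by rewrite /derive E; exact: d2.
Qed.

(** Only the derivative along [v] is assumed, so homogeneity in the direction comes from the
    one-variable chain rule with inner function [h * c]. *)
Lemma is_derive_scale f x v (c df : R) :
  is_derive x v f df -> is_derive x (c *: v) f (c * df).
Proof.
move=> H; have {}H : is_derive (0 *: v + x) v f df by rewrite scale0r add0r.
suff : is_derive (0 *: (c *: v) + x) (c *: v) f (c * df).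
  by rewrite scale0r add0r.
apply/is_derive_lineP.
have -> : (fun h : R => f (h *: (c *: v) + x)) =
   (fun h : R => f (h *: v + x)) \o (fun h : R => h * c).
  by apply/funext => h /=; rewrite scalerA.
have {}H : is_derive (0 * c) 1 (fun h : R => f (h *: v + x)) df.
  by rewrite mul0r; apply/is_derive_lineP; exact: H.
have [H1 H2] := H.
have [dc dcE] : is_derive (0 : R) 1 (fun h : R => h * c) c.
  have -> : (fun h : R => h * c) = c \*o id by apply/funext => h; rewrite mulrC.
  have d1 := @derivable_id R R 0 1.
  split; last by rewrite deriveMl ?derive_id ?mulr1.
  exact: (derivableM (@derivable_cst R R R c 0 1) d1).
split; first by apply/derivable1_diffP/differentiable_comp;
  apply/derivable1_diffP; [exact: dc|exact: H1].
by have := derive1_comp dc H1; rewrite !derive1E H2 dcE mulrC.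
Qed.

Lemma Ck_on_continuous k U f y : Ck_on k U f -> U y -> {for y, continuous f}.
Proof. by case: k => [|k] [H _]; exact: H. Qed.

Lemma Ck_on_derivable k U f y v : Ck_on k.+1 U f -> U y -> derivable f y v.
Proof. by move=> [_ /(_ v)[]] H _; exact: H. Qed.

Lemma Ck_on_derive k U f v : Ck_on k.+1 U f -> Ck_on k U ('D_v f).
Proof. by move=> [_ /(_ v)[]]. Qed.

Lemma Ck_onW k U f : Ck_on k.+1 U f -> Ck_on k U f.
Proof.
elim: k f => [|k IH] f [fc fd]; split => // v.
by split; [exact: (fd v).1|exact/IH/(fd v).2].
Qed.

Lemma Ck_on_sub k U U' f : U' `<=` U -> Ck_on k U f -> Ck_on k U' f.
Proof.
move=> sU; elim: k f => [|k IH] f [fc fd]; split => //.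
- by move=> y /sU/fc.
- by move=> y /sU/fc.
by move=> v; split; [move=> y /sU/(fd v).1|exact/IH/(fd v).2].
Qed.

Lemma open_near_eq U f g y : open U -> {in U, f =1 g} -> U y -> \near y, f y = g y.
Proof.
move=> oU fg Uy; have : nbhs y U by exact: open_nbhs_nbhs.
by apply: filterS => z Uz; apply: fg; rewrite inE.
Qed.

Lemma near_eq_continuous f g y :
  (\near y, f y = g y) -> {for y, continuous f} -> {for y, continuous g}.
Proof.
move=> fg; rewrite /prop_for /continuous_at -(nbhs_singleton fg).
by move=> H; exact: cvg_trans (near_eq_cvg fg) H.
Qed.

(** Openness turns equality on [U] into equality near each point, which is what derivatives see. *)
Lemma eq_Ck_on k U f g : open U -> {in U, f =1 g} -> Ck_on k U f -> Ck_on k U g.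
Proof.
move=> oU; elim: k f g => [|k IH] f g fg [fc fd]; split => //.
- by move=> y Uy; apply: near_eq_continuous (fc y Uy); exact: open_near_eq fg Uy.
- by move=> y Uy; apply: near_eq_continuous (fc y Uy); exact: open_near_eq fg Uy.
move=> v; split=> [y Uy|].
  by apply: near_eq_derivable ((fd v).1 y Uy); exact: open_near_eq fg Uy.
apply: IH (fd v).2 => y; rewrite inE => Uy.
by apply: near_eq_derive; exact: open_near_eq fg Uy.
Qed.

Lemma Ck_on_local k U f :
  (forall y, U y -> exists2 W, open W /\ W y & Ck_on k W f) -> Ck_on k U f.
Proof.
elim: k f => [|k IH] f H; split => //.
- by move=> y /H[W [oW Wy] [fc _]]; exact: fc.
- by move=> y /H[W [oW Wy] [fc _]]; exact: fc.
move=> v; split=> [y /H[W [oW Wy] fW]|]; first exact: Ck_on_derivable fW Wy.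
by apply: IH => y /H[W WW fW]; exists W => //; exact: Ck_on_derive.
Qed.

Lemma Ck_on_cst k U (a : R) : Ck_on k U (fun=> a).
Proof.
elim: k a => [|k IH] a; split => //; try by move=> y _; exact: cst_continuous.
move=> v; split=> [y _|]; first exact: derivable_cst.
by have -> : 'D_v (fun=> a) = (fun=> 0) by apply/funext => z; rewrite derive_cst.
Qed.

Lemma Ck_onD k U f g : open U -> Ck_on k U f -> Ck_on k U g ->
  Ck_on k U (fun z => f z + g z).
Proof.
move=> oU; elim: k f g => [|k IH] f g Hf Hg; split => //;
  try by move=> y Uy; apply: continuousD; [exact: Ck_on_continuous Hf Uy|exact: Ck_on_continuous Hg Uy].
move=> v; split=> [y Uy|].
  by apply: derivableD; [exact: Ck_on_derivable Hf Uy|exact: Ck_on_derivable Hg Uy].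
apply: eq_Ck_on (IH _ _ (Ck_on_derive v Hf) (Ck_on_derive v Hg)) => // y.
by rewrite inE => Uy; rewrite deriveD //; [exact: Ck_on_derivable Hf Uy|exact: Ck_on_derivable Hg Uy].
Qed.

Lemma Ck_onM k U f g : open U -> Ck_on k U f -> Ck_on k U g ->
  Ck_on k U (fun z => f z * g z).
Proof.
move=> oU; elim: k f g => [|k IH] f g Hf Hg; split => //;
  try by move=> y Uy; apply: continuousM; [exact: Ck_on_continuous Hf Uy|exact: Ck_on_continuous Hg Uy].
move=> v; split=> [y Uy|].
  by apply: derivableM; [exact: Ck_on_derivable Hf Uy|exact: Ck_on_derivable Hg Uy].
have H1 := IH _ _ (Ck_onW Hf) (Ck_on_derive v Hg).
have H2 := IH _ _ (Ck_onW Hg) (Ck_on_derive v Hf).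
apply: eq_Ck_on (Ck_onD oU H1 H2) => // y.
by rewrite inE => Uy; rewrite deriveM //; [exact: Ck_on_derivable Hf Uy|exact: Ck_on_derivable Hg Uy].
Qed.

Lemma Ck_onN k U f : open U -> Ck_on k U f -> Ck_on k U (fun z => - f z).
Proof.
move=> oU Hf; apply: eq_Ck_on (Ck_onM oU (Ck_on_cst k U (-1)) Hf) => // y _.
by rewrite mulN1r.
Qed.

Lemma Ck_onB k U f g : open U -> Ck_on k U f -> Ck_on k U g ->
  Ck_on k U (fun z => f z - g z).
Proof. by move=> oU Hf Hg; apply: Ck_onD => //; exact: Ck_onN. Qed.

Lemma Ck_on_sum k U (I : Type) (r : seq I) (P : pred I) (F : I -> V -> R) :
  open U -> (forall i, P i -> Ck_on k U (F i)) ->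
  Ck_on k U (fun z => \sum_(i <- r | P i) F i z).
Proof.
move=> oU HF; elim: r => [|i r IH].
  by apply: eq_Ck_on (Ck_on_cst k U 0) => // y _; rewrite big_nil.
have [Pi|Pi] := boolP (P i).
  by apply: eq_Ck_on (Ck_onD oU (HF _ Pi) IH) => // y _; rewrite big_cons Pi.
by apply: eq_Ck_on IH => // y _; rewrite big_cons (negbTE Pi).
Qed.

Lemma Ck_on_prod k U (I : Type) (r : seq I) (P : pred I) (F : I -> V -> R) :
  open U -> (forall i, P i -> Ck_on k U (F i)) ->
  Ck_on k U (fun z => \prod_(i <- r | P i) F i z).
Proof.
move=> oU HF; elim: r => [|i r IH].
  by apply: eq_Ck_on (Ck_on_cst k U 1) => // y _; rewrite big_nil.
have [Pi|Pi] := boolP (P i).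
  by apply: eq_Ck_on (Ck_onM oU (HF _ Pi) IH) => // y _; rewrite big_cons Pi.
by apply: eq_Ck_on IH => // y _; rewrite big_cons (negbTE Pi).
Qed.

Lemma Ck_onV k U f : open U -> (forall y, U y -> f y != 0) -> Ck_on k U f ->
  Ck_on k U (fun z => (f z)^-1).
Proof.
move=> oU f0; elim: k f f0 => [|k IH] f f0 Hf; split => //;
  try by move=> y Uy; apply: continuousV; [exact: f0|exact: Ck_on_continuous Hf Uy].
move=> v; split=> [y Uy|].
  by apply: derivableV; [exact: f0|exact: Ck_on_derivable Hf Uy].
have H1 := IH _ f0 (Ck_onW Hf).
have := Ck_onN oU (Ck_onM oU (Ck_onM oU H1 H1) (Ck_on_derive v Hf)).
apply: eq_Ck_on => // y.
rewrite inE => Uy; rewrite deriveV; first by rewrite scaleNr -expr2 exprVn.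
  exact: f0.
exact: Ck_on_derivable Hf Uy.
Qed.
End Ck.

(** * Symmetry of second derivatives *)

Section Schwarz.
Context {R : realType} {V : normedModType R}.
Implicit Types (U : set V) (f g : V -> R) (k : nat) (x y v w : V).

Lemma is_derive_translate f x v w (df : R) :
  is_derive (w + x) v f df -> is_derive x v (fun z => f (w + z)) df.
Proof.
have E : (fun h : R => h^-1 *: (((fun z => f (w + z)) \o shift x) (h *: v)
     - f (w + x))) =
    (fun h : R => h^-1 *: ((f \o shift (w + x)) (h *: v) - f (w + x))).
  by apply/funext => h /=; rewrite addrCA.
by move=> [d1 d2]; split; [rewrite /derivable E|rewrite /derive E].
Qed.

Lemma is_deriveBE f g x v (df dg : R) : is_derive x v f df ->
  is_derive x v g dg -> is_derive x v (fun z => f z - g z) (df - dg).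
Proof. by move=> H1 H2; exact: is_deriveB. Qed.

Lemma line_MVT f x v :
  (forall t : R, 0 <= t <= 1 -> derivable f (t *: v + x) v) ->
  exists2 t : R, 0 <= t <= 1 & f (v + x) - f x = 'D_v f (t *: v + x).
Proof.
move=> df; pose F (h : R) := f (h *: v + x).
have dF (t : R) : 0 <= t <= 1 -> is_derive t 1 F ('D_v f (t *: v + x)).
  by move=> /df /derivableP H; exact: (is_derive_lineP f x v t _).1 H.
have [| |c cI] := @MVT R F (fun t => 'D_v f (t *: v + x)) 0 1 ltr01.
- by move=> t; rewrite in_itv /= => /andP[t0 t1]; apply: dF; rewrite !ltW.
- by apply: derivable_within_continuous => t; rewrite in_itv /= => /dF [].
rewrite /F scale1r scale0r add0r subr0 mulr1 => E; exists c => //.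
by move: cI; rewrite in_itv /= => /andP[/ltW-> /ltW->].
Qed.

(** Two applications of the mean value theorem: to [f (w + z) - f z] along [v], then to ['D_v f]
    along [w]. *)
Lemma double_difference U f x v w : Ck_on 2 U f ->
  (forall s t : R, 0 <= s <= 1 -> 0 <= t <= 1 -> U (t *: w + (s *: v + x))) ->
  exists s t : R, [/\ 0 <= s <= 1, 0 <= t <= 1 &
    f (w + (v + x)) - f (v + x) - (f (w + x) - f x) =
    'D_w ('D_v f) (t *: w + (s *: v + x))].
Proof.
move=> Cf HU.
have i0 : (0 : R) <= (0 : R) <= 1 by apply/andP; split => //; exact: ler01.
have i1 : (0 : R) <= (1 : R) <= 1 by apply/andP; split => //; exact: ler01.
pose phi z := f (w + z) - f z.
have dphi (s : R) : 0 <= s <= 1 -> is_derive (s *: v + x) v phi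
    ('D_v f (w + (s *: v + x)) - 'D_v f (s *: v + x)).
  move=> sI.
  have D z : U z -> is_derive z v f ('D_v f z).
    by move=> Uz; apply/derivableP; exact: Ck_on_derivable Cf Uz.
  apply: is_deriveBE.
    apply/is_derive_translate/D.
    by have := HU s 1 sI i1; rewrite scale1r.
  by apply: D; have := HU s 0 sI i0; rewrite scale0r add0r.
have [|s sI E] := @line_MVT phi x v; first by move=> t /dphi[].
have [|t tI E'] := @line_MVT ('D_v f) (s *: v + x) w.
  by move=> t tI; exact: Ck_on_derivable (Ck_on_derive v Cf) (HU _ _ sI tI).
exists s, t; split => //; rewrite -E' -(@derive_val _ _ _ _ _ _ _ (dphi s sI)) -E.
by [].
Qed.

Lemma derive_scale2 U f y v w (h : R) : open U -> Ck_on 2 U f -> U y ->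
  'D_(h *: w) ('D_(h *: v) f) y = h * (h * 'D_w ('D_v f) y).
Proof.
move=> oU Cf Uy.
have D2 : is_derive y (h *: w) ('D_v f) (h * 'D_w ('D_v f) y).
  apply: is_derive_scale; apply/derivableP.
  exact: Ck_on_derivable (Ck_on_derive v Cf) Uy.
have -> : 'D_(h *: w) ('D_(h *: v) f) y = 'D_(h *: w) (h \*o 'D_v f) y.
  apply/near_eq_derive/(open_near_eq oU) => // z; rewrite inE => Uz /=.
  have /derivableP := Ck_on_derivable (v := v) Cf Uz.
  by move=> /(is_derive_scale h) H; rewrite derive_val.
by rewrite deriveMl ?derive_val.
Qed.

Lemma nbhs_norm_ex (y : V) (P : V -> Prop) : (\near y, P y) ->
  exists2 r : R, 0 < r & forall z, `|z| < r -> P (z + y).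
Proof.
move=> /nbhs_normP[r /= r0 H]; exists r => // z zr; apply: H.
by rewrite /ball_ /= opprD addrCA subrr addr0 normrN.
Qed.

(** The second difference over a small parallelogram is symmetric in the two sides, so each mixed
    derivative, at some point of the parallelogram, takes the same value; continuity at [y]
    concludes. *)
Lemma schwarz U f y v w : open U -> Ck_on 2 U f -> U y ->
  'D_v ('D_w f) y = 'D_w ('D_v f) y.
Proof.
move=> oU Cf Uy; apply/eqP; rewrite -subr_eq0 -normr_le0; apply/ler_addgt0Pr => e e0.
rewrite add0r.
set a := 'D_v ('D_w f); set b := 'D_w ('D_v f).
have Ca : {for y, continuous a}.
  exact: (Ck_on_continuous (Ck_on_derive v (Ck_on_derive w Cf)) Uy).
have Cb : {for y, continuous b}.
  exact: (Ck_on_continuous (Ck_on_derive w (Ck_on_derive v Cf)) Uy).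
have e2 : 0 < e / 2 by rewrite divr_gt0.
have /nbhs_norm_ex[r r0 Hr] : \forall z \near y,
    [/\ U z, `|a y - a z| < e / 2 & `|b y - b z| < e / 2].
  have NU := open_nbhs_nbhs (conj oU Uy).
  have Na := (@cvgrPdist_lt _ _ _ _ _ _ _).1 Ca _ e2.
  have Nb := (@cvgrPdist_lt _ _ _ _ _ _ _).1 Cb _ e2.
  exact: filterS3 (fun z A B C => And3 A B C) NU (Na _) (Nb _).
(* The scale [h] puts the parallelogram with sides [h *: v] and [h *: w] inside the ball of radius
   [r]; the [+ 1] in the witness covers [v = w = 0]. *)
have [h h0 hr] : exists2 h : R, 0 < h & h * (`|v| + `|w|) < r.
  have q0 : 0 < `|v| + `|w| + 1 by rewrite ltr_wpDl ?addr_ge0.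
  exists (r / (`|v| + `|w| + 1)); first by rewrite divr_gt0.
  by rewrite mulrAC ltr_pdivrMr // ltr_pM2l // ltrDl.
(* Stated for any [v'], [w'] with the same sum of norms, because the second differences below use
   [v] and [w] in both orders. *)
have small (v' w' : V) (s t : R) : `|v'| + `|w'| = `|v| + `|w| ->
    0 <= s <= 1 -> 0 <= t <= 1 ->
    `|t *: (h *: w') + (s *: (h *: v'))| < r.
  move=> E /andP[s0 s1] /andP[t0 t1]; apply: le_lt_trans hr.
  rewrite (le_trans (ler_normD _ _)) // !normrZ (ger0_norm s0) (ger0_norm t0).
  rewrite (gtr0_norm h0) -E mulrDr addrC lerD // ler_piMl ?mulr_ge0 // ltW //.
have HU v' w' : `|v'| + `|w'| = `|v| + `|w| -> forall s t : R,
    0 <= s <= 1 -> 0 <= t <= 1 ->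
    U (t *: (h *: w') + (s *: (h *: v') + y)).
  by move=> E s t sI tI; rewrite addrA; case: (Hr _ (small _ _ _ _ E sI tI)).
have vw : `|w| + `|v| = `|v| + `|w| by rewrite addrC.
have [s [t [sI tI E1]]] := double_difference Cf (HU v w erefl).
have [s' [t' [sI' tI' E2]]] := double_difference Cf (HU w v vw).
have [_ _ Hb] := Hr _ (small _ _ _ _ erefl sI tI).
have [_ Ha _] := Hr _ (small _ _ _ _ vw sI' tI').
have E : a (t' *: (h *: v) + (s' *: (h *: w) + y)) =
         b (t *: (h *: w) + (s *: (h *: v) + y)).
  apply: (@mulfI _ h); first by rewrite gt_eqF.
  apply: (@mulfI _ h); first by rewrite gt_eqF.
  have E1' := etrans E1 (derive_scale2 v w h oU Cf (HU v w erefl _ _ sI tI)).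
  have E2' := etrans E2 (derive_scale2 w v h oU Cf (HU w v vw _ _ sI' tI')).
  rewrite -[LHS]E2' -[RHS]E1' (addrCA (h *: w) (h *: v)).
  by ring.
move: Ha Hb; rewrite -!addrA E; move: (b (t *: _ + _)) => q Ha Hb.
apply: (le_trans (ler_distD q _ _)); apply: ltW; rewrite (splitr e).
by apply: ltrD; [exact: Ha|rewrite distrC; exact: Hb].
Qed.
End Schwarz.

(** * Strict differentiability of C^1 functions of several variables *)

Section RowFunctions.
Context {R : realType} {n : nat}.
Implicit Types (W : set 'rV[R]_n) (f : 'rV[R]_n -> R) (x y a b c : 'rV[R]_n).

Lemma rV_norm_ltP x (r : R) : 0 < r -> (`|x| < r) <-> (forall i, `|x 0 i| < r).
Proof.
move=> r0; rewrite [`|x|]/(Num.Def.normr x) /= mx_normrE; split.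
  by move=> /bigmax_ltP[_ H] i; exact: (H (0, i)).
by move=> H; apply/bigmax_ltP; split => // -[i j] _ /=; rewrite (ord1 i).
Qed.

Lemma rV_norm_leP x (r : R) : 0 <= r -> (forall i, `|x 0 i| <= r) -> `|x| <= r.
Proof.
move=> r0 H; rewrite [`|x|]/(Num.Def.normr x) /= mx_normrE.
by apply/bigmax_leP; split => // -[i j] _ /=; rewrite (ord1 i).
Qed.

Lemma rV_coord_le x i : `|x 0 i| <= `|x|.
Proof.
by rewrite [`|x|]/(Num.Def.normr x) /= mx_normrE; exact: (le_bigmax _ (fun ij => `|x ij.1 ij.2|) (0, i)).
Qed.

(** The vertices of the path from [b] to [c] parallel to the axes: [stair b c k] and
    [stair b c k.+1] differ in coordinate [k] only. *)
Definition stair b c k : 'rV[R]_n := \row_i if (i < k)%N then c 0 i else b 0 i.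

(** The estimate is uniform in both endpoints. The mean value theorem on each edge of the staircase
    produces a partial derivative at a nearby point, which continuity replaces by the one at [a]. *)
Lemma strictly_differentiable W f a : Ck_on 1 W f -> open W -> W a ->
  forall e : R, 0 < e -> exists2 r : R, 0 < r &
  forall b c, `|b - a| < r -> `|c - a| < r -> W b /\
   `|f c - f b - \sum_i (c 0 i - b 0 i) * partial i f a| <=
     e * \sum_i `|c 0 i - b 0 i|.
Proof.
move=> Cf oW Wa e e0.
have /nbhs_norm_ex[r r0 Hr] : \forall z \near a,
    W z /\ forall i, `|partial i f a - partial i f z| < e.
  have NW := open_nbhs_nbhs (conj oW Wa).
  have Nd : \forall z \near a, forall i, `|partial i f a - partial i f z| < e.
    suff H i : \forall z \near a, `|partial i f a - partial i f z| < e.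
      exact: filter_forall H.
    have Ca := Ck_on_continuous (Ck_on_derive (delta_mx 0 i) Cf) Wa.
    by move/cvgrPdist_lt : Ca => /(_ _ e0).
  exact: filterS2 (fun z A B => conj A B) NW Nd.
have {}Hr z : `|z - a| < r -> W z /\ forall i, `|partial i f a - partial i f z| < e.
  by move=> /Hr; rewrite subrK.
exists r => // b c br cr; split; first exact: (Hr b br).1.
have {}br i : `|b 0 i - a 0 i| < r.
  by move: br => /(rV_norm_ltP _ r0)/(_ i); rewrite !mxE.
have {}cr i : `|c 0 i - a 0 i| < r.
  by move: cr => /(rV_norm_ltP _ r0)/(_ i); rewrite !mxE.
have step (k : 'I_n) : exists2 p, `|partial k f a - partial k f p| < e &
    f (stair b c k.+1) - f (stair b c k) = (c 0 k - b 0 k) * partial k f p.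
  set d := c 0 k - b 0 k.
  have E : stair b c k.+1 = d *: delta_mx 0 k + stair b c k.
    apply/rowP => i; rewrite !mxE eqxx /= ltnS leq_eqVlt -val_eqE /=.
    by case: eqP => [/val_inj->|]; rewrite ?ltnn /= ?mulr1 ?subrK // mulr0 add0r.
  (* The norm is the maximum norm, so balls are cubes: each coordinate of a point of the edge is
     that of [b], that of [c], or a convex combination of the two. *)
  have B (t : R) : 0 <= t <= 1 ->
      `|t *: (d *: delta_mx 0 k) + stair b c k - a| < r.
    move=> /andP[t0 t1]; apply/(rV_norm_ltP _ r0) => i; rewrite !mxE eqxx /=.
    case: eqP => [->|_] /=; last first.
      by rewrite !mulr0 add0r; case: ifP.
    rewrite ltnn mulr1 /d.
    have -> : t * (c 0 k - b 0 k) + b 0 k - a 0 k =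
      t * (c 0 k - a 0 k) + (1 - t) * (b 0 k - a 0 k) by ring.
    apply: (le_lt_trans (ler_normD _ _)); rewrite !normrM (ger0_norm t0).
    rewrite (ger0_norm (_ : 0 <= 1 - t)) ?subr_ge0 //.
    have := br k; have := cr k; move: `|_| `|_| => B C Cr Br.
    have [->|tn0] := eqVneq t 0; first by rewrite mul0r add0r subr0 mul1r.
    have : t * C < t * r by rewrite ltr_pM2l // lt_neqAle eq_sym tn0.
    have : (1 - t) * B <= (1 - t) * r by rewrite ler_wpM2l ?subr_ge0 // ltW.
    lra.
  have D z : `|z - a| < r -> is_derive z (d *: delta_mx 0 k) f (d * partial k f z).
    move=> /Hr[Wz _]; apply: is_derive_scale; apply/derivableP.
    exact: Ck_on_derivable Cf Wz.
  have [|t tI Et] := @line_MVT _ _ f (stair b c k) (d *: delta_mx 0 k).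
    by move=> t /B/D[].
  exists (t *: (d *: delta_mx 0 k) + stair b c k); first by case: (Hr _ (B t tI)).
  by rewrite E Et; have [_ ->] := D _ (B t tI).
have sE : f c - f b = \sum_(i < n) (f (stair b c i.+1) - f (stair b c i)).
  rewrite -(big_mkord xpredT (fun i => f (stair b c i.+1) - f (stair b c i))).
  rewrite telescope_sumr //; congr (f _ - f _); apply/rowP => i; rewrite !mxE //.
  by rewrite ltn_ord.
rewrite sE -sumrB mulr_sumr (le_trans (ler_norm_sum _ _ _)) //.
apply: ler_sum => i _; have [p pe ->] := step i.
by rewrite -mulrBr normrM mulrC distrC ler_wpM2r // ltW.
Qed.

End RowFunctions.

(** * The chain rule *)

Section ChainRule.
Context {R : realType} {V : normedModType R} {n : nat}.
Implicit Types (W : set 'rV[R]_n) (U : set V) (f : 'rV[R]_n -> R) (phi : V -> 'rV[R]_n).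

Lemma is_deriveP (f : V -> R) (y v : V) (df : R) : is_derive y v f df <->
  h^-1 * (f (h *: v + y) - f y) @[h --> 0^'] --> df.
Proof.
split=> [[H <-]|H]; first exact: H.
by split; [apply/cvg_ex; exists df|exact/cvg_lim].
Qed.

Lemma row_continuous (T : topologicalType) (phi : T -> 'rV[R]_n) (y : T) :
  (forall i, {for y, continuous (fun z => phi z 0 i)}) -> {for y, continuous phi}.
Proof.
move=> H; apply/cvgrPdist_lt => e e0.
suff K : \forall z \near y, forall i, `|phi y 0 i - phi z 0 i| < e.
  apply: filterS K => z Hz; apply/(rV_norm_ltP _ e0) => i.
  by rewrite !mxE.
suff K i : \forall z \near y, `|phi y 0 i - phi z 0 i| < e.
  exact: filter_forall K.
by have /cvgrPdist_lt/(_ _ e0) := H i.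
Qed.

Lemma cvg_sumr (T : Type) (F : set_system T) {FF : Filter F} (m : nat)
    (u : 'I_m -> T -> R) (l : 'I_m -> R) : (forall i, u i x @[x --> F] --> l i) ->
  \sum_i u i x @[x --> F] --> \sum_i l i.
Proof.
move=> H; elim: (index_enum _) => [|i s IH].
  by rewrite big_nil; under eq_fun do rewrite big_nil; exact: cvg_cst.
rewrite big_cons; under eq_fun do rewrite big_cons.
by apply: cvgD => //; exact: H.
Qed.

(** Strict differentiability of [f] at [phi y] bounds the remainder by a small multiple of the
    increments of the coordinates of [phi]; after division by [h] these are the difference quotients
    [q i h], bounded near 0. *)
Lemma is_derive_comp W f phi (y v : V) (d : 'I_n -> R) :
  open W -> Ck_on 1 W f -> W (phi y) -> {for y, continuous phi} ->
  (forall i, is_derive y v (fun z => phi z 0 i) (d i)) ->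
  is_derive y v (fun z => f (phi z)) (\sum_i d i * partial i f (phi y)).
Proof.
move=> oW Cf Wy cphi Hd; apply/is_deriveP.
pose q i (h : R) := h^-1 * (phi (h *: v + y) 0 i - phi y 0 i).
have Hq i : q i h @[h --> 0^'] --> d i by exact: (is_deriveP _ _ _ _).1 (Hd i).
have Hs : \sum_i (q i h * partial i f (phi y)) @[h --> 0^'] -->
    \sum_i d i * partial i f (phi y).
  by apply: cvg_sumr => i; apply: cvgM; [exact: Hq|exact: cvg_cst].
have Hn : \sum_i `|q i h| @[h --> 0^'] --> \sum_i `|d i|.
  by apply: cvg_sumr => i; apply: cvg_norm; exact: Hq.
apply/cvgrPdist_lt => e e0.
(* [K] bounds the sum of the [|q i h|] for small [h]. Half of [e] goes to the remainder, hence
   [e / 2 / K], and half to the convergence of the linear part. *)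
set K := \sum_i `|d i| + 1.
have K0 : 0 < K by rewrite ltr_wpDl // sumr_ge0.
have e'0 : 0 < e / 2 / K by rewrite !divr_gt0.
have [r r0 Hr] := strictly_differentiable Cf oW Wy e'0.
have N1 : \forall h \near 0^', `|phi (h *: v + y) - phi y| < r.
  apply: (@cvg_within _ (nbhs (0 : R))).
  have : \forall z \near y, `|phi z - phi y| < r.
    have /cvgrPdist_lt/(_ _ r0) := cphi.
    by apply: filterS => z; rewrite distrC.
  move=> /nbhs_norm_ex[s s0 Hs0].
  have : \forall z \near (0 : V), `|phi (z + y) - phi y| < r.
    apply/nbhs_normP; exists s => // z; rewrite /ball_ /= sub0r normrN.
    exact: Hs0.
  exact: near0Z.
have N2 : \forall h \near 0^', \sum_i `|q i h| < K.
  have /cvgrPdist_lt/(_ _ ltr01) := Hn.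
  by apply: filterS => h; rewrite distrC ltr_distl => /andP[].
have N3 : \forall h \near 0^', `|\sum_i d i * partial i f (phi y) -
    \sum_i (q i h * partial i f (phi y))| < e / 2.
  by have /cvgrPdist_lt/(_ _ (divr_gt0 e0 (ltr0Sn _ 1))) := Hs.
have N0 : \forall h \near 0^', h != 0 :> R by exact: nbhs_dnbhs_neq.
near=> h.
have h0 : h != 0 by near: h.
have n1 : `|phi (h *: v + y) - phi y| < r by near: h.
have n2 : \sum_i `|q i h| < K by near: h.
have n3 : `|\sum_i d i * partial i f (phi y) -
    \sum_i (q i h * partial i f (phi y))| < e / 2 by near: h.
have nr : `|phi y - phi y| < r by rewrite subrr normr0.
have [_ E] := Hr (phi y) (phi (h *: v + y)) nr n1.
have D i : phi (h *: v + y) 0 i - phi y 0 i = h * q i h by rewrite mulVKf.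
clearbody q.
have S1 : \sum_i (phi (h *: v + y) 0 i - phi y 0 i) * partial i f (phi y) =
    \sum_i h * (q i h * partial i f (phi y)).
  by apply: eq_bigr => i _; rewrite D mulrA.
have S2 : \sum_i `|phi (h *: v + y) 0 i - phi y 0 i| = \sum_i `|h| * `|q i h|.
  by apply: eq_bigr => i _; rewrite D normrM.
rewrite S1 S2 in E.
rewrite -!mulr_sumr in E.
apply: le_lt_trans (ler_distD (\sum_i (q i h * partial i f (phi y))) _ _) _.
rewrite (splitr e) ltrD ////.
rewrite distrC -(@ltr_pM2l _ `|h|) ?normr_gt0 // -normrM mulrBr mulrA mulfV //.
rewrite mul1r (le_lt_trans E) // mulrCA ltr_pM2l ?normr_gt0 //.
have E2 : e / 2 = e / 2 / K * K by rewrite divfK // gt_eqF.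
by rewrite [X in _ < X]E2 ltr_pM2l //.
Unshelve. all: by end_near. Qed.

End ChainRule.

Section DeriveRules.
Context {R : realType} {V : normedModType R}.
Implicit Types (f g : V -> R) (y v : V).

Lemma is_deriveDE f g y v (df dg : R) : is_derive y v f df ->
  is_derive y v g dg -> is_derive y v (fun z => f z + g z) (df + dg).
Proof. by move=> H1 H2; exact: is_deriveD. Qed.

Lemma is_derive_cstE (a : R) y v : is_derive y v (fun=> a) 0.
Proof. exact: is_derive_cst. Qed.

Lemma is_deriveME f g y v (df dg : R) : is_derive y v f df ->
  is_derive y v g dg -> is_derive y v (fun z => f z * g z) (df * g y + f y * dg).
Proof.
move=> H1 H2; rewrite addrC [df * _]mulrC.
exact: (is_deriveM (f := f) (g := g)).
Qed.

Lemma is_derive_sumE (I : Type) (r : seq I) (F : I -> V -> R) (dF : I -> R) y v :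
  (forall i, is_derive y v (F i) (dF i)) ->
  is_derive y v (fun z => \sum_(i <- r) F i z) (\sum_(i <- r) dF i).
Proof.
move=> H; elim: r => [|i r IH].
  have -> : (fun z => \sum_(i <- [::]) F i z) = cst 0.
    by apply/funext => z; rewrite big_nil.
  by rewrite big_nil; exact: is_derive_cst.
have -> : (fun z => \sum_(j <- i :: r) F j z) = (fun z => F i z + \sum_(j <- r) F j z).
  by apply/funext => z; rewrite big_cons.
by rewrite big_cons; apply: is_deriveDE.
Qed.

Lemma is_derive_coord (n : nat) (y v : 'rV[R]_n) (i : 'I_n) :
  is_derive y v (fun z : 'rV[R]_n => z 0 i) (v 0 i).
Proof.
apply/is_deriveP; apply: (@cvg_trans _ ((fun=> v 0 i) @ 0^')); last exact: cvg_cst.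
apply: near_eq_cvg; near=> h; rewrite !mxE addrK mulKf //.
by near: h; exact: nbhs_dnbhs_neq.
Unshelve. all: by end_near. Qed.

End DeriveRules.

Section Composition.
Context {R : realType} {V : normedModType R} {n : nat}.
Implicit Types (W : set 'rV[R]_n) (U : set V) (f : 'rV[R]_n -> R) (phi : V -> 'rV[R]_n).

(** By induction for all [f] at once: the derivative of the composite is a sum of products of
    derivatives of [phi] with [partial i f] composed with [phi]. *)
Lemma Ck_on_comp k U W f phi : open U -> open W ->
  (forall y, U y -> W (phi y)) -> Ck_on k W f ->
  (forall i, Ck_on k U (fun z => phi z 0 i)) -> Ck_on k U (fun z => f (phi z)).
Proof.
move=> oU oW UW.
have cont j f' y : Ck_on j W f' -> (forall i, Ck_on j U (fun z => phi z 0 i)) ->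
    U y -> {for y, continuous (fun z => f' (phi z))}.
  move=> Cf Cphi Uy; apply: continuous_comp.
    by apply: row_continuous => i; exact: Ck_on_continuous (Cphi i) Uy.
  exact: Ck_on_continuous Cf (UW _ Uy).
elim: k f => [|k IH] f Cf Cphi; split => //.
- by move=> y Uy; exact: cont Cf Cphi Uy.
- by move=> y Uy; exact: cont Cf Cphi Uy.
have Cf1 : Ck_on 1 W f.
  by move: Cf; elim: (k) => // j IHj H; apply: IHj; exact: Ck_onW.
have D v y : U y -> is_derive y v (fun z => f (phi z))
    (\sum_i 'D_v (fun z => phi z 0 i) y * partial i f (phi y)).
  move=> Uy; apply: is_derive_comp oW Cf1 (UW _ Uy) _ _.
    by apply: row_continuous => i; exact: Ck_on_continuous (Cphi i) Uy.
  by move=> i; apply/derivableP; exact: Ck_on_derivable (Cphi i) Uy.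
move=> v; split=> [y /(D v)[]//|].
apply: (@eq_Ck_on _ _ _ _ (fun y => \sum_i 'D_v (fun z => phi z 0 i) y * partial i f (phi y))) => //.
  by move=> y; rewrite inE => /(D v)[_ ->].
apply: Ck_on_sum => // i _; apply: Ck_onM => //; first exact: Ck_on_derive (Cphi i).
by apply: IH => [|j]; [exact: Ck_on_derive|exact: Ck_onW].
Qed.

End Composition.

Section Smooth.
Context {R : realType} {V : normedModType R}.
Implicit Types (U : set V) (f g : V -> R) (v y : V).

Lemma smooth_derivable U f y v : smooth_on U f -> U y -> is_derive y v f ('D_v f y).
Proof. by move=> /(_ 1%N) Cf Uy; apply/derivableP; exact: Ck_on_derivable Cf Uy. Qed.

Lemma smooth_continuous U f y : smooth_on U f -> U y -> {for y, continuous f}.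
Proof. by move=> /(_ 0%N) Cf Uy; exact: Ck_on_continuous Cf Uy. Qed.

Lemma smooth_derive U f v : smooth_on U f -> smooth_on U ('D_v f).
Proof. by move=> Sf k; exact: Ck_on_derive (Sf k.+1). Qed.

Lemma smooth_cst U (a : R) : smooth_on U (fun=> a).
Proof. by move=> k; exact: Ck_on_cst. Qed.

Lemma smoothD U f g : open U -> smooth_on U f -> smooth_on U g ->
  smooth_on U (fun z => f z + g z).
Proof. by move=> oU Sf Sg k; exact: Ck_onD. Qed.

Lemma smoothB U f g : open U -> smooth_on U f -> smooth_on U g ->
  smooth_on U (fun z => f z - g z).
Proof. by move=> oU Sf Sg k; exact: Ck_onB. Qed.

Lemma smoothN U f : open U -> smooth_on U f -> smooth_on U (fun z => - f z).
Proof. by move=> oU Sf k; exact: Ck_onN. Qed.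

Lemma smoothM U f g : open U -> smooth_on U f -> smooth_on U g ->
  smooth_on U (fun z => f z * g z).
Proof. by move=> oU Sf Sg k; exact: Ck_onM. Qed.

Lemma smoothV U f : open U -> (forall y, U y -> f y != 0) -> smooth_on U f ->
  smooth_on U (fun z => (f z)^-1).
Proof. by move=> oU f0 Sf k; exact: Ck_onV. Qed.

Lemma smooth_sum U (I : Type) (r : seq I) (P : pred I) (F : I -> V -> R) :
  open U -> (forall i, smooth_on U (F i)) ->
  smooth_on U (fun z => \sum_(i <- r | P i) F i z).
Proof. by move=> oU SF k; apply: Ck_on_sum => // i _; exact: SF. Qed.

Lemma smooth_prod U (I : Type) (r : seq I) (P : pred I) (F : I -> V -> R) :
  open U -> (forall i, smooth_on U (F i)) ->
  smooth_on U (fun z => \prod_(i <- r | P i) F i z).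
Proof. by move=> oU SF k; apply: Ck_on_prod => // i _; exact: SF. Qed.

Lemma eq_smooth U f g : open U -> {in U, f =1 g} -> smooth_on U f -> smooth_on U g.
Proof. by move=> oU fg Sf k; exact: eq_Ck_on fg (Sf k). Qed.

Lemma smooth_sub U U' f : U' `<=` U -> smooth_on U f -> smooth_on U' f.
Proof. by move=> sU Sf k; exact: Ck_on_sub sU (Sf k). Qed.

Lemma smooth_local U f :
  (forall y, U y -> exists2 W, open W /\ W y & smooth_on W f) -> smooth_on U f.
Proof.
by move=> H k; apply: Ck_on_local => y /H[W WW Sf]; exists W.
Qed.

Lemma smooth_comp (n : nat) U (W : set 'rV[R]_n) (f : 'rV[R]_n -> R)
    (phi : V -> 'rV[R]_n) : open U -> open W ->
  (forall y, U y -> W (phi y)) -> smooth_on W f ->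
  (forall i, smooth_on U (fun z => phi z 0 i)) -> smooth_on U (fun z => f (phi z)).
Proof. by move=> oU oW UW Sf Sphi k; apply: Ck_on_comp oU oW UW (Sf k) _ => i; exact: Sphi. Qed.

End Smooth.

(** * Matrix-valued functions *)

Section SmoothMatrix.
Context {R : realType} {V : normedModType R}.
Implicit Types (U : set V) (v y : V).

Definition smooth_mx m n U (A : V -> 'M[R]_(m, n)) :=
  forall i j, smooth_on U (fun z => A z i j).

Lemma smooth_det m U (A : V -> 'M[R]_m) : open U -> smooth_mx U A ->
  smooth_on U (fun z => \det (A z)).
Proof.
move=> oU SA; apply: smooth_sum => // s; apply: smoothM => //.
  exact: smooth_cst.
by apply: smooth_prod => // i; exact: SA.
Qed.

Lemma smooth_mulmx m n p U (A : V -> 'M[R]_(m, n)) (B : V -> 'M[R]_(n, p)) :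
  open U -> smooth_mx U A -> smooth_mx U B -> smooth_mx U (fun z => A z *m B z).
Proof.
move=> oU SA SB i j; under eq_fun do rewrite mxE.
by apply: smooth_sum => // k; apply: smoothM; [|exact: SA|exact: SB].
Qed.

(** Cramer's rule reduces the inverse to determinants. *)
Lemma smooth_invmx m U (A : V -> 'M[R]_m) : open U ->
  (forall y, U y -> A y \in unitmx) -> smooth_mx U A ->
  smooth_mx U (fun z => invmx (A z)).
Proof.
move=> oU uA SA i j.
apply: (@eq_smooth _ _ _ (fun z => (\det (A z))^-1 * ((-1) ^+ (j + i) *
    \det (row' j (col' i (A z)))))) => //.
  by move=> y; rewrite inE => Uy; rewrite /invmx uA // !mxE.
apply: smoothM => //.
  apply: smoothV => //; last exact: smooth_det.
  by move=> y /uA; rewrite unitmxE unitfE.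
apply: smoothM => //; first exact: smooth_cst.
apply: smooth_det => // k l; under eq_fun do rewrite !mxE.
exact: SA.
Qed.

Lemma smooth_mx_cst m n U (A : 'M[R]_(m, n)) : smooth_mx U (fun=> A).
Proof. by move=> i j; exact: smooth_cst. Qed.

Definition mxderive m n v (A : V -> 'M[R]_(m, n)) y : 'M[R]_(m, n) :=
  \matrix_(i, j) 'D_v (fun z => A z i j) y.

(** A relation, like [is_derive]: it carries derivability with the value, so that the sum and
    product rules chain without side conditions. *)
Definition is_mxderive m n y v (A : V -> 'M[R]_(m, n)) (dA : 'M[R]_(m, n)) :=
  forall i j, is_derive y v (fun z => A z i j) (dA i j).

Lemma is_mxderiveE m n y v (A : V -> 'M[R]_(m, n)) (dA : 'M[R]_(m, n)) :
  is_mxderive y v A dA -> mxderive v A y = dA.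
Proof. by move=> H; apply/matrixP => i j; rewrite mxE; have [_ ->] := H i j. Qed.

Lemma smooth_is_mxderive m n U (A : V -> 'M[R]_(m, n)) y v :
  smooth_mx U A -> U y -> is_mxderive y v A (mxderive v A y).
Proof. by move=> SA Uy i j; rewrite mxE; exact: smooth_derivable (SA i j) Uy. Qed.

Lemma smooth_mxderive m n U (A : V -> 'M[R]_(m, n)) v :
  smooth_mx U A -> smooth_mx U (mxderive v A).
Proof.
move=> SA i j; rewrite (_ : (fun z => _) = 'D_v (fun z => A z i j)).
  exact: smooth_derive (SA i j).
by apply/funext => z; rewrite mxE.
Qed.

Lemma is_mxderiveD m n y v (A B : V -> 'M[R]_(m, n)) (dA dB : 'M[R]_(m, n)) :
  is_mxderive y v A dA -> is_mxderive y v B dB ->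
  is_mxderive y v (fun z => A z + B z) (dA + dB).
Proof.
move=> HA HB i j; rewrite mxE; under eq_fun do rewrite mxE.
exact: is_deriveDE.
Qed.

Lemma is_mxderiveM m n p y v (A : V -> 'M[R]_(m, n)) (B : V -> 'M[R]_(n, p)) dA dB :
  is_mxderive y v A dA -> is_mxderive y v B dB ->
  is_mxderive y v (fun z => A z *m B z) (dA *m B y + A y *m dB).
Proof.
move=> HA HB i j; rewrite !mxE -big_split /=; under eq_fun do rewrite mxE.
by apply: is_derive_sumE => k; exact: is_deriveME.
Qed.

Lemma is_mxderive_tr m n y v (A : V -> 'M[R]_(m, n)) dA :
  is_mxderive y v A dA -> is_mxderive y v (fun z => (A z)^T) dA^T.
Proof. by move=> HA i j; rewrite mxE; under eq_fun do rewrite mxE; exact: HA. Qed.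

Lemma is_mxderive_near m n y v (A B : V -> 'M[R]_(m, n)) dA :
  (\near y, A y = B y) -> is_mxderive y v A dA -> is_mxderive y v B dA.
Proof.
move=> AB HA i j; apply: near_eq_is_derive (HA i j).
by apply: filterS AB => z ->.
Qed.

Lemma is_mxderive_unique m n y v (A : V -> 'M[R]_(m, n)) dA dA' :
  is_mxderive y v A dA -> is_mxderive y v A dA' -> dA = dA'.
Proof. by move=> /is_mxderiveE <- /is_mxderiveE. Qed.

Lemma mxderive_schwarz m n U (A : V -> 'M[R]_(m, n)) y v w : open U ->
  smooth_mx U A -> U y ->
  mxderive v (mxderive w A) y = mxderive w (mxderive v A) y.
Proof.
move=> oU SA Uy; apply/matrixP => i j.
have E u : (fun z => mxderive u A z i j) = 'D_u (fun z => A z i j).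
  by apply/funext => z; exact: mxE.
have E2 u u' : mxderive u (mxderive u' A) y i j = 'D_u ('D_u' (fun z => A z i j)) y.
  by rewrite -E; exact: mxE.
exact: etrans (E2 v w) (etrans (schwarz v w oU (SA i j 2%N) Uy) (esym (E2 w v))).
Qed.

End SmoothMatrix.

(** * Ordinary differential equations *)

Section Picard.
Context {R : realType}.
Implicit Types (h f : R -> R) (T K t s : R).

(** Integrating from [a < 0] instead of 0 makes the derivative two-sided at 0 and at negative times;
    subtracting [F 0] restores the initial value. *)
Lemma antiderivative h (a : R) : continuous h -> a < 0 ->
  exists H : R -> R, H 0 = 0 /\ forall t, a < t -> is_derive t 1 H (h t).
Proof.
move=> ch a0.
pose F (x : R) := (\int[@lebesgue_measure R]_(t in [set` `[a, x]]) (h t))%R.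
exists (fun x => F x - F 0); split=> [|t at_]; first by rewrite subrr.
have tu : t < t + 1 by rewrite ltrDl.
have hi : (@lebesgue_measure R).-integrable `[a, t + 1] (EFin \o h).
  apply: continuous_compact_integrable; first exact: segment_compact.
  exact: continuous_subspaceT.
have [d1 d2] := continuous_FTC1_closed tu hi at_ (ch t).
have H : is_derive t 1 F (h t).
  by split; [exact: d1|rewrite -derive1E; exact: d2].
rewrite -[h t]subr0; apply: is_deriveBE => //; exact: is_derive_cst.
Qed.

Lemma derive_bound_lipschitz f (f' : R -> R) T K :
  (forall s, `|s| <= T -> is_derive s 1 f (f' s)) ->
  (forall s, `|s| <= T -> `|f' s| <= K) ->
  forall t s, `|t| <= T -> `|s| <= T -> `|f t - f s| <= K * `|t - s|.
Proof.
move=> df f'K t s tT sT.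
have I (c : R) : 0 <= c <= 1 -> `|c *: (t - s) + s| <= T.
  move=> /andP[c0 c1]; rewrite [c *: _]/(c * _).
  have -> : c * (t - s) + s = c * t + (1 - c) * s by ring.
  apply: (le_trans (ler_normD _ _)); rewrite !normrM (ger0_norm c0).
  rewrite (ger0_norm (_ : 0 <= 1 - c)) ?subr_ge0 //.
  have -> : T = c * T + (1 - c) * T by ring.
  by rewrite lerD // ler_wpM2l // subr_ge0.
have D (c : R) : 0 <= c <= 1 ->
    is_derive (c *: (t - s) + s) (t - s) f ((t - s) * f' (c *: (t - s) + s)).
  move=> /I/df; move/(is_derive_scale (t - s)).
  by rewrite [(t - s) *: 1]mulr1.
have [c /D[]//|c cI] := @line_MVT _ _ f s (t - s).
rewrite subrK => ->; have [_ ->] := D _ cI.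
by rewrite normrM mulrC ler_wpM2r // f'K // I.
Qed.

(** Nested intervals: [x k - 2 * C * 2^-1 ^+ k] increases and [x k + 2 * C * 2^-1 ^+ k] decreases,
    where [2 * C] is the sum of the geometric series. The limit is the supremum of the left ends. *)
Lemma geometric_cauchy (x : nat -> R) (C : R) :
  (forall k, `|x k.+1 - x k| <= C * 2^-1 ^+ k) ->
  exists l, forall k, `|x k - l| <= 2 * C * 2^-1 ^+ k.
Proof.
move=> Hx.
have C0 : 0 <= C by have := Hx 0%N; rewrite expr0 mulr1; exact: le_trans.
pose y k := x k - 2 * C * 2^-1 ^+ k.
have q0 k : 0 <= 2^-1 ^+ k :> R by rewrite exprn_ge0.
have yS k m : y k <= y (k + m)%N.
  elim: m => [|m IH]; first by rewrite addn0.
  rewrite addnS (le_trans IH) // /y.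
  have := Hx (k + m)%N; rewrite ler_distl exprSr => /andP[+ _].
  by move: (2^-1 ^+ (k + m)) (x _) (x _) => q a b; lra.
have zS k m : x (k + m)%N + 2 * C * 2^-1 ^+ (k + m) <= x k + 2 * C * 2^-1 ^+ k.
  elim: m => [|m IH]; first by rewrite addn0.
  rewrite addnS (le_trans _ IH) // /y.
  have := Hx (k + m)%N; rewrite ler_distl exprSr => /andP[_ +].
  by move: (2^-1 ^+ (k + m)) (x _) (x _) => q a b; lra.
have yz k m : y m <= x k + 2 * C * 2^-1 ^+ k.
  apply: le_trans (zS k m); apply: le_trans (yS m k) _; rewrite addnC /y.
  by have := mulr_ge0 C0 (q0 (k + m)%N); lra.
exists (sup (range y)) => k.
have ub : has_ubound (range y) by exists (x k + 2 * C * 2^-1 ^+ k) => _ [m _ <-].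
have y1 : y k <= sup (range y) by apply: ub_le_sup => //; exists k.
have y2 : sup (range y) <= x k + 2 * C * 2^-1 ^+ k.
  by apply: ge_sup => [|_ [m _ <-]//]; exists (y 0%N); exists 0%N.
rewrite distrC ler_distl; apply/andP; split; last exact: y2.
exact: y1.
Qed.

Lemma le_geometric (C a b : R) : (forall k, a <= b + C * 2^-1 ^+ k) -> a <= b.
Proof.
move=> H; rewrite leNgt; apply/negP => ab.
have d0 : 0 < a - b by rewrite subr_gt0.
pose k := Num.truncn (`|C| / (a - b)).
have Ck : `|C| < (a - b) * 2 ^+ k.+1.
  rewrite mulrC -ltr_pdivrMr //; apply: lt_le_trans (truncnS_gt _) _.
  by rewrite -natrX ler_nat ltnW // ltn_expl.
have := H k.+1; rewrite exprVn -lerBlDl ler_pdivlMr ?exprn_gt0 // => H1.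
by have := le_lt_trans (le_trans H1 (ler_norm C)) Ck; rewrite ltxx.
Qed.

(** The 1-Lipschitz retraction onto [[-r, r]]. It is applied to time in [picard_global] and to each
    space coordinate in [picard_local], to extend local data to the whole space. *)
Definition clamp (r x : R) : R := Num.max (- r) (Num.min r x).

Lemma clamp_le r x : 0 <= r -> `|clamp r x| <= r.
Proof.
move=> r0; rewrite ler_norml /clamp; apply/andP; split.
  by rewrite le_max lexx.
by rewrite ge_max ge_min lexx /= andbT; lra.
Qed.

Lemma clamp_id r x : `|x| <= r -> clamp r x = x.
Proof.
rewrite ler_norml /clamp => /andP[x1 x2].
by rewrite min_r // max_r.
Qed.

Lemma clamp_lipschitz r x y : 0 <= r -> `|clamp r x - clamp r y| <= `|x - y|.
Proof.
move=> r0; wlog xy : x y / x <= y.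
  move=> H; have [/H//|/ltW/H] := leP x y.
  by rewrite distrC [leRHS]distrC.
rewrite [leRHS]distrC (ger0_norm (_ : 0 <= y - x)) ?subr_ge0 //.
rewrite ler_norml /clamp.
have rr : - r <= r by lra.
have [a1|a1] := leP r x; have [a2|a2] := leP r y; rewrite ?(max_r rr); try lra.
- by have [?|?] := leP (- r) x; lra.
by have [?|?] := leP (- r) x; have [?|?] := leP (- r) y; lra.
Qed.

Lemma lipschitz_continuous (V W : normedModType R) (G : V -> W) (L : R) : 0 <= L ->
  (forall x y, `|G x - G y| <= L * `|x - y|) -> continuous G.
Proof.
move=> L0 GL x; apply/cvgrPdist_lt => e e0.
apply/nbhs_normP; exists (e / (L + 1)) => [|z]; first by rewrite /= divr_gt0 // ltr_wpDl.
rewrite /ball_ /= ltr_pdivlMr ?ltr_wpDl // => xz.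
apply: le_lt_trans (GL _ _) _; apply: le_lt_trans xz.
by rewrite mulrC ler_wpM2l // lerDl.
Qed.

(** The bound [T * L <= 2^-1] makes every iteration halve distances, so the iterates converge at
    rate [2^-1 ^+ k], uniformly for [|t| <= T]. *)
Lemma picard_global (n : nat) (a : 'rV[R]_n) (G : 'rV[R]_n -> 'rV[R]_n) (L M T : R) :
  0 < T -> 0 <= L -> 0 <= M -> T * L <= 2^-1 -> 
  (forall x y, `|G x - G y| <= L * `|x - y|) -> (forall x, `|G x| <= M) ->
  exists u : R -> 'rV[R]_n, u 0 = a /\ forall t : R, `|t| <= T -> forall i,
    is_derive t 1 (fun s => u s 0 i) (G (u t) 0 i).
Proof.
move=> T0 L0 M0 TL GL GM.
have T0' := ltW T0.
have Gcont : continuous G by exact: lipschitz_continuous L0 GL.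
have prim (w : R -> 'rV[R]_n) : continuous w -> exists v : R -> 'rV[R]_n,
    v 0 = a /\ forall t : R, `|t| <= T -> forall i,
      is_derive t 1 (fun s => v s 0 i) (G (w t) 0 i).
  move=> cw.
  have ch i : continuous (fun t => G (w t) 0 i).
    move=> t; apply: (continuous_comp (g := fun x : 'rV[R]_n => x 0 i)); last exact: coord_continuous.
    by apply: continuous_comp; [exact: cw|exact: Gcont].
  have Na : - T - 1 < 0 by lra.
  pose H i := sval (cid (antiderivative (ch i) Na)).
  have [H0 HD] : (forall i, H i 0 = 0) /\ (forall i t, - T - 1 < t ->
      is_derive t 1 (H i) (G (w t) 0 i)).
    by split=> i; rewrite /H; case: cid => ? [].
  exists (fun t => \row_i (a 0 i + H i t)); split.
    by apply/rowP => i; rewrite mxE H0 addr0.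
  move=> t; rewrite ler_norml => /andP[t1 _] i.
  under eq_fun do rewrite mxE.
  have -> : G (w t) 0 i = 0 + G (w t) 0 i by rewrite add0r.
  apply: is_deriveDE.
  by apply: HD; lra.
pose tau := clamp T.
have tauT s : `|tau s| <= T by exact: clamp_le.
have tau_id s : `|s| <= T -> tau s = s by exact: clamp_id.
have tauC : continuous tau.
  by apply: (lipschitz_continuous ler01) => x y; rewrite mul1r; exact: clamp_lipschitz.
(* [prim] asks for a proof of continuity; the value [w] otherwise only makes [step] a total function
   that can be iterated. *)
pose step w := if pselect (continuous w) is left cw then sval (cid (prim w cw)) else w.
have stepP w : continuous w -> step w 0 = a /\ forall t : R, `|t| <= T -> forall i,
    is_derive t 1 (fun s => step w s 0 i) (G (w t) 0 i).
  by rewrite /step => cw; case: pselect => // cw'; case: cid.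
(* time is clamped so that all iterates are globally Lipschitz *)
have stepL w : continuous w -> forall t s, `|step w (tau t) - step w (tau s)| <= M * `|t - s|.
  move=> cw t s; apply: (@le_trans _ _ (M * `|tau t - tau s|)); last first.
    by rewrite ler_wpM2l // clamp_lipschitz.
  have D := (stepP w cw).2.
  apply/rV_norm_leP => [|i]; first by rewrite mulr_ge0.
  rewrite !mxE.
  apply: (derive_bound_lipschitz (f := fun s => step w s 0 i)) (tauT t) (tauT s).
    by move=> r rT; exact: D.
  by move=> r _; exact: le_trans (rV_coord_le _ _) (GM _).
pose x k := iter k (fun w => step (w \o tau)) (fun=> a).
have xL k : forall t s, `|x k (tau t) - x k (tau s)| <= M * `|t - s|.
  elim: k => [|k IH] t s; first by rewrite subrr normr0 mulr_ge0.
  by apply: stepL; exact: lipschitz_continuous M0 IH.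
have xC k : continuous (x k \o tau) by exact: lipschitz_continuous M0 (xL k).
have xD k := (stepP _ (xC k)).2.
have x0 k : x k 0 = a by case: k => // k; exact: (stepP _ (xC k)).1.
have T0n : `|0 : R| <= T by rewrite normr0.
(* The derivatives of [v] and [v'] differ by at most [L * E], hence the curves by [T * L * E]. *)
have contr (w w' v v' : R -> 'rV[R]_n) (E : R) : v 0 = v' 0 ->
  (forall t : R, `|t| <= T -> forall i, is_derive t 1 (fun s => v s 0 i) (G (w t) 0 i)) ->
  (forall t : R, `|t| <= T -> forall i, is_derive t 1 (fun s => v' s 0 i) (G (w' t) 0 i)) ->
  (forall t : R, `|t| <= T -> `|w t - w' t| <= E) -> forall t : R, `|t| <= T ->
  `|v t - v' t| <= 2^-1 * E.
  move=> vv' vD vD' ww' t tT.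
  have E0 : 0 <= E by apply: le_trans (ww' 0 T0n).
  apply/rV_norm_leP => [|i]; first by rewrite mulr_ge0.
  have F1 s : `|s| <= T -> is_derive s 1 (fun s => v s 0 i - v' s 0 i)
     (G (w s) 0 i - G (w' s) 0 i).
    by move=> sT; apply: is_deriveBE; [exact: vD|exact: vD'].
  have F2 s : `|s| <= T -> `|G (w s) 0 i - G (w' s) 0 i| <= L * E.
    move=> sT; have := rV_coord_le (G (w s) - G (w' s)) i; rewrite !mxE => H.
    apply: (le_trans H); apply: le_trans (GL _ _) _.
    by rewrite ler_wpM2l // ww'.
  have := derive_bound_lipschitz F1 F2 tT T0n.
  rewrite vv' subrr !subr0 !mxE => H; apply: (le_trans H).
  apply: (@le_trans _ _ (L * E * T)); first by rewrite ler_wpM2l // mulr_ge0.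
  by rewrite mulrAC [L * T]mulrC ler_wpM2r.
have xcauchy k : forall t : R, `|t| <= T -> `|x k.+1 t - x k t| <= M * T * 2^-1 ^+ k.
  elim: k => [|k IH] t tT.
    rewrite expr0 mulr1; have := stepL _ (xC 0%N) t 0.
    rewrite !tau_id // subr0 => H.
    have E : step (x 0%N \o tau) 0 = a := x0 1%N.
    rewrite E in H; apply: (le_trans H).
    by rewrite ler_wpM2l.
  rewrite exprS mulrCA; apply: (contr (x k.+1 \o tau) (x k \o tau)) => //; first by rewrite !x0.
  by move=> s sT /=; rewrite tau_id // IH.
have lim_ex t i : exists l, `|t| <= T -> forall k, `|x k t 0 i - l| <= 2 * (M * T) * 2^-1 ^+ k.
  have [tT|] := boolP (`|t| <= T); last by exists 0.
  have [|l Hl] := @geometric_cauchy (fun k => x k t 0 i) (M * T).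
    move=> k; apply: le_trans (xcauchy k t tT).
    by have := rV_coord_le (x k.+1 t - x k t) i; rewrite !mxE.
  by exists l.
pose u t := \row_i sval (cid (lim_ex t i)).
have uP t k : `|t| <= T -> `|x k t - u t| <= 2 * (M * T) * 2^-1 ^+ k.
  move=> tT; apply/rV_norm_leP => [|i]; first by rewrite !mulr_ge0 ?exprn_ge0.
  by rewrite !mxE; case: cid => l Hl /=; exact: Hl.
have uL t s : `|u (tau t) - u (tau s)| <= M * `|t - s|.
  apply: (@le_geometric (4 * (M * T))) => k.
  have H1 := uP _ k (tauT t); have H2 := uP _ k (tauT s).
  apply: (le_trans (ler_distD (x k (tau t)) _ _)); rewrite distrC.
  apply: (le_trans (lerD H1 (ler_distD (x k (tau s)) _ _))).
  apply: (le_trans (lerD (lexx _) (lerD (xL k t s) H2))).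
  by move: (2^-1 ^+ k) (M * T) (M * `|t - s|) => p q r; lra.
(* The limit [u] is so far only Lipschitz after clamping. Integrating once more gives a
   differentiable [v], and [contr] shows that [v] is also the limit of the iterates, hence equals
   [u]. *)
have [v [v0 vD]] := prim _ (lipschitz_continuous M0 uL : continuous (u \o tau)).
exists v; split => // t tT i.
have -> : v t = (u \o tau) t; last exact: vD.
rewrite /= tau_id //; apply/eqP; rewrite -subr_eq0 -normr_le0.
apply: (@le_geometric (2 * (M * T))) => k; rewrite add0r.
apply: (le_trans (ler_distD (x k.+1 t) _ _)).
have H : `|v t - x k.+1 t| <= 2^-1 * (2 * (M * T) * 2^-1 ^+ k).
  apply: (contr (u \o tau) (x k \o tau)) tT => //; first by rewrite v0 x0.
  by move=> s sT /=; rewrite tau_id // distrC uP.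
apply: (le_trans (lerD H (uP t k.+1 tT))); rewrite exprS.
by move: (2^-1 ^+ k) (M * T) => p q; lra.
Qed.
End Picard.

(** * Local solutions of autonomous systems *)

Section LocalODE.
Context {R : realType} {n : nat}.
Implicit Types (W : set 'rV[R]_n) (F : 'I_n -> 'rV[R]_n -> R) (a : 'rV[R]_n).

(** Strict differentiability with error 1 explains the [+ 1] in [D]; summing over all [i] and [j]
    gives one constant for all components. *)
Lemma locally_lipschitz W F a : open W -> (forall i, Ck_on 1 W (F i)) -> W a ->
  exists r L : R, [/\ 0 < r, 0 <= L, forall b, `|b - a| < r -> W b &
    forall i b c, `|b - a| < r -> `|c - a| < r -> `|F i c - F i b| <= L * `|c - b|].
Proof.
move=> oW CF Wa.
pose D i j : R := `|partial j (F i) a| + 1.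
have D0 i j : 0 <= D i j by rewrite addr_ge0.
pose L : R := \sum_i \sum_j D i j.
pose P i r := forall b c, `|b - a| < r -> `|c - a| < r -> `|F i c - F i b| <= L * `|c - b|.
have NP i : \forall r \near 0^'+, P i r.
  have [r r0 Hr] := strictly_differentiable (CF i) oW Wa ltr01.
  have : \forall s \near 0^'+, s < r by exact: nbhs_right_lt.
  apply: filterS => s sr b c bs cs.
  have [_] := Hr b c (lt_trans bs sr) (lt_trans cs sr); rewrite mul1r.
  set S := \sum_j _ => E.
  have HS : `|S| <= \sum_j `|c 0 j - b 0 j| * `|partial j (F i) a|.
    by apply: (le_trans (ler_norm_sum _ _ _)); apply: ler_sum => j _; rewrite normrM.
  have : `|F i c - F i b| <= \sum_j `|c 0 j - b 0 j| * D i j.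
    have -> : \sum_j `|c 0 j - b 0 j| * D i j =
      \sum_j `|c 0 j - b 0 j| * `|partial j (F i) a| + \sum_j `|c 0 j - b 0 j|.
      by rewrite -big_split; apply: eq_bigr => j _ /=; rewrite /D mulrDr mulr1.
    rewrite -[X in `|X|](subrK S) addrC.
    by apply: (le_trans (ler_normD _ _)); exact: lerD.
  move=> /le_trans; apply; apply: (@le_trans _ _ (\sum_j D i j * `|c - b|)).
    apply: ler_sum => j _; rewrite mulrC ler_wpM2l //.
    by have := rV_coord_le (c - b) j; rewrite !mxE.
  rewrite -mulr_suml ler_wpM2r // /L [leRHS](bigD1 i) //= lerDl sumr_ge0 // => k _.
  exact: sumr_ge0.
have [q q0 Hq] : exists2 q : R, 0 < q & forall z, `|z| < q -> W (z + a).
  exact: nbhs_norm_ex (open_nbhs_nbhs (conj oW Wa)).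
have NW : \forall r \near 0^'+, r < q by exact: nbhs_right_lt.
have N0 : \forall r \near (0 : R)^'+, 0 < r by exact: nbhs_right_gt.
have [r [[rq r0] Hr]] := filter_ex (filterI (filterI NW N0) (filter_forall _ NP)).
exists r, L; split => //; first by apply: sumr_ge0 => i _; exact: sumr_ge0.
by move=> b br; rewrite -(subrK a b); apply: Hq; exact: lt_trans rq.
Qed.

(** Precomposing with the projection [P] onto the cube of radius [q] around [a] makes the field
    bounded and globally Lipschitz; while the solution stays in the cube, [P] is the identity and
    the original system is solved. *)
Theorem picard_local W F a : open W -> (forall i, Ck_on 1 W (F i)) -> W a ->
  exists2 e : R, 0 < e & exists u : R -> 'rV[R]_n, u 0 = a /\
    forall t, `|t| < e -> W (u t) /\
      forall i, is_derive t 1 (fun s => u s 0 i) (F i (u t)).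
Proof.
move=> oW CF Wa; have [r [L [r0 L0 rW HL]]] := locally_lipschitz oW CF Wa.
pose q : R := r / 2.
have q0 : 0 < q by rewrite divr_gt0.
have qr : q < r by rewrite /q; lra.
have q0' := ltW q0.
pose P (x : 'rV[R]_n) : 'rV[R]_n := \row_j (a 0 j + clamp q (x 0 j - a 0 j)).
have Pa x : `|P x - a| <= q.
  apply/rV_norm_leP => // i; rewrite !mxE addrAC subrr add0r.
  exact: clamp_le.
have Par x : `|P x - a| < r by exact: le_lt_trans (Pa x) qr.
have PL x y : `|P x - P y| <= `|x - y|.
  apply/rV_norm_leP => // i; rewrite !mxE opprD addrACA subrr add0r.
  apply: (le_trans (clamp_lipschitz _ _ q0')); rewrite opprB addrA subrK.
  by have := rV_coord_le (x - y) i; rewrite !mxE.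
have Pid x : `|x - a| <= q -> P x = x.
  move=> xa; apply/rowP => i; rewrite !mxE clamp_id ?(addrC (a 0 i)) ?subrK //.
  by apply: le_trans xa; have := rV_coord_le (x - a) i; rewrite !mxE.
pose G x : 'rV[R]_n := \row_i F i (P x).
have GL x y : `|G x - G y| <= L * `|x - y|.
  apply/rV_norm_leP => [|i]; first by rewrite mulr_ge0.
  rewrite !mxE; apply: (le_trans (HL i _ _ (Par y) (Par x))).
  by rewrite ler_wpM2l.
pose M : R := `|G a| + L * q.
have M0 : 0 <= M by apply: addr_ge0 => //; exact: mulr_ge0.
have Paa : P a = a by apply: Pid; rewrite subrr normr0.
have GM x : `|G x| <= M.
  rewrite -[G x](subrK (G a)) addrC; apply: (le_trans (ler_normD _ _)).
  apply: lerD => //; apply/rV_norm_leP => [|i]; first by rewrite mulr_ge0.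
  rewrite !mxE; apply: (le_trans (HL i _ _ (Par a) (Par x))).
  by rewrite ler_wpM2l // Paa.
(* The first bound makes the iteration a contraction, the second keeps the solution within [q] of
   [a]; the [+ 1]s keep the denominators positive. *)
pose T := Num.min (2^-1 / (L + 1)) (q / (M + 1)).
have L1 : 0 < L + 1 by rewrite ltr_wpDl.
have M1 : 0 < M + 1 by rewrite ltr_wpDl.
have T0 : 0 < T by rewrite lt_min !divr_gt0.
have TL : T * L <= 2^-1.
  have : T <= 2^-1 / (L + 1) by rewrite ge_min lexx.
  rewrite ler_pdivlMr //; apply: le_trans; rewrite ler_wpM2l ?ltW // ltrDl //.
have TM : M * T <= q.
  have : T <= q / (M + 1) by rewrite ge_min lexx orbT.
  rewrite ler_pdivlMr //; apply: le_trans; rewrite mulrC ler_wpM2l ?ltW // ltrDl //.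
have [u [u0 uD]] := picard_global a T0 L0 M0 TL GL GM.
exists T => //; exists u; split => // t /ltW tT.
have ua : `|u t - a| <= q.
  apply/rV_norm_leP => // i; rewrite !mxE -u0.
  have T0n : `|0 : R| <= T by rewrite normr0 ltW.
  have GMi s : `|s| <= T -> `|G (u s) 0 i| <= M.
    by move=> _; exact: le_trans (rV_coord_le _ _) (GM _).
  apply: le_trans (derive_bound_lipschitz (fun s sT => uD s sT i) GMi tT T0n) _.
  by rewrite subr0; apply: le_trans TM; rewrite ler_wpM2l.
split; first by apply: rW; exact: le_lt_trans qr.
by move=> i; have := uD t tT i; rewrite mxE Pid.
Qed.

End LocalODE.

(** * Regularity of solutions and the geodesic equation *)

Section Regularity.
Context {R : realType}.
Implicit Types (I : set R) (f g : R -> R).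

Lemma Ck_on_primitive k I f g : open I ->
  (forall t, I t -> is_derive t 1 f (g t)) -> Ck_on k I g -> Ck_on k.+1 I f.
Proof.
move=> oI fg Cg; split=> [t /fg[/derivable1_diffP d _]|v].
  exact: differentiable_continuous.
have D t : I t -> is_derive t v f (v * g t).
  by move=> /fg/(is_derive_scale v); rewrite [v *: 1]mulr1.
split=> [t /D[]//|].
apply: (eq_Ck_on oI) (Ck_onM oI (Ck_on_cst k I v) Cg) => t.
by rewrite inE => /D[_ ->].
Qed.

(** Bootstrapping: if [u] is C^k then so is the right-hand side along [u], and its primitive [u] is
    C^(k+1). *)
Lemma ode_smooth n I (W : set 'rV[R]_n) (F : 'I_n -> 'rV[R]_n -> R) (u : R -> 'rV[R]_n) :
  open I -> open W -> (forall t, I t -> W (u t)) -> (forall i, smooth_on W (F i)) ->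
  (forall t, I t -> forall i, is_derive t 1 (fun s => u s 0 i) (F i (u t))) ->
  forall i, smooth_on I (fun s => u s 0 i).
Proof.
move=> oI oW IW SF uF i k; elim: k i => [|k IH] i.
  split => // t /uF /(_ i)[/derivable1_diffP d _]; exact: differentiable_continuous.
apply: (Ck_on_primitive oI) => [t It|]; first exact: uF.
exact: Ck_on_comp oI oW IW (SF i k) IH.
Qed.

Lemma open_ball0 (e : R) : open [set t : R | `|t| < e].
Proof.
rewrite (_ : [set t : R | `|t| < e] = [set` `]-e, e[]); first exact: interval_open.
by apply/seteqP; split => t /=; rewrite in_itv /= ltr_norml.
Qed.

(** The first-order system on the tangent bundle: the left half of a row in ['rV_(n + n)] is the
    position, the right half the velocity. *)
Lemma geodesic_ode n (W : set 'rV[R]_n) (Gam : 'I_n -> 'I_n -> 'I_n -> 'rV[R]_n -> R)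
    (y w : 'rV[R]_n) : open W -> (forall i j k, smooth_on W (Gam i j k)) -> W y ->
  exists2 e : R, 0 < e & exists u : R -> 'rV[R]_n, [/\ u 0 = y,
   forall t, `|t| < e -> W (u t),
   forall i, smooth_on [set t | `|t| < e] (fun t => u t 0 i),
   forall i, 'D_1 (fun t => u t 0 i) 0 = w 0 i &
   forall t, `|t| < e -> forall i,
    'D_1 ('D_1 (fun t => u t 0 i)) t + \sum_j \sum_k Gam i j k (u t) *
       'D_1 (fun t => u t 0 j) t * 'D_1 (fun t => u t 0 k) t = 0].
Proof.
move=> oW SG Wy.
pose W2 := [set x : 'rV[R]_(n + n) | W (lsubmx x)].
pose F (i0 : 'I_(n + n)) (x : 'rV[R]_(n + n)) : R := match fintype.split i0 with
  | inl i => x 0 (rshift n i)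
  | inr i => - \sum_j \sum_k Gam i j k (lsubmx x) * x 0 (rshift n j) * x 0 (rshift n k)
  end.
have Sc (j : 'I_(n + n)) : smooth_on setT (fun x : 'rV[R]_(n + n) => x 0 j).
  move=> k; case: k => [|k].
    by split=> // x _; exact: coord_continuous.
  split=> [x _|v]; first exact: coord_continuous.
  split=> [x _|]; first by have [] := is_derive_coord x v j.
  apply: (@eq_Ck_on _ _ _ _ (fun=> v 0 j)) (Ck_on_cst _ _ _); first exact: openT.
  by move=> x _; have [_ ->] := is_derive_coord x v j.
have lC : continuous (fun x : 'rV[R]_(n + n) => lsubmx x).
  move=> x; apply: row_continuous => i.
  rewrite (_ : (fun z => _) = (fun z : 'rV[R]_(n + n) => z 0 (lshift n i))).
    exact: coord_continuous.
  by apply/funext => z; rewrite mxE.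
have oW2 : open W2 by move/continuousP : lC; apply.
have SF i : smooth_on W2 (F i).
  have S2 (j : 'I_(n + n)) : smooth_on W2 (fun x : 'rV[R]_(n + n) => x 0 j).
    exact: smooth_sub (Sc j).
  rewrite /F; case: (fintype.split i) => k; first exact: S2.
  apply: smoothN => //; apply: smooth_sum => // j; apply: smooth_sum => // l.
  apply: smoothM => //; apply: smoothM => //.
  apply: smooth_comp oW2 oW _ (SG k j l) _ => // m.
  by under eq_fun do rewrite mxE; exact: S2.
have W2y : W2 (row_mx y w) by rewrite /W2 /= row_mxKl.
have [e e0 [u [u0 uF]]] := picard_local oW2 (fun i => SF i 1%N) W2y.
pose I := [set t : R | `|t| < e].
have oI : open I by exact: open_ball0.
have Su := ode_smooth oI oW2 (fun t It => (uF t It).1) SF (fun t It => (uF t It).2).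
have D1 t i : I t -> is_derive t 1 (fun s => lsubmx (u s) 0 i) (u t 0 (rshift n i)).
  move=> It; have := (uF t It).2 (lshift n i).
  rewrite /F; case: split_ordP => j.
    by move=> /lshift_inj ->; under [in X in _ -> X]eq_fun do rewrite mxE.
  by move/eqP; rewrite eq_lrshift.
have D1E i t : I t -> 'D_1 (fun s => lsubmx (u s) 0 i) t = u t 0 (rshift n i).
  by move=> /(D1 t i)[].
have D2 t i : I t -> 'D_1 ('D_1 (fun s => lsubmx (u s) 0 i)) t = F (rshift n i) (u t).
  move=> It; rewrite -[RHS](@derive_val _ _ _ _ _ _ _ ((uF t It).2 (rshift n i))).
  apply: near_eq_derive; apply: (open_near_eq oI) => // s; rewrite inE.
  exact: D1E.
exists e => //; exists (fun t => lsubmx (u t)); split.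
- by rewrite u0 row_mxKl.
- by move=> t /uF[].
- move=> i; rewrite (_ : (fun t => _) = (fun t => u t 0 (lshift n i))).
    exact: Su.
  by apply/funext => t; rewrite mxE.
- by move=> i /=; rewrite D1E /I /= ?normr0 // u0 row_mxEr.
move=> t It i /=; rewrite D2 // /F.
case: split_ordP => j; first by move/eqP; rewrite eq_rlshift.
move=> /rshift_inj <-; apply/eqP; rewrite addrC subr_eq0; apply/eqP.
by apply: eq_bigr => k _; apply: eq_bigr => l _; rewrite !D1E.
Qed.

End Regularity.

(** * Algebra of curvature tensors *)

Section Contraction.
Context {R : fieldType} {n : nat}.
Implicit Types (T : 'I_n -> 'I_n -> 'M[R]_n) (u v w : 'cV[R]_n) (G P : 'M[R]_n).

(* T k l i j stands for R^i_{jkl}, so that ctr T u w is the operator R(u, w). *)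
Definition ctr T u w : 'M[R]_n := \sum_k \sum_l (u k 0 * w l 0) *: T k l.

Definition bform G u v : R := (u^T *m G *m v) 0 0.

Lemma bformDr G u v v' : bform G u (v + v') = bform G u v + bform G u v'.
Proof. by rewrite /bform !mulmxDr mxE. Qed.
Lemma bformZr G a u v : bform G u (a *: v) = a * bform G u v.
Proof. by rewrite /bform -!scalemxAr mxE. Qed.
Lemma bformNr G u v : bform G u (- v) = - bform G u v.
Proof. by rewrite -scaleN1r bformZr mulN1r. Qed.
Lemma bformBr G u v v' : bform G u (v - v') = bform G u v - bform G u v'.
Proof. by rewrite bformDr bformNr. Qed.
Lemma bformC G u v : G^T = G -> bform G u v = bform G v u.
Proof.
move=> sG; have E : (u^T *m G *m v)^T = v^T *m G *m u.
  by rewrite !trmx_mul trmxK sG mulmxA.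
by rewrite /bform -E [RHS]mxE.
Qed.
Lemma bform_linl G H (a : R) u v : bform (G - a *: H) u v = bform G u v - a * bform H u v.
Proof. by rewrite /bform mulmxBr mulmxBl -scalemxAr -scalemxAl !mxE. Qed.
Lemma bform_delta G i j : bform G (delta_mx i 0) (delta_mx j 0) = G i j.
Proof. by rewrite /bform trmx_delta -rowE -colE !mxE. Qed.
Lemma bform_mul G J u v : bform (J^T *m G *m J) u v = bform G (J *m u) (J *m v).
Proof. by rewrite /bform trmx_mul !mulmxA. Qed.

Lemma bform_inj G H : (forall u v, bform G u v = bform H u v) -> G = H.
Proof. by move=> E; apply/matrixP => i j; rewrite -!bform_delta. Qed.

Lemma bform_eq G u v : G \in unitmx -> (forall w, bform G w u = bform G w v) -> u = v.
Proof.
move=> uG E; rewrite -[u](mulKmx uG) -[v](mulKmx uG); congr (_ *m _).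
apply/matrixP => i j; rewrite (ord1 j); have := E (delta_mx i 0).
by rewrite /bform trmx_delta -!mulmxA -!rowE !mxE.
Qed.

Lemma col_sumE u : u = \sum_k u k 0 *: delta_mx k 0.
Proof.
apply/colP => i; rewrite summxE (bigD1 i) //= big1 ?addr0 => [|k ki].
  by rewrite !mxE !eqxx mulr1.
by rewrite !mxE eq_sym (negbTE ki) mulr0.
Qed.

Lemma ctr_delta T k l : ctr T (delta_mx k 0) (delta_mx l 0) = T k l.
Proof.
rewrite /ctr (bigD1 k) //= [X in _ + X]big1 ?addr0 => [|i ik]; last first.
  by apply: big1 => j _; rewrite !mxE (negbTE ik) mul0r scale0r.
rewrite (bigD1 l) //= big1 ?addr0 => [|i il]; first by rewrite !mxE !eqxx mul1r scale1r.
by rewrite !mxE (negbTE il) mulr0 scale0r.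
Qed.

Lemma ctr_sumE T u w : ctr T u w = \sum_k u k 0 *: ctr T (delta_mx k 0) w.
Proof.
rewrite {1}/ctr; apply: eq_bigr => k _; rewrite /ctr [in RHS](bigD1 k) //=.
rewrite [X in _ + X]big1 ?addr0 => [|i ik]; last first.
  by apply: big1 => j _; rewrite mxE (negbTE ik) mul0r scale0r.
rewrite scaler_sumr; apply: eq_bigr => l _.
by rewrite !mxE !eqxx mul1r scalerA.
Qed.

Lemma ctr_eq T T' : (forall k l, T k l = T' k l) -> forall u w, ctr T u w = ctr T' u w.
Proof.
by move=> E u w; apply: eq_bigr => k _; apply: eq_bigr => l _; rewrite E.
Qed.

Lemma ctr_mul T u w v : ctr T u w *m v = \sum_k \sum_l (u k 0 * w l 0) *: (T k l *m v).
Proof.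
rewrite /ctr mulmx_suml; apply: eq_bigr => k _; rewrite mulmx_suml.
by apply: eq_bigr => l _; rewrite scalemxAl.
Qed.

Lemma ctr_skew T : (forall k l, T l k = - T k l) -> forall u w, ctr T w u = - ctr T u w.
Proof.
move=> sT u w; rewrite /ctr exchange_big -sumrN; apply: eq_bigr => k _.
by rewrite -sumrN; apply: eq_bigr => l _ /=; rewrite sT scalerN mulrC.
Qed.

Lemma ctr_metric T G : (forall k l, (T k l)^T *m G + G *m T k l = 0) ->
  forall u w a b, bform G a (ctr T u w *m b) = - bform G (ctr T u w *m a) b.
Proof.
move=> sT u w a b.
have sM : (ctr T u w)^T *m G + G *m ctr T u w = 0.
  rewrite /ctr linear_sum /= mulmx_suml mulmx_sumr -big_split big1 // => k _ /=.
  rewrite linear_sum /= mulmx_suml mulmx_sumr -big_split big1 // => l _ /=.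
  by rewrite linearZ /= -scalemxAl -scalemxAr -scalerDr sT scaler0.
have H : a^T *m (ctr T u w)^T *m G *m b + a^T *m G *m ctr T u w *m b = 0.
  have <- : a^T *m ((ctr T u w)^T *m G + G *m ctr T u w) *m b =
    a^T *m (ctr T u w)^T *m G *m b + a^T *m G *m ctr T u w *m b.
    by rewrite mulmxDr mulmxDl !mulmxA.
  by rewrite sM mulmx0 mul0mx.
apply/eqP; rewrite -addr_eq0 addrC /bform trmx_mul !mulmxA.
by have /matrixP/(_ 0 0) := H; rewrite [LHS]mxE [RHS]mxE => ->.
Qed.

Lemma ctr_bianchi T : (forall i j k l, T k l i j + T l j i k + T j k i l = 0) ->
  forall u w b, ctr T u w *m b + ctr T w b *m u + ctr T b u *m w = 0.
Proof.
move=> bT u w b; apply/colP => i; rewrite [LHS]mxE [X in X + _]mxE [RHS]mxE.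
have E (x y z : 'cV[R]_n) : (ctr T x y *m z) i 0 = \sum_k \sum_l \sum_j x k 0 * y l 0 * z j 0 * T k l i j.
  rewrite ctr_mul summxE; apply: eq_bigr => k _; rewrite summxE; apply: eq_bigr => l _.
  by rewrite !mxE mulr_sumr; apply: eq_bigr => j _; ring.
rewrite !E.
under [X in _ + X + _]eq_bigr do rewrite exchange_big /=.
rewrite [X in _ + X + _]exchange_big /=.
rewrite [X in _ + X]exchange_big /=.
under [X in _ + X]eq_bigr do rewrite exchange_big /=.
rewrite -!big_split big1 // => k _ /=; rewrite -!big_split big1 // => l _ /=.
rewrite -!big_split big1 // => j _ /=.
rewrite -[RHS](mulr0 (u k 0 * w l 0 * b j 0)) -(bT i j k l); ring.
Qed.

End Contraction.

(** * Algebra of the Weyl nullity at a point *)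

Section CurvatureAlgebra.
Context {R : realType} {n : nat}.
Implicit Types (T : 'I_n -> 'I_n -> 'M[R]_n) (u v w a b c d : 'cV[R]_n) (G : 'M[R]_n).

(** What the algebra uses of a Levi-Civita curvature: skewness in the operator slots,
    skew-adjointness for [G] and the first Bianchi identity. Pair symmetry and the symmetry of Ricci
    are derived from these. *)
Definition riemann_like G T := [/\ G^T = G, G \in unitmx,
  forall k l, T l k = - T k l,
  forall k l, (T k l)^T *m G + G *m T k l = 0 &
  forall i j k l, T k l i j + T l j i k + T j k i l = 0].

Definition ricci_of T : 'M[R]_n := \matrix_(j, k) \sum_a T a k a j.
Definition schouten_of T : 'M[R]_n := (n.-1)%:R^-1 *: ricci_of T.
Definition weyl_of T k l : 'M[R]_n := \matrix_(i, j)
  (T k l i j + (i == l)%:R * schouten_of T j k - (i == k)%:R * schouten_of T j l).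

Definition in_nullity T v := forall k l, weyl_of T k l *m v = 0.

Lemma bform_basis (P : 'M[R]_n) v (k : 'I_n) :
  bform P v (delta_mx k 0) = \sum_j P j k * v j 0.
Proof.
by rewrite /bform -colE mxE mxE; apply: eq_bigr => j _; rewrite mxE mulrC.
Qed.

Lemma weyl_of_mul T k l v : weyl_of T k l *m v = T k l *m v +
  bform (schouten_of T) v (delta_mx k 0) *: delta_mx l 0 -
  bform (schouten_of T) v (delta_mx l 0) *: delta_mx k 0.
Proof.
have := bform_basis (schouten_of T) v k; have := bform_basis (schouten_of T) v l.
move: (bform _ v _) (bform _ v _) => p q Ep Eq; apply/colP => i.
rewrite !mxE eqxx !andbT Ep Eq.
rewrite mulr_suml mulr_suml -big_split -sumrN -big_split /=.
by apply: eq_bigr => j _; rewrite mxE; ring.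
Qed.

Lemma ctr_weyl_of T u w v : ctr (weyl_of T) u w *m v = ctr T u w *m v +
  bform (schouten_of T) v u *: w - bform (schouten_of T) v w *: u.
Proof.
rewrite ctr_mul.
under eq_bigr => k _ do under eq_bigr => l _ do rewrite weyl_of_mul.
set P := schouten_of T.
have S1 : bform P v u *: w = \sum_k \sum_l (u k 0 * w l 0) *:
    (bform P v (delta_mx k 0) *: delta_mx l 0).
  rewrite {1}(col_sumE u) {1}(col_sumE w) (big_morph _ (bformDr P v) (_ : bform P v 0 = 0)); last first.
    by rewrite /bform mulmx0 mxE.
  rewrite scaler_suml; apply: eq_bigr => k _; rewrite scaler_sumr.
  by apply: eq_bigr => l _; rewrite bformZr !scalerA; congr (_ *: _); ring.
have S2 : bform P v w *: u = \sum_k \sum_l (u k 0 * w l 0) *: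
    (bform P v (delta_mx l 0) *: delta_mx k 0).
  rewrite exchange_big /= {1}(col_sumE u) {1}(col_sumE w) (big_morph _ (bformDr P v) (_ : bform P v 0 = 0)); last first.
    by rewrite /bform mulmx0 mxE.
  rewrite scaler_suml; apply: eq_bigr => k _; rewrite scaler_sumr.
  by apply: eq_bigr => l _; rewrite bformZr !scalerA; congr (_ *: _); ring.
rewrite S1 S2 ctr_mul -sumrN -!big_split; apply: eq_bigr => k _ /=.
rewrite -sumrN -!big_split; apply: eq_bigr => l _ /=.
by rewrite scalerBr scalerDr.
Qed.

Lemma in_nullity_ctr T v : in_nullity T v -> forall u w, ctr (weyl_of T) u w *m v = 0.
Proof.
by move=> Nv u w; rewrite ctr_mul big1 // => k _; rewrite big1 // => l _; rewrite Nv scaler0.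
Qed.

Lemma in_nullityP T v : in_nullity T v -> forall u w,
  ctr T u w *m v = bform (schouten_of T) v w *: u - bform (schouten_of T) v u *: w.
Proof.
move=> Nv u w; have := ctr_weyl_of T u w v; rewrite in_nullity_ctr // => E.
by apply/eqP; rewrite -subr_eq0 [X in _ == X]E opprB addrA.
Qed.

(** The classical combination of four Bianchi identities, one with each of [a], [b], [c], [d] in the
    first slot; with the two skew symmetries it is linear arithmetic in the values of [r]. *)
Lemma riemann_pair_symmetry G T : riemann_like G T -> forall a b c d,
  bform G a (ctr T c d *m b) = bform G c (ctr T a b *m d).
Proof.
move=> [sG uG sT mT bT] a b c d; pose r a b c d := bform G a (ctr T c d *m b).
have r34 x y z t : r x y t z = - r x y z t.
  by rewrite /r (ctr_skew sT) mulNmx bformNr.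
have r12 x y z t : r y x z t = - r x y z t.
  by rewrite /r (ctr_metric mT) bformC.
have rb x y z t : r x y z t + r x z t y + r x t y z = 0.
  by rewrite /r -!bformDr (ctr_bianchi bT) /bform mulmx0 mxE.
rewrite -/(r a b c d) -/(r c d a b).
clearbody r; have := (rb a b c d, rb b c d a, rb c d a b, rb d a b c).
have := (r34 b c a d, r12 a b c d, r12 a c b d, r34 a c d b, r12 b c d a).
have := (r12 a d b c, r12 b d c a, r34 b d a c, r12 c d a b).
move=> [[[? ?] ?] ?] [[[[? ?] ?] ?] ?] [[[? ?] ?] ?].
lra.
Qed.

(** A skew-adjoint operator has trace zero, and contracting the Bianchi identity expresses the skew
    part of Ricci by the trace of [T k j]. *)
Lemma ricci_of_sym G T : riemann_like G T -> (ricci_of T)^T = ricci_of T.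
Proof.
move=> [sG uG sT mT bT].
have tr0 k l : \tr (T k l) = 0.
  have E : T k l = - (invmx G *m (T k l)^T *m G).
    apply/eqP; rewrite -addr_eq0 -{1}(mulKmx uG (T k l)) -mulmxA -mulmxDr addrC.
    by rewrite mT mulmx0.
  have := congr1 (fun M => \tr M) E; rewrite raddfN /= mxtrace_mulC mulmxA mulmxV //.
  by rewrite mul1mx mxtrace_tr; lra.
apply/matrixP => j k; rewrite !mxE.
apply/eqP; rewrite -subr_eq0 -sumrB; apply/eqP.
rewrite -[RHS](tr0 k j); apply: eq_bigr => a _.
by have := bT a k j a; rewrite (sT a j) mxE => E; lra.
Qed.

Lemma schouten_of_sym G T : riemann_like G T -> (schouten_of T)^T = schouten_of T.
Proof. by move=> /ricci_of_sym H; rewrite linearZ /= H. Qed.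

(** Since [T] is skew-adjoint, $G(v, R(u,w)v) = 0$; inserting the nullity formula gives
    $P(v,w)\,G(v,u) = P(v,u)\,G(v,w)$ for all [u], [w]. *)
Lemma nullity_eigen G T v : riemann_like G T -> in_nullity T v ->
  exists B, schouten_of T *m v = B *: (G *m v).
Proof.
move=> rT Nv; have [sG uG sT mT bT] := rT; have sP := schouten_of_sym rT.
set P := schouten_of T in sP *.
have [->|v0] := eqVneq v 0; first by exists 0; rewrite !mulmx0 scaler0.
(* In indefinite signature [v] may be null, so an auxiliary [u] takes the place of [v] in the
   quotient that defines the eigenvalue. *)
have [u Gvu] : exists u, bform G v u != 0.
  apply/not_existsP => H; move/negP: v0; apply; apply/eqP.
  apply: (bform_eq uG) => w; have := H w; rewrite bformC // => /negP/negPn/eqP ->.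
  by rewrite /bform mulmx0 mxE.
exists (bform P v u / bform G v u).
have E w : bform P v w * bform G v u = bform P v u * bform G v w.
  have X0 : bform G v (ctr T u w *m v) = 0.
    have := ctr_metric mT u w v v; rewrite (bformC (ctr T u w *m v) v sG); lra.
  move: X0; rewrite in_nullityP // -/P bformBr !bformZr; lra.
have H w : bform P v w = bform P v u / bform G v u * bform G v w.
  by rewrite mulrAC -E mulfK.
apply/colP => i.
have := H (delta_mx i 0); rewrite ![bform _ v _]bformC // /bform !trmx_delta.
by rewrite -!mulmxA -!rowE ![row _ _ _ _]mxE => ->; rewrite [RHS]mxE.
Qed.

(** When all vectors of a space are eigenvectors, the eigenvalues agree: compare [v], [w] and
    [v + w]. For trivial nullity the witness is 0. *)
Lemma nullity_eigen_uniform G T : riemann_like G T ->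
  exists B, forall v, in_nullity T v -> schouten_of T *m v = B *: (G *m v).
Proof.
move=> rT; have [sG uG _ _ _] := rT.
have [[v [Nv v0]]|none] := pselect (exists v, in_nullity T v /\ v != 0); last first.
  exists 0 => v Nv; have [->|v0] := eqVneq v 0; first by rewrite !mulmx0 scaler0.
  by case: none; exists v.
have [B EB] := nullity_eigen rT Nv; exists B => w Nw.
have [C EC] := nullity_eigen rT Nw.
have Nvw : in_nullity T (v + w) by move=> k l; rewrite mulmxDr Nv Nw addr0.
have [D ED] := nullity_eigen rT Nvw.
have [->//|BC] := eqVneq B C.
have dep e f : e *: v + f *: w = 0 -> f != 0 -> schouten_of T *m w = B *: (G *m w).
  move=> E f0; have {E} -> : w = (- (e / f)) *: v.
    apply: (scalerI f0); rewrite scalerA mulrN mulrCA mulfV // mulr1 scaleNr.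
    by apply/eqP; rewrite -addr_eq0 addrC E.
  by rewrite -!scalemxAr EB !scalerA mulrC.
have E : (B - D) *: v + (C - D) *: w = 0.
  rewrite -[LHS](mulKmx uG) mulmxDr -!scalemxAr !scalerBl -EB -EC addrACA.
  by rewrite -mulmxDr -opprD -scalerDr -mulmxDr ED subrr mulmx0.
have [CD|CD] := eqVneq C D; last by apply: dep E _; rewrite subr_eq0.
move: E; rewrite CD subrr scale0r addr0 => /eqP.
by rewrite scaler_eq0 (negbTE v0) orbF subr_eq0 -CD (negbTE BC).
Qed.

(* The pair symmetry moves the nullity vector v into the operator slots of R. *)
Lemma weyl_nullity_schouten G T v B : riemann_like G T -> in_nullity T v ->
  schouten_of T *m v = B *: (G *m v) -> forall u w,
  ctr (weyl_of T) v u *m w = - bform (schouten_of T - B *: G) w u *: v.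
Proof.
move=> rT Nv EB u w; have [sG uG sT mT bT] := rT; have sP := schouten_of_sym rT.
have Pv x : bform (schouten_of T) v x = B * bform G v x.
  by rewrite !(bformC v) // /bform -!mulmxA EB -scalemxAr mxE.
have H : ctr T v u *m w = B *: (bform G u w *: v - bform G v w *: u).
  apply: (bform_eq uG) => a; rewrite riemann_pair_symmetry //.
  have -> : bform G v (ctr T a w *m u) = - bform G u (ctr T a w *m v).
    by rewrite (ctr_metric mT) bformC.
  rewrite in_nullityP // bformBr !bformZr !Pv bformBr !bformZr.
  by rewrite (bformC u a) // (bformC v a) //; ring.
rewrite ctr_weyl_of H bform_linl (bformC w v sP) Pv (bformC w u sG).
move: (bform _ w u) (bform G u w) (bform G v w) => p g1 g2.
by apply/colP => i; rewrite !mxE; ring.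
Qed.

End CurvatureAlgebra.

(** * Connections and changes of coordinates *)

Local Notation coordv k := (delta_mx (0 : 'I_1) k).

(** * Uniqueness of the torsion-free metric connection *)

Section Koszul.
Context {R : realType} {n : nat}.
Implicit Types (G : 'M[R]_n) (dG C : 'I_n -> 'M[R]_n).

(** Twice the Christoffel symbols with lowered upper index, where [dG l] is the derivative of the
    metric in direction [l]. *)
Definition koszul dG k : 'M[R]_n := \matrix_(a, j) (dG k a j + dG j k a - dG a k j).

Lemma koszul_metric G dG k : G^T = G -> (forall l, (dG l)^T = dG l) -> G \in unitmx ->
  let C := 2^-1 *: (invmx G *m koszul dG k) in C^T *m G + G *m C = dG k.
Proof.
move=> sG sdG uG /=.
have -> : (2^-1 *: (invmx G *m koszul dG k))^T *m G =
    (G *m (2^-1 *: (invmx G *m koszul dG k)))^T by rewrite trmx_mul sG.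
rewrite -scalemxAr mulKVmx //; apply/matrixP => i j; rewrite !mxE.
have E l a b : dG l a b = dG l b a by rewrite -[in LHS]sdG mxE.
rewrite (E k j i) (E i k j) (E j k i) (E i j k) (E j i k); lra.
Qed.

(** Purely pointwise, with [dG] an arbitrary array of symmetric matrices. A candidate for the
    Christoffel symbols in new coordinates can then be recognised by its symmetry and its
    compatibility with the metric. *)
Lemma koszul_unique G dG C : G^T = G -> (forall l, (dG l)^T = dG l) -> G \in unitmx ->
  (forall k i j, C k i j = C j i k) ->
  (forall k, dG k = (C k)^T *m G + G *m C k) ->
  forall k, C k = 2^-1 *: (invmx G *m koszul dG k).
Proof.
move=> sG sdG uG sC mC k.
pose L k := G *m C k.
have LE l a b : dG l a b = L l b a + L l a b.
  by rewrite mC -{1}sG -trmx_mul [LHS]mxE [X in X + _]mxE.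
have sL l a b : L l a b = L b a l.
  by rewrite /L [LHS]mxE [RHS]mxE; apply: eq_bigr => i _; rewrite sC.
have -> : koszul dG k = 2 *: L k.
  apply/matrixP => a j; rewrite [LHS]mxE [RHS]mxE.
  by rewrite !LE (sL j a k) (sL a k j) (sL a j k) (sL k a j); clearbody L; ring.
by rewrite /L -scalemxAr mulKmx // scalerA mulVf ?pnatr_eq0 // scale1r.
Qed.

End Koszul.

(** Identities in the noncommutative ring of matrices: expand all products, treat them as atoms, and
    check the remaining additive identity entrywise. *)
Ltac mx_abel :=
  rewrite ?(mulmxDl, mulmxDr, mulmxBl, mulmxBr, mulmxN, mulNmx, mulmxA);
  repeat match goal with |- context [?A *m ?B] =>
    let X := fresh "X" in set X := (A *m B); clearbody X end;
  apply/matrixP => ? ?; rewrite ?mxE; ring.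

(** * Symmetries of the curvature of a connection *)

Section Curv.
Context {R : realType} {n : nat}.
Implicit Types (U : set 'rV[R]_n) (y z : 'rV[R]_n) (C : 'I_n -> 'rV[R]_n -> 'M[R]_n).

(* The curvature of a connection with matrices C k = (Gamma^i_{kj})_{ij}. *)
Definition curv C k l y : 'M[R]_n :=
  mxderive (coordv k) (C l) y - mxderive (coordv l) (C k) y
  + (C k y *m C l y - C l y *m C k y).

Lemma curv_skew C k l y : curv C l k y = - curv C k l y.
Proof. by rewrite /curv opprD !opprB. Qed.

(** Differentiate the compatibility condition once more; the equality of the two mixed second
    derivatives of [G] is exactly the claim. *)
Lemma curv_metric U C (G : 'rV[R]_n -> 'M[R]_n) y : open U -> smooth_mx U G ->
  (forall k, smooth_mx U (C k)) ->
  (forall k z, U z -> mxderive (coordv k) G z = (C k z)^T *m G z + G z *m C k z) ->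
  U y -> forall k l, (curv C k l y)^T *m G y + G y *m curv C k l y = 0.
Proof.
move=> oU SG SC mG Uy k l.
have D2 a b : mxderive (coordv a) (mxderive (coordv b) G) y =
   (mxderive (coordv a) (C b) y)^T *m G y + (C b y)^T *m mxderive (coordv a) G y +
   (mxderive (coordv a) G y *m C b y + G y *m mxderive (coordv a) (C b) y).
  apply: is_mxderiveE.
  have HG := smooth_is_mxderive (coordv a) SG Uy.
  have HC := smooth_is_mxderive (coordv a) (SC b) Uy.
  apply: is_mxderive_near (is_mxderiveD (is_mxderiveM (is_mxderive_tr HC) HG)
    (is_mxderiveM HG HC)).
  by apply: open_near oU _ Uy => z Uz; rewrite mG.
have := mxderive_schwarz (coordv k) (coordv l) oU SG Uy.
rewrite !D2 !mG // /curv.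
move: (mxderive _ (C l) y) (mxderive _ (C k) y) => dl dk.
move: (C k y) (C l y) (G y) => Ck Cl g.
move=> /eqP; rewrite -subr_eq0 => /eqP H.
have -> : (dl - dk + (Ck *m Cl - Cl *m Ck))^T =
    dl^T - dk^T + (Cl^T *m Ck^T - Ck^T *m Cl^T).
  rewrite -!trmx_mul; move: (Ck *m Cl) (Cl *m Ck) => X Y.
  by apply/matrixP => i j; rewrite !mxE.
by rewrite -[RHS]H; mx_abel.
Qed.

(** The symmetry of [C] in its lower indices holds on an open set, hence also for the derivatives
    and the products; the twelve terms then cancel in pairs. *)
Lemma curv_bianchi U C y : open U -> (forall k, smooth_mx U (C k)) ->
  (forall k i j z, U z -> C k z i j = C j z i k) -> U y ->
  forall i j k l, curv C k l y i j + curv C l j y i k + curv C j k y i l = 0.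
Proof.
move=> oU SC sC Uy i j k l.
have S a b c : mxderive (coordv a) (C b) y i c = mxderive (coordv a) (C c) y i b.
  rewrite [LHS]mxE [RHS]mxE; apply: near_eq_derive.
  by apply: open_near oU _ Uy => z Uz; rewrite sC.
have Q a b c : (C a y *m C b y) i c = (C a y *m C c y) i b.
  by rewrite [LHS]mxE [RHS]mxE; apply: eq_bigr => x _; rewrite (sC b).
have E a b c : curv C a b y i c = mxderive (coordv a) (C b) y i c -
  mxderive (coordv b) (C a) y i c + ((C a y *m C b y) i c - (C b y *m C a y) i c).
  rewrite /curv; move: (mxderive _ _ _) (mxderive _ _ _) (_ *m _) (_ *m _) => A B D F.
  by rewrite !mxE.
rewrite !E (S k l j) (S l k j) (S j l k) (Q k l j) (Q l k j) (Q j l k).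
ring.
Qed.

End Curv.

(** * The Levi-Civita connection in matrix form *)

Section LeviCivita.
Context {R : realType} {n : nat}.
Implicit Types (U : set 'rV[R]_n) (y z : 'rV[R]_n) (G : 'rV[R]_n -> 'M[R]_n).

Definition metric_on U G := [/\ open U, smooth_mx U G,
  forall z, U z -> (G z)^T = G z & forall z, U z -> G z \in unitmx].

Definition chris G k y : 'M[R]_n := \matrix_(i, j) christoffel G i k j y.

Definition riem G y k l : 'M[R]_n := curv (chris G) k l y.

Lemma chrisE G k y : chris G k y =
  2^-1 *: (invmx (G y) *m koszul (fun l => mxderive (coordv l) G y) k).
Proof.
apply/matrixP => i j; rewrite !mxE; congr (_ * _); apply: eq_bigr => a _.
by rewrite !mxE.
Qed.

Lemma mxderive_sym U G k y : metric_on U G -> U y ->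
  (mxderive (coordv k) G y)^T = mxderive (coordv k) G y.
Proof.
move=> [oU SG sG _] Uy; apply/matrixP => i j; rewrite !mxE.
apply: near_eq_derive; apply: open_near oU _ Uy => z Uz.
by rewrite -[in LHS]sG // mxE.
Qed.

Lemma chris_metric U G k y : metric_on U G -> U y ->
  mxderive (coordv k) G y = (chris G k y)^T *m G y + G y *m chris G k y.
Proof.
move=> mG Uy; have [oU SG sG uG] := mG; rewrite chrisE koszul_metric //.
- exact: sG.
- by move=> l; exact: mxderive_sym mG Uy.
- exact: uG.
Qed.

Lemma chris_sym U G k i j y : metric_on U G -> U y -> chris G k y i j = chris G j y i k.
Proof.
move=> mG Uy; rewrite !mxE /christoffel; congr (_ * _); apply: eq_bigr => a _.
congr (_ * _).
have E l b c : partial l (fun z => G z b c) y = partial l (fun z => G z c b) y.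
  have := mxderive_sym l mG Uy => /matrixP /(_ b c); rewrite !mxE.
  exact: esym.
by rewrite (E k a j) (E j k a) (E a k j); ring.
Qed.

Lemma smooth_chris U G k : metric_on U G -> smooth_mx U (chris G k).
Proof.
move=> [oU SG sG uG] i j; have SI := smooth_invmx oU uG SG.
rewrite (_ : (fun z => _) = (fun z => christoffel G i k j z)); last first.
  by apply/funext => z; rewrite mxE.
apply: smoothM => //; first exact: smooth_cst.
apply: smooth_sum => // a; apply: smoothM; [exact: oU|exact: SI|].
apply: smoothB => //; last exact: smooth_derive (SG _ _).
by apply: smoothD => //; exact: smooth_derive (SG _ _).
Qed.

Lemma riemannE G i j k l y : riemann G i j k l y = riem G y k l i j.
Proof.
rewrite /riem /curv /riemann.
rewrite [RHS]mxE [X in _ = X + _]mxE [X in _ = X + _ + _]mxE.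
rewrite [X in _ = _ + X + _]mxE [X in _ = _ - X + _]mxE.
rewrite [X in _ = _ + X]mxE [X in _ = _ + (X + _)]mxE [X in _ = _ + (_ + X)]mxE.
rewrite [X in _ = _ + (_ - X)]mxE sumrB.
have E a b c : (fun z => chris G a z b c) = christoffel G b a c.
  by apply/funext => z; rewrite mxE.
rewrite !E; congr (_ + (_ - _)); apply: eq_bigr => a _; by rewrite !mxE.
Qed.

Lemma riemann_like_riem U G y : metric_on U G -> U y -> riemann_like (G y) (riem G y).
Proof.
move=> mG Uy; have [oU SG sG uG] := mG.
have SC k := smooth_chris k mG.
split; [exact: sG|exact: uG|by move=> k l; exact: curv_skew| |].
  move=> k l; apply: (curv_metric oU SG SC _ Uy) => a z Uz.
  exact: chris_metric mG Uz.
move=> i j k l; apply: (curv_bianchi oU SC _ Uy) => a b c z Uz.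
exact: chris_sym mG Uz.
Qed.

Lemma proj_schoutenE G y : proj_schouten G y = schouten_of (riem G y).
Proof.
congr (_ *: _); apply/matrixP => j k; rewrite !mxE; apply: eq_bigr => a _.
exact: riemannE.
Qed.

Lemma proj_weylE G i j k l y : proj_weyl G i j k l y = weyl_of (riem G y) k l i j.
Proof. by rewrite mxE -proj_schoutenE -riemannE. Qed.

Lemma proj_weyl_nullityP G y v :
  v \in proj_weyl_nullity G y <-> in_nullity (riem G y) v.
Proof.
have E k l : \matrix_(i, j) proj_weyl G i j k l y = weyl_of (riem G y) k l.
  by apply/matrixP => i j; rewrite mxE proj_weylE.
rewrite /proj_weyl_nullity memvE; split.
  move=> /subv_bigcapP H k l; have /subv_bigcapP /(_ l isT) := H k isT.
  by rewrite -memvE memv_ker lfunE /= E => /eqP.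
move=> H; apply/subv_bigcapP => k _; apply/subv_bigcapP => l _.
by rewrite -memvE memv_ker lfunE /= E H.
Qed.

End LeviCivita.

(** * Transformation of curvature, Ricci and Weyl tensors under a linear map *)

Section TensorLaw.
Context {R : realType} {n : nat}.
Implicit Types (T : 'I_n -> 'I_n -> 'M[R]_n) (u v w : 'cV[R]_n) (J : 'M[R]_n).

Lemma ctr_suml T (I : finType) (a : I -> R) (x : I -> 'cV[R]_n) w :
  ctr T (\sum_i a i *: x i) w = \sum_i a i *: ctr T (x i) w.
Proof.
under [RHS]eq_bigr => i _ do rewrite /ctr scaler_sumr.
rewrite exchange_big /=; apply: eq_bigr => k _.
under [RHS]eq_bigr => i _ do rewrite scaler_sumr.
rewrite exchange_big /=; apply: eq_bigr => l _.
rewrite summxE mulr_suml scaler_suml; apply: eq_bigr => i _.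
by rewrite mxE scalerA mulrA.
Qed.

Lemma ctr_sumr T (I : finType) (a : I -> R) (x : I -> 'cV[R]_n) u :
  ctr T u (\sum_i a i *: x i) = \sum_i a i *: ctr T u (x i).
Proof.
under [RHS]eq_bigr => i _ do rewrite /ctr scaler_sumr.
rewrite exchange_big /=; apply: eq_bigr => k _.
under [RHS]eq_bigr => i _ do rewrite scaler_sumr.
rewrite exchange_big /=; apply: eq_bigr => l _.
rewrite summxE mulr_sumr scaler_suml; apply: eq_bigr => i _.
by rewrite mxE scalerA mulrCA.
Qed.

Lemma mul_col_sum J u : J *m u = \sum_k u k 0 *: col k J.
Proof.
apply/colP => i; rewrite mxE summxE; apply: eq_bigr => k _.
by rewrite !mxE mulrC.
Qed.

(** [T'] is the pull-back of [T] by [J], written as an intertwining relation so that the inverse of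
    [J] does not appear. *)
Definition tensor_law J T' T :=
  forall u w, J *m ctr T' u w = ctr T (J *m u) (J *m w) *m J.

Lemma tensor_lawP J T' T :
  (forall k l, J *m T' k l = (\sum_m \sum_p (J m k * J p l) *: T m p) *m J) ->
  tensor_law J T' T.
Proof.
move=> H u w; rewrite (mul_col_sum J u) (mul_col_sum J w) ctr_suml /ctr.
rewrite mulmx_sumr mulmx_suml; apply: eq_bigr => k _.
rewrite -/(ctr T (col k J) (\sum_l w l 0 *: col l J)) ctr_sumr.
rewrite scaler_sumr mulmx_sumr mulmx_suml; apply: eq_bigr => l _.
rewrite -scalemxAr H scalerA -scalemxAl; congr (_ *: (_ *m _)).
by apply: eq_bigr => m _; apply: eq_bigr => p _; rewrite !mxE.
Qed.

(* the endomorphism u |-> R(u, w) v, whose trace is Ric(v, w) *)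
Definition ricci_endo T v w : 'M[R]_n := \matrix_(i, a) (ctr T (delta_mx a 0) w *m v) i 0.

Lemma ricci_endo_mul T v w u : ricci_endo T v w *m u = ctr T u w *m v.
Proof.
rewrite [in RHS](col_sumE u) ctr_suml mulmx_suml; apply/colP => i.
rewrite mxE summxE; apply: eq_bigr => a _.
by rewrite -scalemxAl [RHS]mxE [X in X * _]mxE mulrC.
Qed.

Lemma bform_ricci T v w : bform (ricci_of T) v w = \tr (ricci_endo T v w).
Proof.
rewrite /mxtrace; under [RHS]eq_bigr => a _.
  rewrite mxE ctr_mul summxE (bigD1 a) //= [X in _ + X]big1 ?addr0; last first.
    move=> k ka; rewrite summxE big1 // => l _.
    by rewrite !mxE (negbTE ka) mul0r mul0r.
  rewrite summxE; under eq_bigr => l _ do rewrite !mxE !eqxx mul1r.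
  over.
rewrite /bform mxE exchange_big /=; apply: eq_bigr => l _.
rewrite mxE mulr_suml.
under [LHS]eq_bigr => j _ do rewrite !mxE mulr_sumr mulr_suml.
rewrite exchange_big /=; apply: eq_bigr => a _; rewrite mulr_sumr.
by apply: eq_bigr => j _; ring.
Qed.

Section Law.
Variables (J : 'M[R]_n) (T' T : 'I_n -> 'I_n -> 'M[R]_n).
Hypotheses (uJ : J \in unitmx) (HT : tensor_law J T' T).

(** [J] conjugates the two endomorphisms whose traces are the Ricci forms. *)
Lemma ricci_law v w : bform (ricci_of T') v w = bform (ricci_of T) (J *m v) (J *m w).
Proof.
rewrite !bform_ricci.
have E : J *m ricci_endo T' v w = ricci_endo T (J *m v) (J *m w) *m J.
  apply/matrixP => i j.
  have : J *m ricci_endo T' v w *m (delta_mx j 0 : 'cV_n) =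
     ricci_endo T (J *m v) (J *m w) *m J *m (delta_mx j 0 : 'cV_n).
    by rewrite -!mulmxA !ricci_endo_mul !mulmxA HT.
  by rewrite -!colE => /colP/(_ i); rewrite [LHS]mxE [RHS]mxE.
by rewrite -[ricci_endo T _ _](mulmxK uJ) -E mxtrace_mulC mulKmx.
Qed.

Lemma schouten_law v w :
  bform (schouten_of T') v w = bform (schouten_of T) (J *m v) (J *m w).
Proof.
have S (U : 'I_n -> 'I_n -> 'M[R]_n) x y : bform (schouten_of U) x y = (n.-1)%:R^-1 * bform (ricci_of U) x y.
  by rewrite /bform /schouten_of -scalemxAr -scalemxAl mxE.
by rewrite !S ricci_law.
Qed.

Lemma weyl_law u w v : J *m (ctr (weyl_of T') u w *m v) =
  ctr (weyl_of T) (J *m u) (J *m w) *m (J *m v).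
Proof.
rewrite !ctr_weyl_of !mulmxBr mulmxDr -!scalemxAr !schouten_law.
by rewrite mulmxA HT -mulmxA.
Qed.

Lemma nullity_law v : in_nullity T' v <-> in_nullity T (J *m v).
Proof.
split=> H k l.
  rewrite -ctr_delta -(mulKVmx uJ (delta_mx k 0)) -(mulKVmx uJ (delta_mx l 0)).
  by rewrite -weyl_law in_nullity_ctr // mulmx0.
by rewrite -ctr_delta -[LHS](mulKmx uJ) weyl_law in_nullity_ctr // mulmx0.
Qed.

End Law.
End TensorLaw.

(** * Connections under a change of coordinates *)

Section ChangeOfCoordinates.
Context {R : realType} {n : nat}.
Variables (V W : set 'rV[R]_n) (phi : 'rV[R]_n -> 'rV[R]_n).
Hypotheses (oV : open V) (oW : open W) (VW : forall z, V z -> W (phi z)).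
Hypothesis Sphi : forall i, smooth_on V (fun z => phi z 0 i).
Implicit Types (y z : 'rV[R]_n).

Definition jac z : 'M[R]_n := \matrix_(i, j) partial j (fun x => phi x 0 i) z.

Lemma smooth_jac : smooth_mx V jac.
Proof.
move=> i j; rewrite (_ : (fun z => _) = partial j (fun x => phi x 0 i)).
  exact: smooth_derive (Sphi i).
by apply/funext => z; rewrite mxE.
Qed.

Lemma jac_sym y : V y -> forall k i j,
  mxderive (coordv k) jac y i j = mxderive (coordv j) jac y i k.
Proof.
move=> Vy k i j.
have E l : (fun z => jac z i l) = 'D_(coordv l) (fun x => phi x 0 i).
  by apply/funext => z; exact: mxE.
have D a b : mxderive (coordv a) jac y i b =
    'D_(coordv a) ('D_(coordv b) (fun x => phi x 0 i)) y.
  by rewrite -E; exact: mxE.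
exact: etrans (D k j) (etrans
  (schwarz (coordv k) (coordv j) oV (Sphi i 2%N) Vy) (esym (D j k))).
Qed.

Lemma phi_continuous y : V y -> {for y, continuous phi}.
Proof. by move=> Vy; apply: row_continuous => i; exact: smooth_continuous (Sphi i) Vy. Qed.

Lemma is_mxderive_comp m p (A : 'rV[R]_n -> 'M[R]_(m, p)) y k : smooth_mx W A -> V y ->
  is_mxderive y (coordv k) (fun z => A (phi z))
    (\sum_a jac y a k *: mxderive (coordv a) A (phi y)).
Proof.
move=> SA Vy i j; rewrite summxE.
under eq_bigr => a _ do rewrite mxE [jac y a k]mxE [mxderive _ _ _ _ _]mxE.
apply: (is_derive_comp oW (SA i j 1%N) (VW Vy) (phi_continuous Vy)) => a.
exact: smooth_derivable (Sphi a) Vy.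
Qed.

Lemma is_mxderive_sum m p (I : Type) (r : seq I) (A : I -> 'rV[R]_n -> 'M[R]_(m, p))
    (dA : I -> 'M[R]_(m, p)) y v :
  (forall i, is_mxderive y v (A i) (dA i)) ->
  is_mxderive y v (fun z => \sum_(i <- r) A i z) (\sum_(i <- r) dA i).
Proof.
move=> H i j; rewrite summxE; under eq_fun do rewrite summxE.
by apply: is_derive_sumE => k; exact: H.
Qed.

Lemma is_mxderiveZ m p (a : 'rV[R]_n -> R) (A : 'rV[R]_n -> 'M[R]_(m, p)) y v da dA :
  is_derive y v a da -> is_mxderive y v A dA ->
  is_mxderive y v (fun z => a z *: A z) (da *: A y + a y *: dA).
Proof.
move=> Ha HA i j; rewrite !mxE; under eq_fun do rewrite mxE.
exact: is_deriveME.
Qed.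

Section Connections.
Variable D : 'I_n -> 'rV[R]_n -> 'M[R]_n.
Hypothesis SD : forall k, smooth_mx W (D k).

(* the pull-back of the connection form D, before the change of frame *)
Definition pullconn k z : 'M[R]_n := \sum_a jac z a k *: D a (phi z).

Lemma is_mxderive_pullconn y k l : V y ->
  is_mxderive y (coordv l) (pullconn k) (\sum_a
    (mxderive (coordv l) jac y a k *: D a (phi y) +
     jac y a k *: \sum_b jac y b l *: mxderive (coordv b) (D a) (phi y))).
Proof.
move=> Vy; apply: is_mxderive_sum => a; apply: is_mxderiveZ.
  by rewrite mxE; exact: smooth_derivable (smooth_jac a k) Vy.
exact: is_mxderive_comp.
Qed.

(** Curvature commutes with pull-back: the terms in the second derivatives of [phi] cancel by
    [jac_sym]. *)
Lemma curv_pullconn y k l : V y -> curv pullconn k l y =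
  \sum_a \sum_b (jac y a k * jac y b l) *: curv D a b (phi y).
Proof.
move=> Vy; rewrite /curv.
rewrite (is_mxderiveE (is_mxderive_pullconn l k Vy)).
rewrite (is_mxderiveE (is_mxderive_pullconn k l Vy)).
have -> : \sum_a (mxderive (coordv k) jac y a l *: D a (phi y) +
     jac y a l *: \sum_b jac y b k *: mxderive (coordv b) (D a) (phi y)) =
   \sum_a mxderive (coordv k) jac y a l *: D a (phi y) +
   \sum_a \sum_b (jac y a k * jac y b l) *: mxderive (coordv a) (D b) (phi y).
  rewrite big_split /=; congr (_ + _); rewrite exchange_big /=.
  apply: eq_bigr => a _; rewrite scaler_sumr; apply: eq_bigr => b _.
  by rewrite scalerA mulrC.
have -> : \sum_a (mxderive (coordv l) jac y a k *: D a (phi y) +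
     jac y a k *: \sum_b jac y b l *: mxderive (coordv b) (D a) (phi y)) =
   \sum_a mxderive (coordv k) jac y a l *: D a (phi y) +
   \sum_a \sum_b (jac y a k * jac y b l) *: mxderive (coordv b) (D a) (phi y).
  rewrite big_split /=; congr (_ + _).
    by apply: eq_bigr => a _; congr (_ *: _); exact: jac_sym.
  apply: eq_bigr => a _; rewrite scaler_sumr; apply: eq_bigr => b _.
  by rewrite scalerA.
have M1 : pullconn k y *m pullconn l y =
    \sum_a \sum_b (jac y a k * jac y b l) *: (D a (phi y) *m D b (phi y)).
  rewrite /pullconn mulmx_suml; apply: eq_bigr => a _; rewrite mulmx_sumr.
  by apply: eq_bigr => b _; rewrite -scalemxAl -scalemxAr scalerA.
have M2 : pullconn l y *m pullconn k y =
    \sum_a \sum_b (jac y a k * jac y b l) *: (D b (phi y) *m D a (phi y)).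
  rewrite /pullconn mulmx_suml exchange_big /=; apply: eq_bigr => a _; rewrite mulmx_sumr.
  by apply: eq_bigr => b _; rewrite -scalemxAl -scalemxAr scalerA mulrC.
rewrite M1 M2 opprD [X in X + _]addrACA subrr add0r -!sumrB -big_split; apply: eq_bigr => a _ /=.
rewrite -!sumrB -big_split; apply: eq_bigr => b _ /=.
by rewrite -!scalerBr -scalerDr.
Qed.

Variable C : 'I_n -> 'rV[R]_n -> 'M[R]_n.
Hypothesis SC : forall k, smooth_mx V (C k).
Hypothesis gauge : forall k z, V z ->
  jac z *m C k z = pullconn k z *m jac z + mxderive (coordv k) jac z.

(** Differentiate [gauge] for [l] along [k] and for [k] along [l], and subtract: the second
    derivatives of the Jacobian cancel by Schwarz, and its first derivatives are eliminated by
    [gauge] itself. *)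
Lemma curv_gauge y k l : V y -> jac y *m curv C k l y = curv pullconn k l y *m jac y.
Proof.
move=> Vy.
have E a b : mxderive (coordv a) jac y *m C b y + jac y *m mxderive (coordv a) (C b) y =
   mxderive (coordv a) (pullconn b) y *m jac y +
   pullconn b y *m mxderive (coordv a) jac y + mxderive (coordv a) (mxderive (coordv b) jac) y.
  have HJ := smooth_is_mxderive (coordv a) smooth_jac Vy.
  apply: (is_mxderive_unique (A := fun z => jac z *m C b z) (y := y) (v := coordv a)).
    exact: is_mxderiveM HJ (smooth_is_mxderive _ (SC b) Vy).
  apply: is_mxderive_near (is_mxderiveD (is_mxderiveM _ HJ)
     (smooth_is_mxderive _ (smooth_mxderive _ smooth_jac) Vy)).
    by apply: open_near oV _ Vy => z Vz; rewrite gauge.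
  by rewrite (is_mxderiveE (is_mxderive_pullconn _ _ Vy)); exact: is_mxderive_pullconn.
have S := mxderive_schwarz (coordv k) (coordv l) oV smooth_jac Vy.
have Ek := E k l; have El := E l k.
have move_term (X Y Z : 'M[R]_n) : X = Y + Z -> Z = X - Y.
  by move=> ->; rewrite addrC addKr.
have Gk := move_term _ _ _ (gauge k Vy); have Gl := move_term _ _ _ (gauge l Vy).
move: Ek El; rewrite -S /curv Gk Gl => Ek El.
have := congr2 (fun A B => A - B) Ek El; rewrite /= => H.
apply/eqP; rewrite -subr_eq0; apply/eqP.
move/eqP: H; rewrite -subr_eq0 => /eqP H; rewrite -[RHS]H.
move: (mxderive _ (C l) y) (mxderive _ (C k) y) (mxderive _ (pullconn l) y)
  (mxderive _ (pullconn k) y) (mxderive _ (mxderive _ _) y) (jac y) (C k y) (C l y)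
  (pullconn k y) (pullconn l y) => a1 a2 a3 a4 a5 a6 a7 a8 a9 a0.
by mx_abel.
Qed.

End Connections.
End ChangeOfCoordinates.

(** * Christoffel symbols and curvature of a pulled-back metric *)

Section MetricChange.
Context {R : realType} {n : nat}.
Variables (V W : set 'rV[R]_n) (phi : 'rV[R]_n -> 'rV[R]_n) (G' G : 'rV[R]_n -> 'M[R]_n).
Hypotheses (mG' : metric_on V G') (mG : metric_on W G) (VW : forall z, V z -> W (phi z)).
Hypothesis Sphi : forall i, smooth_on V (fun z => phi z 0 i).
Hypothesis GG : forall z, V z -> G' z = (jac phi z)^T *m G (phi z) *m jac phi z.
Implicit Types (y z : 'rV[R]_n).

Let oV : open V. Proof. by case: mG'. Qed.
Let oW : open W. Proof. by case: mG. Qed.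

(** Read off from the nondegeneracy of $G' = J^T G J$. *)
Lemma jac_unit y : V y -> jac phi y \in unitmx.
Proof.
move=> Vy; have [_ _ _ /(_ y Vy)] := mG'.
by rewrite GG // unitmx_mul => /andP[].
Qed.

(** Solve the desired law for [C] and recognise [C] as the Levi-Civita connection of [G']: it is
    torsion-free by [jac_sym] and [chris_sym], and metric by the product rule applied to [GG]. *)
Lemma chris_gauge k y : V y ->
  jac phi y *m chris G' k y = pullconn phi (chris G) k y *m jac phi y +
    mxderive (coordv k) (jac phi) y.
Proof.
move=> Vy; have uJ := jac_unit Vy.
have [_ SG sG uG] := mG; have [_ SG' sG' uG'] := mG'.
pose C k := invmx (jac phi y) *m (pullconn phi (chris G) k y *m jac phi y +
    mxderive (coordv k) (jac phi) y).
suff -> : chris G' k y = C k by rewrite mulKVmx.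
rewrite chrisE; apply/esym.
apply: (koszul_unique (G := G' y) (dG := fun l => mxderive (coordv l) G' y)).
- exact: sG'.
- by move=> l; exact: mxderive_sym mG' Vy.
- exact: uG'.
- move=> l i j.
  have E : pullconn phi (chris G) l y *m jac phi y + mxderive (coordv l) (jac phi) y =
    \matrix_(i, j) (\sum_a \sum_b jac phi y a l * jac phi y b j * chris G a (phi y) i b
      + mxderive (coordv l) (jac phi) y i j).
    apply/matrixP => p q; rewrite [LHS]mxE [RHS]mxE; congr (_ + _).
    rewrite mxE exchange_big /=; apply: eq_bigr => b _.
    by rewrite summxE mulr_suml; apply: eq_bigr => a _; rewrite mxE; ring.
  have E' : pullconn phi (chris G) j y *m jac phi y + mxderive (coordv j) (jac phi) y =
    \matrix_(i, q) (\sum_a \sum_b jac phi y a j * jac phi y b q * chris G a (phi y) i b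
      + mxderive (coordv j) (jac phi) y i q).
    apply/matrixP => p q; rewrite [LHS]mxE [RHS]mxE; congr (_ + _).
    rewrite mxE exchange_big /=; apply: eq_bigr => b _.
    by rewrite summxE mulr_suml; apply: eq_bigr => a _; rewrite mxE; ring.
  rewrite /C E E' [LHS]mxE [RHS]mxE; apply: eq_bigr => p _; congr (_ * _).
  rewrite [LHS]mxE [RHS]mxE; congr (_ + _); last exact: jac_sym oV Sphi _ Vy _ _ _.
  rewrite exchange_big /=; apply: eq_bigr => a _; apply: eq_bigr => b _.
  by rewrite (chris_sym _ _ _ mG (VW Vy)); ring.
move=> l; have HJ := smooth_is_mxderive (coordv l) (smooth_jac Sphi) Vy.
have HG := is_mxderive_comp oW VW Sphi l SG Vy.
have HH := is_mxderiveM (is_mxderiveM (is_mxderive_tr HJ) HG) HJ.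
have N : \forall z \near y, (jac phi z)^T *m G (phi z) *m jac phi z = G' z.
  by apply: open_near oV _ Vy => z Vz; rewrite GG.
rewrite (is_mxderiveE (is_mxderive_near N HH)) GG //.
have -> : \sum_a jac phi y a l *: mxderive (coordv a) G (phi y) =
    (pullconn phi (chris G) l y)^T *m G (phi y) + G (phi y) *m pullconn phi (chris G) l y.
  rewrite /pullconn linear_sum /= mulmx_suml mulmx_sumr -big_split /=.
  apply: eq_bigr => a _; rewrite (chris_metric _ mG (VW Vy)).
  by rewrite scalerDr linearZ /= -scalemxAl -scalemxAr.
have CE : jac phi y *m C l = pullconn phi (chris G) l y *m jac phi y +
    mxderive (coordv l) (jac phi) y by rewrite mulKVmx.
move: (C l) CE; move: (mxderive _ (jac phi) y) (pullconn _ _ _ _) (jac phi y)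
  (G (phi y)) => dJ A J g c CE.
have -> : c^T *m (J^T *m g *m J) = (J *m c)^T *m g *m J by rewrite trmx_mul !mulmxA.
have -> : J^T *m g *m J *m c = J^T *m g *m (J *m c) by rewrite !mulmxA.
rewrite CE.
have -> : (A *m J + dJ)^T = J^T *m A^T + dJ^T.
  by rewrite -trmx_mul; move: (A *m J) => X; apply/matrixP => i j; rewrite !mxE.
by mx_abel.
Qed.

Lemma riem_law y : V y -> tensor_law (jac phi y) (riem G' y) (riem G (phi y)).
Proof.
move=> Vy; apply: tensor_lawP => k l.
have SC a := smooth_chris a mG'; have SD a := smooth_chris a mG.
rewrite /riem.
by rewrite (curv_gauge oV oW VW Sphi SD SC chris_gauge k l Vy)
  (curv_pullconn oV oW VW Sphi SD k l Vy).
Qed.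

End MetricChange.

(** * Covariant acceleration of a curve *)

Section GeodesicOperator.
Context {R : realType} {n : nat}.
Implicit Types (u : R -> 'rV[R]_n) (G : 'rV[R]_n -> 'M[R]_n) (t : R) (I : set R).

Definition velocity u t : 'cV[R]_n := \col_i 'D_1 (fun s => u s 0 i) t.
Definition second_derivative u t : 'cV[R]_n := \col_i 'D_1 ('D_1 (fun s => u s 0 i)) t.

Definition covariant_acceleration G u t : 'cV[R]_n := second_derivative u t +
  \sum_k velocity u t k 0 *: (chris G k (u t) *m velocity u t).

Lemma covariant_accelerationE G u t i : covariant_acceleration G u t i 0 =
  'D_1 ('D_1 (fun s => u s 0 i)) t + \sum_j \sum_k christoffel G i j k (u t)
     * 'D_1 (fun s => u s 0 j) t * 'D_1 (fun s => u s 0 k) t.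
Proof.
rewrite [LHS]mxE [X in X + _]mxE; congr (_ + _); rewrite summxE.
apply: eq_bigr => j _; rewrite [LHS]mxE [X in X * _]mxE [X in _ * X]mxE mulr_sumr.
by apply: eq_bigr => k _; rewrite !mxE; ring.
Qed.

Variables (V W : set 'rV[R]_n) (phi : 'rV[R]_n -> 'rV[R]_n) (G' G : 'rV[R]_n -> 'M[R]_n).
Hypotheses (mG' : metric_on V G') (mG : metric_on W G) (VW : forall z, V z -> W (phi z)).
Hypothesis Sphi : forall i, smooth_on V (fun z => phi z 0 i).
Hypothesis GG : forall z, V z -> G' z = (jac phi z)^T *m G (phi z) *m jac phi z.
Variables (I : set R) (u : R -> 'rV[R]_n).
Hypotheses (oI : open I) (IV : forall t, I t -> V (u t)).
Hypothesis Su : forall i, smooth_on I (fun t => u t 0 i).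

Let oV : open V. Proof. by case: mG'. Qed.
Let oW : open W. Proof. by case: mG. Qed.

Lemma is_derive_curve (f : 'rV[R]_n -> R) t : smooth_on V f -> I t ->
  is_derive t 1 (fun s => f (u s)) (\sum_a velocity u t a 0 * partial a f (u t)).
Proof.
move=> Sf It; under eq_bigr => a _ do rewrite mxE.
apply: (is_derive_comp oV (Sf 1%N) (IV It)).
  by apply: row_continuous => i; exact: smooth_continuous (Su i) It.
by move=> a; exact: smooth_derivable (Su a) It.
Qed.

Lemma velocity_comp t : I t -> velocity (phi \o u) t = jac phi (u t) *m velocity u t.
Proof.
move=> It; apply/colP => i; rewrite [LHS]mxE [RHS]mxE.
have [_ ->] := is_derive_curve (Sphi i) It.
by apply: eq_bigr => a _; rewrite [jac phi _ _ _]mxE mulrC.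
Qed.

Lemma second_derivative_comp t : I t -> second_derivative (phi \o u) t =
  jac phi (u t) *m second_derivative u t +
  \sum_b velocity u t b 0 *: (mxderive (coordv b) (jac phi) (u t) *m velocity u t).
Proof.
move=> It; apply/colP => i; rewrite [LHS]mxE.
have N : \forall s \near t, \sum_a velocity u s a 0 * jac phi (u s) i a =
    'D_1 (fun s => (phi \o u) s 0 i) s.
  apply: open_near oI _ It => s Is.
  have := velocity_comp Is => /colP /(_ i); rewrite [X in X = _]mxE => ->.
  by rewrite mxE; apply: eq_bigr => a _; rewrite mulrC.
have SJ := smooth_jac Sphi.
have D a : is_derive t 1 (fun s => velocity u s a 0 * jac phi (u s) i a)
    (second_derivative u t a 0 * jac phi (u t) i a + velocity u t a 0 *
     \sum_b velocity u t b 0 * mxderive (coordv b) (jac phi) (u t) i a).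
  apply: is_deriveME.
    rewrite mxE (_ : (fun s => velocity u s a 0) = 'D_1 (fun s => u s 0 a)).
      have H := smooth_derivable (1 : R) (smooth_derive (1 : R) (Su a)) It.
      exact: H.
    by apply/funext => s; exact: mxE.
  under eq_bigr => b _ do rewrite [mxderive _ _ _ _ _]mxE.
  exact: is_derive_curve (SJ i a) It.
have [_ HE] := near_eq_is_derive N (is_derive_sumE (index_enum 'I_n) D).
apply: (etrans HE); rewrite big_split /= [RHS]mxE; congr (_ + _).
  by rewrite [RHS]mxE; apply: eq_bigr => a _; rewrite mulrC.
rewrite summxE; under [LHS]eq_bigr => a _ do rewrite mulr_sumr.
rewrite exchange_big /=; apply: eq_bigr => b _.
rewrite [RHS]mxE [X in _ = _ * X]mxE mulr_sumr; apply: eq_bigr => a _.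
by move: (mxderive _ _ _) (velocity _ _) => X Y; ring.
Qed.

(** The derivative of the Jacobian that the second derivative of [phi \o u] produces is matched by
    the inhomogeneous term of [chris_gauge]. Hence the geodesic equation in one chart implies it in
    any other. *)
Lemma covariant_acceleration_law t : I t -> covariant_acceleration G (phi \o u) t =
  jac phi (u t) *m covariant_acceleration G' u t.
Proof.
move=> It; have Vu := IV It.
rewrite /covariant_acceleration velocity_comp // second_derivative_comp //.
rewrite mulmxDr -addrA; congr (_ + _).
set p := velocity u t; clearbody p; rewrite mulmx_sumr.
under [RHS]eq_bigr => k _ do rewrite -scalemxAr mulmxA (chris_gauge mG' mG VW Sphi GG k Vu)
  mulmxDl scalerDr.
rewrite big_split /= addrC; congr (_ + _).
rewrite {1}mul_col_sum.
transitivity (\sum_a \sum_k (p k 0 * jac phi (u t) a k) *: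
    (chris G a (phi (u t)) *m (jac phi (u t) *m p))).
  apply: eq_bigr => a _; rewrite -scaler_suml; congr (_ *: _).
  by rewrite summxE; apply: eq_bigr => k _; rewrite !mxE.
rewrite exchange_big /=; apply: eq_bigr => k _.
rewrite /pullconn -mulmxA mulmx_suml scaler_sumr; apply: eq_bigr => a _.
by rewrite -scalemxAl scalerA.
Qed.

End GeodesicOperator.

(** * Geodesics and projective changes of metric *)

Section Charts.
Context {R : realType} {n : nat} {M : smooth_manifold R n}.
Implicit Types (g : metric M) (c d : chart R n M) (x : M) (U : set M).

Lemma chart_image_open c U : open U -> open (chart_image c U).
Proof.
move=> oU; rewrite openE => y [Cy Uy].
have N1 : nbhs y (ccod c) by apply: open_nbhs_nbhs; split => //; exact: ccod_open.
have N2 : nbhs y (cinv c @^-1` U).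
  by apply: (cinv_continuous Cy); exact: open_nbhs_nbhs.
exact: filterI N1 N2.
Qed.

Lemma chart_imageS c U : chart_image c U `<=` ccod c.
Proof. by move=> y []. Qed.

Lemma metric_on_ccod g c : atlas c -> metric_on (ccod c) (gmx g c).
Proof.
move=> ac; split; first exact: ccod_open.
- by move=> i j; exact: (metric_smooth g ac).
- by move=> z Cz; exact: (Defs.metric_sym g ac Cz).
by move=> z Cz; exact: (metric_nondegenerate g ac Cz).
Qed.

Lemma metric_onS (V W : set 'rV[R]_n) G : open V -> V `<=` W -> metric_on W G -> metric_on V G.
Proof.
move=> oV VW [_ SG sG uG]; split => //.
- by move=> i j; exact: smooth_sub (SG i j).
- by move=> z /VW; exact: sG.
by move=> z /VW; exact: uG.
Qed.

Lemma metric_on_chart_image g c U : atlas c -> open U ->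
  metric_on (chart_image c U) (gmx g c).
Proof.
move=> ac oU; apply: metric_onS (metric_on_ccod g ac); last exact: chart_imageS.
exact: chart_image_open.
Qed.

Lemma transition_ccod c d y : chart_image c (cdom d) y -> ccod d (transition c d y).
Proof. by move=> [_ ?]; exact: cmap_fun. Qed.

Lemma chart_point_image c d x : chart_at c x -> chart_at d x ->
  chart_image c (cdom d) (cmap c x).
Proof.
by move=> [ac cx] [ad dx]; split; [exact: cmap_fun|rewrite /preimage /= cmapK].
Qed.

Lemma transition_point c d x : chart_at c x -> transition c d (cmap c x) = cmap d x.
Proof. by move=> [ac cx]; rewrite /transition cmapK. Qed.

Lemma chart_riem_law g c d x : chart_at c x -> chart_at d x ->
  tensor_law (jac (transition c d) (cmap c x)) (riem (gmx g c) (cmap c x))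
    (riem (gmx g d) (cmap d x)).
Proof.
move=> cx dx; have [ac _] := cx; have [ad _] := dx.
have := riem_law (metric_on_chart_image g ac (@cdom_open _ _ _ d)) (metric_on_ccod g ad)
  (@transition_ccod c d) (atlas_smooth ac ad) (metric_transition g ac ad)
  (chart_point_image cx dx).
by rewrite transition_point.
Qed.

Lemma chart_jac_unit g c d x : chart_at c x -> chart_at d x ->
  jac (transition c d) (cmap c x) \in unitmx.
Proof.
move=> cx dx; have [ac _] := cx; have [ad _] := dx.
exact: (jac_unit (metric_on_chart_image g ac (@cdom_open _ _ _ d)) (metric_transition g ac ad)
  (chart_point_image cx dx)).
Qed.

Lemma chart_metric_law g c d x : chart_at c x -> chart_at d x ->
  gmx g c (cmap c x) = (jac (transition c d) (cmap c x))^T *m gmx g d (cmap d x)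
    *m jac (transition c d) (cmap c x).
Proof.
move=> cx dx; have [ac _] := cx; have [ad _] := dx.
by rewrite {1}(metric_transition g ac ad (chart_point_image cx dx)) transition_point.
Qed.

(** The equation is solved in the chart [c] only, while [geodesic] asks for it in every chart [d];
    on the open set of times where the curve lies in [d] it is carried over by
    [covariant_acceleration_law]. *)
Lemma geodesic_exists g c (y w : 'rV[R]_n) : atlas c -> ccod c y ->
  exists2 e : R, 0 < e & exists gamma : R -> M,
  [/\ geodesic g [set t | `|t| < e] gamma, cmap c (gamma 0) = y,
    forall t, `|t| < e -> cdom c (gamma t) &
    forall i, 'D_1 (Defs.coord c gamma i) 0 = w 0 i].
Proof.
move=> ac Cy.
have SG i j k : smooth_on (ccod c) (christoffel (gmx g c) i j k).
  have := smooth_chris j (metric_on_ccod g ac) i k.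
  rewrite (_ : (fun z => _) = christoffel (gmx g c) i j k) //.
  by apply/funext => z; rewrite mxE.
have [e e0 [u [u0 uC Su u1 uE]]] :=
  geodesic_ode (Gam := christoffel (gmx g c)) w (@ccod_open _ _ _ c) SG Cy.
exists e => //; exists (fun t => cinv c (u t)).
pose I := [set t : R | `|t| < e].
have oI : open I by exact: open_ball0.
have coordE i : {in I, (fun t => u t 0 i) =1 Defs.coord c (fun t => cinv c (u t)) i}.
  by move=> t; rewrite inE => It; rewrite /Defs.coord cinvK //; exact: uC.
have uCont t : I t -> {for t, continuous u}.
  by move=> It; apply: row_continuous => i; exact: smooth_continuous (Su i) It.
split; last first.
- move=> i; rewrite -u1; apply: near_eq_derive.
  have I0 : I 0 by rewrite /I /= normr0.
  apply: open_near oI _ I0 => t It.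
  by rewrite /Defs.coord cinvK //; exact: uC.
- by move=> t /uC; exact: cinv_fun.
- by rewrite cinvK u0.
split=> [t It|d ad].
  by apply: continuous_comp; [exact: uCont|apply: cinv_continuous; exact: uC].
pose V := chart_image c (cdom d).
have oV : open V by apply: chart_image_open; exact: cdom_open.
pose I' := I `&` (fun t => cinv c (u t)) @^-1` cdom d.
have I'V t : I' t -> V (u t) by move=> [It dt]; split => //; exact: uC.
have oI' : open I'.
  rewrite openE => t I't; have [It dt] := I't.
  have N1 : nbhs t I by exact: open_nbhs_nbhs.
  have N2 : nbhs t (u @^-1` V).
    by apply: (uCont _ It); apply: open_nbhs_nbhs; split => //; exact: I'V.
  by apply: filterS2 N1 N2 => s Is [_ Vs].
have Su' i : smooth_on I' (fun t => u t 0 i) by apply: smooth_sub (Su i) => t [].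
split=> [i|t It dt i].
  exact: smooth_comp oI' oV I'V (atlas_smooth ac ad i) Su'.
have I't : I' t by [].
have := covariant_acceleration_law (metric_on_chart_image g ac (@cdom_open _ _ _ d)) (metric_on_ccod g ad)
  (@transition_ccod c d) (atlas_smooth ac ad) (metric_transition g ac ad) oI' I'V Su' I't.
have -> : covariant_acceleration (gmx g c) u t = 0.
  by apply/colP => j; rewrite covariant_accelerationE uE // mxE.
rewrite mulmx0 => /colP /(_ i); rewrite covariant_accelerationE [RHS]mxE => H.
exact: H.
Qed.

End Charts.

(** * Comparison of the connections of projectively equivalent metrics *)

Section ProjectiveChange.
Context {R : realType} {n : nat} {M : smooth_manifold R n}.
Implicit Types (g h : metric M) (c : chart R n M).

Lemma is_derive1_comp (f rho : R -> R) (s df dr : R) :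
  is_derive s 1 rho dr -> is_derive (rho s) 1 f df ->
  is_derive s 1 (fun t => f (rho t)) (df * dr).
Proof.
move=> [r1 r2] [f1 f2]; split.
  by apply/derivable1_diffP/differentiable_comp; apply/derivable1_diffP; [exact: r1|exact: f1].
by have := derive1_comp r1 f1; rewrite !derive1E r2 f2.
Qed.

(* If the reparametrised g-geodesic with initial velocity w is an h-geodesic,
   comparing the two geodesic equations leaves a multiple of w. *)
Lemma geodesics_included_quadratic g h c (y w : 'rV[R]_n) : geodesics_included g h ->
  atlas c -> ccod c y -> exists lam : R, forall i,
  \sum_j \sum_k (christoffel (gmx h c) i j k y - christoffel (gmx g c) i j k y)
     * w 0 j * w 0 k = lam * w 0 i.
Proof.
move=> gh ac Cy; have [e e0 [gam [geo gam0 gamc vel]]] := geodesic_exists g w ac Cy.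
pose I := [set t : R | `|t| < e].
have oI : open I by exact: open_ball0.
have I0 : I 0 by rewrite /I /= normr0.
have iI : is_interval I.
  move=> a b; rewrite /I /= !ltr_norml => /andP[a1 a2] /andP[b1 b2] z /andP[az zb].
  by rewrite ltr_norml; apply/andP; split; [exact: lt_le_trans az|exact: le_lt_trans b2].
have [J [rho [[oJ _ _] [bij Srho rho0] geoh]]] := gh I gam (And3 oI iI (ex_intro _ 0 I0)) geo.
have [s0 Js0 rs0] : exists2 s, J s & rho s = 0.
  by have [_ _ /(_ 0 I0)[s Js E]] := bij; exists s.
have JI s : J s -> I (rho s) by have [H _ _] := bij; exact: H.
have [_ /(_ c ac)[Sg Eg]] := geo.
have [_ /(_ c ac)[_ Eh]] := geoh.
pose u i := Defs.coord c gam i.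
have Su i : smooth_on I (u i).
  by apply: smooth_sub (Sg i) => t It; split => //; exact: gamc.
have D1 i s : J s -> is_derive s 1 (Defs.coord c (gam \o rho) i)
    ('D_1 (u i) (rho s) * 'D_1 rho s).
  move=> Js; apply: (is_derive1_comp (f := u i)).
    exact: smooth_derivable (Srho) Js.
  exact: smooth_derivable (Su i) (JI _ Js).
have D2 i s : J s -> 'D_1 ('D_1 (Defs.coord c (gam \o rho) i)) s =
    'D_1 ('D_1 (u i)) (rho s) * 'D_1 rho s ^+ 2 + 'D_1 (u i) (rho s) * 'D_1 ('D_1 rho) s.
  move=> Js.
  have N : \forall z \near s, 'D_1 (u i) (rho z) * 'D_1 rho z =
      'D_1 (Defs.coord c (gam \o rho) i) z.
    by apply: open_near oJ _ Js => z Jz; have [_ ->] := D1 i z Jz.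
  have Hr := smooth_derivable (1 : R) Srho Js.
  have Hr2 := smooth_derivable (1 : R) (smooth_derive (1 : R) Srho) Js.
  have Hu := smooth_derivable (1 : R) (smooth_derive (1 : R) (Su i)) (JI _ Js).
  have H := is_deriveME (is_derive1_comp Hr Hu) Hr2.
  have [_ HE] := near_eq_is_derive N H.
  by apply: (etrans HE); rewrite expr2 mulrA.
pose r : R := 'D_1 rho s0; pose r2 : R := 'D_1 ('D_1 rho) s0.
have r0 : r != 0 by exact: rho0.
(* At [s0] the acceleration of the reparametrised curve is $u''\rho'^2 + w\rho''$. Dividing the
   equation of [h] by $\rho'^2$ and subtracting that of [g] leaves $-(\rho''/\rho'^2)\,w$. *)
exists (- r2 / r ^+ 2) => i.
have velE j : 'D_1 (u j) 0 = w 0 j by exact: vel.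
have D1E j : 'D_1 (Defs.coord c (gam \o rho) j) s0 = w 0 j * r.
  by have [_ ->] := D1 j s0 Js0; rewrite rs0 velE.
pose S f := \sum_j \sum_k christoffel (gmx f c) i j k y * w 0 j * w 0 k.
have Hg : 'D_1 ('D_1 (u i)) 0 + S g = 0.
  have := Eg 0 I0 (gamc 0 I0) i; rewrite gam0 => Eg0.
  rewrite -[RHS]Eg0; congr (_ + _); apply: eq_bigr => j _; apply: eq_bigr => k _.
  by rewrite -!velE.
have Hh : 'D_1 ('D_1 (u i)) 0 * r ^+ 2 + w 0 i * r2 + r ^+ 2 * S h = 0.
  have c0 : cdom c ((gam \o rho) s0) by rewrite /= rs0; exact: gamc.
  have := Eh s0 Js0 c0 i; rewrite D2 // rs0 velE /= rs0 gam0 => Eh0.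
  rewrite -[RHS]Eh0; congr (_ + _); rewrite mulr_sumr.
  apply: eq_bigr => j _; rewrite mulr_sumr; apply: eq_bigr => k _.
  by rewrite !D1E; ring.
transitivity (S h - S g).
  rewrite /S -sumrB; apply: eq_bigr => j _; rewrite -sumrB; apply: eq_bigr => k _.
  by ring.
move: Hg Hh; move: ('D_1 ('D_1 (u i)) 0 : R) (S h) (S g) => a b b' Hg Hh.
clearbody r r2; apply: (@mulfI _ (r ^+ 2)); first by rewrite expf_neq0.
have -> : b' = - a by lra.
have -> : r ^+ 2 * (- r2 / r ^+ 2 * w 0 i) = - (w 0 i * r2) by field.
lra.
Qed.

End ProjectiveChange.

Section Polarization.
Context {R : realType} {n : nat}.

(* Compare w = e_j, w = e_j + e_k and w = e_j - e_k. *)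
Lemma quadratic_proportional (D : 'I_n -> 'I_n -> 'I_n -> R) :
  (forall i j k, D i j k = D i k j) ->
  (forall w : 'rV[R]_n, exists lam, forall i,
     \sum_j \sum_k D i j k * w 0 j * w 0 k = lam * w 0 i) ->
  exists U : 'I_n -> R, forall i j k,
    D i j k = (i == j)%:R * U k + (i == k)%:R * U j.
Proof.
move=> sD HD.
have expand (s : R) (j k : 'I_n) i : \sum_a \sum_b D i a b *
    (delta_mx 0 j + s *: delta_mx 0 k : 'rV[R]_n) 0 a *
    (delta_mx 0 j + s *: delta_mx 0 k : 'rV[R]_n) 0 b =
    D i j j + s * D i j k + s * D i k j + s ^+ 2 * D i k k.
  have inner (f : 'I_n -> R) : \sum_b f b *
      (delta_mx 0 j + s *: delta_mx 0 k : 'rV[R]_n) 0 b = f j + s * f k.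
    under eq_bigr => b _ do rewrite !mxE eqxx /= mulrDr.
    rewrite big_split /=; congr (_ + _).
      by rewrite (bigD1 j) //= big1 ?addr0 ?eqxx ?mulr1 // => b /negbTE ->; rewrite mulr0.
    rewrite (bigD1 k) //= big1 ?addr0 ?eqxx ?mulr1 1?mulrC // => b /negbTE ->.
    by rewrite !mulr0.
  under eq_bigr => a _ do rewrite inner.
  under eq_bigr => a _ do rewrite mulrA -mulrDl.
  rewrite (inner (fun a => D i a j + s * D i a k)); ring.
have diag j : exists lam, forall i, D i j j = (i == j)%:R * lam.
  have [lam H] := HD (delta_mx 0 j + 0 *: delta_mx 0 j).
  exists lam => i; have := H i; rewrite expand !mul0r expr0n !mul0r !addr0 => ->.
  by rewrite !mxE eqxx /= mul0r addr0 mulrC.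
pose U j := sval (cid (diag j)) / 2.
have UE i j : D i j j = (i == j)%:R * (2 * U j).
  by rewrite /U; case: cid => lam /= ->; field.
clearbody U; exists U => i j k; have [<-|jk] := eqVneq j k; first by rewrite UE; ring.
have [lp Hp] := HD (delta_mx 0 j + 1 *: delta_mx 0 k).
have [lm Hm] := HD (delta_mx 0 j + (-1) *: delta_mx 0 k).
have {}Hp l := etrans (esym (expand 1 j k l)) (Hp l).
have {}Hm l := etrans (esym (expand (-1) j k l)) (Hm l).
have mxE' (s : R) l : (delta_mx 0 j + s *: delta_mx 0 k : 'rV[R]_n) 0 l =
    (l == j)%:R + s * (l == k)%:R by rewrite !mxE eqxx.
have kj : (k == j) = false by rewrite eq_sym; exact/negbTE.
have := Hp j; have := Hm j; have := Hp k; have := Hm k.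
rewrite !mxE' !UE !(sD _ k j) !eqxx (negbTE jk) kj /= mulr0n mulr1n => E1 E2 E3 E4.
(* Components [j] and [k] of the equations for $e_j + e_k$ and $e_j - e_k$ express [U j] and [U k]
   by the factors [lp] and [lm]; component [i] of their difference is then four times the claim. *)
have Uj : U j = (lp + lm) / 4 by lra.
have Uk : U k = (lp - lm) / 4 by lra.
have := Hp i; have := Hm i; rewrite !mxE' !(sD _ k j) Uj Uk => E5 E6.
lra.
Qed.

End Polarization.

(** * Projective invariance of the Weyl tensor *)

Section WeylInvariance.
Context {R : realType} {n : nat}.
Implicit Types (T : 'I_n -> 'I_n -> 'M[R]_n).

(** Contraction gives $Ric'_{jk} = Ric_{jk} - n q_{kj} + q_{jk}$. The skew part of $q$ enters with
    factor $n+1$ and so vanishes, which leaves $P' = P - q$ after division by $n-1$. *)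
Lemma weyl_of_projective (G G' : 'M[R]_n) T T' (q : 'I_n -> 'I_n -> R) : (2 <= n)%N ->
  riemann_like G T -> riemann_like G' T' ->
  (forall k l i j, T' k l i j = T k l i j + (i == l)%:R * q k j - (i == k)%:R * q l j
     + (q k l - q l k) * (i == j)%:R) ->
  forall k l, weyl_of T' k l = weyl_of T k l.
Proof.
move=> n2 rT rT' H.
have Ric j k : ricci_of T' j k = ricci_of T j k - n%:R * q k j + q j k.
  rewrite !mxE; under eq_bigr => a _ do rewrite H eqxx mul1r.
  rewrite big_split sumrB big_split /= sumr_const card_ord.
  have d (f : 'I_n -> R) (b : 'I_n) : \sum_a (a == b)%:R * f a = f b.
    rewrite (bigD1 b) //= eqxx mul1r big1 ?addr0 // => a /negbTE ->.
    by rewrite mul0r.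
  rewrite (d (fun a => q a j)); under [X in _ + X]eq_bigr => a _ do rewrite mulrC.
  rewrite (d (fun a => q a k - q k a)) -mulr_natl; ring.
have n0 : (n%:R : R) - 1 != 0.
  by rewrite subr_eq0 pnatr_eq1 gtn_eqF.
have qs j k : q j k = q k j.
  have sR j' k' : ricci_of T j' k' = ricci_of T k' j' by rewrite -[in LHS](ricci_of_sym rT) mxE.
  have sR' : ricci_of T' j k = ricci_of T' k j by rewrite -[in LHS](ricci_of_sym rT') mxE.
  move: sR'; rewrite !Ric (sR j k) => E.
  have : (n%:R + 1) * (q j k - q k j) = 0 by lra.
  by move/eqP; rewrite mulf_eq0 natr1 pnatr_eq0 /= subr_eq0 => /eqP.
have nE : (n.-1)%:R = n%:R - 1 :> R by rewrite -subn1 natrB // ltnW.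
have Sch j k : schouten_of T' j k = schouten_of T j k - q j k.
  by rewrite [LHS]mxE [X in _ = X - _]mxE Ric nE (qs k j); field.
move=> k l; apply/matrixP => i j; rewrite [LHS]mxE [RHS]mxE H !Sch (qs k l) (qs k j) (qs l j).
ring.
Qed.

(** The quadratic part of the new curvature. The changed connection matrix is $C_k + e_k p + p_k$
    with $p\,e_k = p_k$, and torsion-freeness is $C_1 e_2 = C_2 e_1$. *)
Lemma projective_commutator (C1 C2 : 'M[R]_n) (e1 e2 : 'cV[R]_n) (p : 'rV[R]_n) (a1 a2 : R) :
  C1 *m e2 = C2 *m e1 -> p *m e1 = a1%:M -> p *m e2 = a2%:M ->
  (C1 + (e1 *m p + a1%:M)) *m (C2 + (e2 *m p + a2%:M)) -
  (C2 + (e2 *m p + a2%:M)) *m (C1 + (e1 *m p + a1%:M)) =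
  C1 *m C2 - C2 *m C1 + e1 *m (p *m C2 + a2 *: p) - e2 *m (p *m C1 + a1 *: p).
Proof.
move=> HC H1 H2.
have F1 : e1 *m p *m (e2 *m p) = a2 *: (e1 *m p).
  by rewrite -mulmxA (mulmxA p) H2 mul_scalar_mx scalemxAr.
have F2 : e2 *m p *m (e1 *m p) = a1 *: (e2 *m p).
  by rewrite -mulmxA (mulmxA p) H1 mul_scalar_mx scalemxAr.
have F3 : C1 *m (e2 *m p) = C2 *m (e1 *m p) by rewrite !mulmxA HC.
rewrite !mulmxDl !mulmxDr !mul_scalar_mx !mul_mx_scalar F1 F2 F3 -!scalemxAr -!mulmxA.
move: (C1 *m C2) (C2 *m C1) (e1 *m p) (e2 *m p) => X1 X2 X3 X4.
move: (e1 *m (p *m C2)) (e2 *m (p *m C1)) (C2 *m X3) => X5 X6 X7.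
by apply/matrixP => i j; rewrite !mxE; ring.
Qed.

Variables (U : set 'rV[R]_n) (G H : 'rV[R]_n -> 'M[R]_n).
Hypotheses (mG : metric_on U G) (mH : metric_on U H).
Hypothesis n2 : (2 <= n)%N.
Hypothesis proj : forall y, U y -> exists u : 'I_n -> R, forall i j k,
  christoffel H i j k y - christoffel G i j k y = (i == j)%:R * u k + (i == k)%:R * u j.

Let oU : open U. Proof. by case: mG. Qed.

(** [proj] gives the covector only point by point. Its [k]-th component is half the difference of
    the symbols with all indices equal to [k], and in this form it is visibly smooth. *)
Definition ups z : 'rV[R]_n := \row_k (2^-1 * (chris H k z k k - chris G k z k k)).

Lemma smooth_ups : smooth_mx U ups.
Proof.
move=> a k; rewrite (_ : (fun z => _) =
  (fun z => 2^-1 * (chris H k z k k - chris G k z k k))); last first.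
  by apply/funext => z; exact: mxE.
apply: smoothM => //; first exact: smooth_cst.
by apply: smoothB => //; exact: smooth_chris.
Qed.

Lemma chris_ups k z : U z -> chris H k z = chris G k z +
  (delta_mx k 0 *m ups z + (ups z 0 k)%:M).
Proof.
move=> Uz; have [u Hu] := proj Uz.
have uE a : ups z 0 a = u a by rewrite !mxE Hu eqxx /= !mulr1n; field.
apply/matrixP => i j; rewrite [RHS]mxE [X in _ = _ + X]mxE [X in _ = _ + (X + _)]mxE.
rewrite big_ord1 uE [(u k)%:M i j]mxE uE [delta_mx _ _ _ _]mxE andbT.
rewrite ![chris _ _ _ _ _]mxE; have := Hu i k j; rewrite -mulr_natr.
rewrite [(i == j)%:R * _]mulrC => E; lra.
Qed.

Lemma weyl_of_invariant y k l : U y -> weyl_of (riem H y) k l = weyl_of (riem G y) k l.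
Proof.
move=> Uy.
pose p := ups y; pose dp a : 'rV[R]_n := mxderive (coordv a) ups y.
pose C a := chris G a y.
(* Row [a] of $\nabla_a U_b - U_a U_b$. *)
pose Q a := dp a - p *m C a - p 0 a *: p.
have dH a b : mxderive (coordv a) (chris H b) y =
  mxderive (coordv a) (chris G b) y + (delta_mx b 0 *m dp a + (dp a 0 b)%:M).
  apply: is_mxderiveE; apply: (is_mxderive_near (A := fun z => chris G b z +
     (delta_mx b 0 *m ups z + (ups z 0 b)%:M))).
    by apply: open_near oU _ Uy => z Uz; rewrite chris_ups.
  apply: is_mxderiveD; first exact: smooth_is_mxderive (smooth_chris b mG) Uy.
  have Hu := smooth_is_mxderive (coordv a) smooth_ups Uy.
  apply: is_mxderiveD.
    have := is_mxderiveM (smooth_is_mxderive (coordv a) (smooth_mx_cst U (delta_mx b 0)) Uy) Hu.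
    have -> : mxderive (coordv a) (fun=> delta_mx b 0 : 'cV[R]_n) y = 0.
      by apply/matrixP => i j; rewrite !mxE derive_cst.
    by rewrite mul0mx add0r.
  move=> i j; rewrite [X in is_derive _ _ _ X]mxE.
  rewrite (_ : (fun z => _) = (fun z => (ups z) 0 b *+ (i == j))); last first.
    by apply/funext => z; rewrite mxE.
  by case: (i == j); [rewrite !mulr1n; exact: Hu|rewrite !mulr0n; exact: is_derive_cstE].
have sC a b : C a *m (delta_mx b 0 : 'cV[R]_n) = C b *m delta_mx a 0.
  rewrite -!colE; apply/colP => i; rewrite !(mxE _ _ i 0).
  exact: chris_sym mG Uy.
apply: (weyl_of_projective (q := fun a b => Q a 0 b) n2
   (riemann_like_riem mG Uy) (riemann_like_riem mH Uy)) => {k l} k l i j.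
have key : riem H y k l = riem G y k l + delta_mx l 0 *m Q k - delta_mx k 0 *m Q l +
   (dp k 0 l - dp l 0 k)%:M.
  rewrite /riem /curv !dH !chris_ups // -/p -/(C k) -/(C l) /Q; clear Q.
  have pe a : p *m (delta_mx a 0 : 'cV[R]_n) = (p 0 a)%:M.
    by rewrite -colE; apply/matrixP => a' b'; rewrite !mxE !ord1.
  rewrite (projective_commutator (sC k l) (pe k) (pe l)) !mulmxBr !mulmxDr -!scalemxAr.
  rewrite raddfB /=; clear sC dH; clearbody C dp p.
  move: (mxderive _ _ y) (mxderive _ _ y) (C k *m C l) (C l *m C k) => X1 X2 X3 X4.
  move: (_ *m dp k) (_ *m dp l) (_ *m (p *m C l)) (_ *m (p *m C k)) => X5 X6 X7 X8.
  move: (_ *m p) (_ *m p) => X9 X0.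
  by apply/matrixP => a b; rewrite !mxE; ring.
have qE a b : Q a 0 b = dp a 0 b - (p *m C a) 0 b - p 0 a * p 0 b.
  by rewrite /Q; move: (dp a) (p *m C a) => A B; rewrite !mxE.
have pC : (p *m C k) 0 l = (p *m C l) 0 k.
  rewrite [LHS]mxE [RHS]mxE; apply: eq_bigr => a _; congr (_ * _).
  exact: chris_sym mG Uy.
(* The scalar part of the curvature change is the exterior derivative of the covector; it agrees
   with the skew part of [Q] because the Christoffel symbols are symmetric. *)
have -> : (Q k 0 l - Q l 0 k) = dp k 0 l - dp l 0 k by rewrite !qE pC; ring.
rewrite key; move: (riem G y k l) (Q k) (Q l) (dp k 0 l - dp l 0 k) => A B D s.
rewrite !mxE !big_ord1 !mxE !andbT mulr_natr; ring.
Qed.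

End WeylInvariance.

(** * The tensor phi *)

Section PointwiseResults.
Context {R : realType} {n : nat} {M : smooth_manifold R n}.
Hypothesis n2 : (2 <= n)%N.
Implicit Types (g h : metric M) (c d : chart R n M) (x : M) (v w : 'cV[R]_n).

Lemma geodesics_included_connection g h c y : geodesics_included g h -> atlas c ->
  ccod c y -> exists u : 'I_n -> R, forall i j k,
  christoffel (gmx h c) i j k y - christoffel (gmx g c) i j k y =
  (i == j)%:R * u k + (i == k)%:R * u j.
Proof.
move=> gh ac Cy.
have sym f i j k : christoffel (gmx f c) i j k y = christoffel (gmx f c) i k j y.
  by have := chris_sym j i k (metric_on_ccod f ac) Cy; rewrite !mxE.
apply: quadratic_proportional => [i j k|w].
  by rewrite (sym h) (sym g).
exact: geodesics_included_quadratic gh ac Cy.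
Qed.

(** Both metrics are compared with the reference metric [g0] that defines the class. *)
Lemma class_weyl (m : metric_projective_structure M) g h c y : mps_class m g ->
  mps_class m h -> atlas c -> ccod c y ->
  forall k l, weyl_of (riem (gmx g c) y) k l = weyl_of (riem (gmx h c) y) k l.
Proof.
move=> mg mh ac Cy k l; have [g0 E] := mps_classP m.
have W f : mps_class m f ->
    weyl_of (riem (gmx f c) y) k l = weyl_of (riem (gmx g0 c) y) k l.
  rewrite E => -[g0f _].
  apply: (weyl_of_invariant (metric_on_ccod g0 ac) (metric_on_ccod f ac) n2 _ k l Cy).
  by move=> z Cz; exact: geodesics_included_connection g0f ac Cz.
exact (etrans (W g mg) (esym (W h mh))).
Qed.

Lemma class_nullity (m : metric_projective_structure M) g h c x v : mps_class m g ->
  mps_class m h -> chart_at c x -> v \in weyl_nullity g c x -> v \in weyl_nullity h c x.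
Proof.
move=> mg mh [ac cx] /proj_weyl_nullityP Nv; apply/proj_weyl_nullityP => k l.
by rewrite (class_weyl mh mg ac (cmap_fun cx)).
Qed.

Lemma chart_riemann_like g c x : chart_at c x ->
  riemann_like (metric_at g c x) (riem (gmx g c) (cmap c x)).
Proof.
by move=> [ac cx]; exact: riemann_like_riem (metric_on_ccod g ac) (cmap_fun cx).
Qed.

Lemma schoutenE g c x : schouten g c x = schouten_of (riem (gmx g c) (cmap c x)).
Proof. exact: proj_schoutenE. Qed.

Lemma chart_schouten_law g c d x : chart_at c x -> chart_at d x ->
  schouten g c x = (jac (transition c d) (cmap c x))^T *m schouten g d x
    *m jac (transition c d) (cmap c x).
Proof.
move=> cx dx; apply: bform_inj => u v; rewrite bform_mul !schoutenE.
exact: schouten_law (chart_jac_unit g cx dx) (chart_riem_law g cx dx) _ _.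
Qed.

Lemma chart_nullity_law g c d x v : chart_at c x -> chart_at d x ->
  (v \in weyl_nullity g c x) = (jac (transition c d) (cmap c x) *m v \in weyl_nullity g d x).
Proof.
move=> cx dx; have L := nullity_law (chart_jac_unit g cx dx) (chart_riem_law g cx dx) v.
by apply/idP/idP => /proj_weyl_nullityP/L/proj_weyl_nullityP.
Qed.

Lemma chart_at_ex x : exists c, chart_at c x.
Proof. by have [c ac cx] := atlas_cover x; exists c. Qed.

(** One chart supplies the eigenvalue; the transformation laws of metric, Schouten tensor and
    nullity carry it to every other chart. With this, the [xget] in [Bscalar] returns a genuine
    B-scalar. *)
Lemma is_Bscalar_ex g x : exists B, is_Bscalar g x B.
Proof.
have [d dx] := chart_at_ex x.
have [B HB] := nullity_eigen_uniform (chart_riemann_like g dx).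
exists B => c cx v; rewrite (chart_nullity_law g v cx dx) => /proj_weyl_nullityP/HB.
rewrite -schoutenE => E; have [_ uG _ _ _] := chart_riemann_like g cx.
rewrite -mulmxA (chart_schouten_law g cx dx) -!mulmxA E.
rewrite -[v in RHS](mulKmx uG) -!scalemxAr; congr (_ *: (_ *m _)).
have ME : metric_at g c x = (jac (transition c d) (cmap c x))^T *m metric_at g d x
    *m jac (transition c d) (cmap c x) := chart_metric_law g cx dx.
by rewrite ME !mulmxA.
Qed.

Lemma Bscalar_eigen g c x v : chart_at c x -> v \in weyl_nullity g c x ->
  schouten g c x *m v = Bscalar g x *: (metric_at g c x *m v).
Proof.
move=> cx Nv; have [_ uG _ _ _] := chart_riemann_like g cx.
have HB : is_Bscalar g x (Bscalar g x) by apply: xgetPex; exact: is_Bscalar_ex.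
by rewrite scalemxAr -(HB c cx v Nv) -mulmxA mulKVmx.
Qed.

Lemma nullity_phi g c x v : chart_at c x -> v \in weyl_nullity g c x -> forall u w,
  ctr (weyl_of (riem (gmx g c) (cmap c x))) v u *m w = - bform (phi g c x) w u *: v.
Proof.
move=> cx Nv u w; have EB := Bscalar_eigen cx Nv.
rewrite /phi schoutenE; move: EB; rewrite schoutenE => EB.
apply: weyl_nullity_schouten (chart_riemann_like g cx) _ EB u w.
exact/proj_weyl_nullityP.
Qed.

(** Moves the vector from the unspecified chart and metric of [has_weyl_nullity] to the ones in
    use. *)
Lemma has_weyl_nullity_chart m g c x : has_weyl_nullity m x -> mps_class m g ->
  chart_at c x -> exists2 v, v != 0 & v \in weyl_nullity g c x.
Proof.
move=> [d [v [dx v0 [h mh Nv]]]] mg cx.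
exists (jac (transition d c) (cmap d x) *m v).
  apply: contra v0 => /eqP E; rewrite -[v](mulKmx (chart_jac_unit g dx cx)).
  by rewrite E mulmx0.
by rewrite -(chart_nullity_law g v dx cx); exact: class_nullity mh mg dx Nv.
Qed.

Lemma phi_canonical m g h c x : has_weyl_nullity m x -> mps_class m g ->
  mps_class m h -> chart_at c x -> phi g c x = phi h c x.
Proof.
move=> Nx mg mh cx; have [v v0 Nv] := has_weyl_nullity_chart Nx mg cx.
have Nv' := class_nullity mg mh cx Nv.
apply: bform_inj => w u.
have [ac cc] := cx.
have E := ctr_eq (class_weyl mg mh ac (cmap_fun cc)) v u.
have /eqP := etrans (esym (nullity_phi cx Nv u w))
  (etrans (congr1 (mulmx^~ w) E) (nullity_phi cx Nv' u w)).
by rewrite -subr_eq0 -scalerBl scaler_eq0 (negbTE v0) orbF subr_eq0 eqr_opp => /eqP.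
Qed.

Lemma phi_nullity g c x v : chart_at c x -> v \in weyl_nullity g c x -> v^T *m phi g c x = 0.
Proof.
move=> cx Nv; have [sG _ _ _ _] := chart_riemann_like g cx.
have sP := schouten_of_sym (chart_riemann_like g cx); rewrite -schoutenE in sP.
have E : phi g c x *m v = 0.
  by rewrite /phi mulmxBl (Bscalar_eigen cx Nv) -scalemxAl subrr.
have trB (A B : 'M[R]_n) (a : R) : (A - a *: B)^T = A^T - a *: B^T.
  by apply/matrixP => i j; rewrite !mxE.
have sphi : (phi g c x)^T = phi g c x by rewrite /phi trB sP sG.
by rewrite -sphi -trmx_mul E trmx0.
Qed.

End PointwiseResults.

(** * Smoothness of the curvature tensors and of phi where B is smooth *)

Section SmoothTensors.
Context {R : realType} {n : nat} {M : smooth_manifold R n}.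
Implicit Types (g h : metric M) (c d : chart R n M) (x : M) (U : set M).

Lemma smooth_riem (V : set 'rV[R]_n) G k l : metric_on V G ->
  smooth_mx V (fun y => riem G y k l).
Proof.
move=> mG i j; have [oV _ _ _] := mG.
have SC a := smooth_chris a mG.
have SM a b := smooth_mulmx oV (SC a) (SC b).
have SD a b := smooth_mxderive (coordv a) (SC b).
rewrite (_ : (fun y => _) = (fun y => mxderive (coordv k) (chris G l) y i j -
  mxderive (coordv l) (chris G k) y i j + ((chris G k y *m chris G l y) i j
   - (chris G l y *m chris G k y) i j))); last first.
  apply/funext => y; rewrite /riem /curv.
  move: (mxderive _ _ _) (mxderive _ _ _) (_ *m _) (_ *m _) => A B E F.
  by rewrite !mxE.
apply: smoothD => //; apply: smoothB => //; [exact: SD|exact: SD|exact: SM|exact: SM].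
Qed.

Lemma smooth_schouten_of (V : set 'rV[R]_n) G : metric_on V G ->
  smooth_mx V (fun y => schouten_of (riem G y)).
Proof.
move=> mG i j; have [oV _ _ _] := mG.
rewrite (_ : (fun y => _) = (fun y => (n.-1)%:R^-1 * \sum_a riem G y a j a i)).
  apply: smoothM => //; first exact: smooth_cst.
  by apply: smooth_sum => // a; exact: smooth_riem.
by apply/funext => y; rewrite !mxE.
Qed.

Lemma smooth_weyl_of (V : set 'rV[R]_n) G k l : metric_on V G ->
  smooth_mx V (fun y => weyl_of (riem G y) k l).
Proof.
move=> mG i j; have [oV _ _ _] := mG.
have SP := smooth_schouten_of mG.
rewrite (_ : (fun y => _) = (fun y => riem G y k l i j +
  (i == l)%:R * schouten_of (riem G y) j k - (i == k)%:R * schouten_of (riem G y) j l)).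
  apply: smoothB => //; last by apply: smoothM; [exact: oV|exact: smooth_cst|exact: SP].
  apply: smoothD => //; first exact: smooth_riem.
  by apply: smoothM; [exact: oV|exact: smooth_cst|exact: SP].
by apply/funext => y; rewrite mxE.
Qed.

Lemma smooth_phi g U : open U -> smooth_function U (Bscalar g) -> smooth_2tensor U (phi g).
Proof.
move=> oU SB c ac a b; have mG := metric_on_chart_image g ac oU.
have [oV SG _ _] := mG.
apply: (@eq_smooth _ _ _ (fun y => schouten_of (riem (gmx g c) y) a b -
   Bscalar g (cinv c y) * gmx g c y a b)) => //.
  move=> y; rewrite inE => -[Cy Uy].
  by rewrite /phi schoutenE /metric_at cinvK // !(mxE _ _ a b).
apply: smoothB => //; first exact: smooth_schouten_of.
by apply: smoothM; [exact: oV|exact: SB|exact: SG].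
Qed.

End SmoothTensors.

(** * Kernels of matrices of constant rank *)

Section ConstantRank.
Context {R : realType} {n : nat}.
Implicit Types (V W : set 'rV[R]_n).

(* A constant rank makes the null space of A the one of a fixed selection S A of
   its rows, on which the correction by C (S A C)^-1 is smooth. *)
Lemma smooth_kernel_section (N : nat) V (A : 'rV[R]_n -> 'M[R]_(N, n)) (r : nat) y0
    (v0 : 'cV[R]_n) : open V -> smooth_mx V A -> (forall y, V y -> \rank (A y) = r) ->
  V y0 -> A y0 *m v0 = 0 -> exists W (v : 'rV[R]_n -> 'cV[R]_n),
  [/\ open W, W y0, W `<=` V, smooth_mx W v & v y0 = v0 /\ forall y, W y -> A y *m v y = 0].
Proof.
move=> oV SA rA Vy0 Av0.
(* From the rank normal form [A y0 = L *m pid_mx r *m Q]: [S] and [C] undo [L] and [Q] and cut out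
   the identity block. *)
have [S [C SAC]] : exists S : 'M[R]_(r, N), exists C : 'M[R]_(n, r), S *m A y0 *m C = 1%:M.
  have := mulmx_ebase (A y0); rewrite rA //.
  have := col_ebase_unit (A y0); have := row_ebase_unit (A y0).
  move: (col_ebase _) (row_ebase _) => L Q uQ uL E.
  exists (pid_mx r *m invmx L), (invmx Q *m pid_mx r).
  rewrite -E !mulmxA mulmxKV // -!mulmxA mulKVmx //.
  have rn : (r <= n)%N by rewrite -(rA _ Vy0) rank_leq_col.
  have rN : (r <= N)%N by rewrite -(rA _ Vy0) rank_leq_row.
  by rewrite mulmxA pid_mx_id // pid_mx_id // pid_mx_1.
pose D y := S *m A y *m C.
have SSA : smooth_mx V (fun y => S *m A y).
  by apply: smooth_mulmx oV _ SA; exact: smooth_mx_cst.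
have SD : smooth_mx V D by apply: smooth_mulmx oV SSA _; exact: smooth_mx_cst.
have Sdet := smooth_det oV SD.
have Dc : {for y0, continuous (fun y => \det (D y))} by exact: smooth_continuous Sdet Vy0.
have N0 : \forall y \near y0, \det (D y) != 0.
  have : \forall z \near \det (D y0), z != 0.
    apply: open_nbhs_nbhs; split; first exact: open_neq.
    by rewrite /D SAC det1 oner_neq0.
  by move=> H; exact: (Dc _ H).
pose W := (V `&` [set y | \det (D y) != 0])°.
have WV : W `<=` V by move=> y /interior_subset [].
have Wdet y : W y -> D y \in unitmx.
  by move=> /interior_subset [_ H]; rewrite unitmxE unitfE.
have oW : open W by exact: open_interior.
have Wy0 : W y0 by apply: filterI N0; exact: open_nbhs_nbhs.
exists W, (fun y => v0 - C *m (invmx (D y) *m (S *m A y *m v0))).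
have SSAW : smooth_mx W (fun y => S *m A y) by move=> i j; exact: smooth_sub (SSA i j).
split => //.
  have S1 : smooth_mx W (fun y => invmx (D y)).
    by apply: smooth_invmx => // i j; exact: smooth_sub (SD i j).
  have S2 := smooth_mulmx oW S1 (smooth_mulmx oW SSAW (smooth_mx_cst W v0)).
  have S3 := smooth_mulmx oW (smooth_mx_cst W C) S2.
  move=> i j; rewrite (_ : (fun z => _) = (fun z => v0 i j -
    (C *m (invmx (D z) *m (S *m A z *m v0))) i j)).
    by apply: smoothB oW _ (S3 i j); exact: smooth_cst.
  by apply/funext => z; rewrite [LHS]mxE [X in _ + X]mxE.
split; first by rewrite -(mulmxA S) Av0 !mulmx0 subr0.
move=> y Wy.
have SAv : S *m A y *m (v0 - C *m (invmx (D y) *m (S *m A y *m v0))) = 0.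
  rewrite mulmxBr [X in _ - X]mulmxA -/(D y) [X in _ - X]mulmxA mulmxV ?Wdet //.
  by rewrite mul1mx subrr.
(* [S *m A y] has the invertible right multiple [D y] of size [r], so it has full rank [r]. By
   constancy of the rank its row space is then that of [A y], and both have the same kernel. *)
have rSA : (\rank (A y) <= \rank (S *m A y))%N.
  rewrite rA; last exact: WV.
  by rewrite -{1}(mxrank_unit (Wdet y Wy)) /D mxrankM_maxl.
have /submxP[X EX] : (A y <= S *m A y)%MS.
  by rewrite -(geq_leqif (mxrank_leqif_sup (submxMl S (A y)))).
by rewrite {1}EX -(mulmxA X) SAv mulmx0.
Qed.

(** The nullity is a [vspace] of columns whereas [kermx] consists of rows, so a row basis of
    [kermx A^T] is transposed into a basis of [K]. *)
Lemma dim_null_space (N : nat) (A : 'M[R]_(N, n)) (K : {vspace 'cV[R]_n}) :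
  (forall v, v \in K <-> A *m v = 0) -> \dim K = (n - \rank A)%N.
Proof.
move=> HK; pose B := row_base (kermx A^T).
pose X := [tuple (row i B)^T | i < \rank (kermx A^T)].
have XE (i : 'I_(\rank (kermx A^T))) : X`_i = (row i B)^T by rewrite -(tnth_nth 0 X i) tnth_mktuple.
have sumX (k : 'I_(\rank (kermx A^T)) -> R) :
    \sum_i k i *: X`_i = ((\row_i k i) *m B)^T.
  rewrite mulmx_sum_row linear_sum /=; apply: eq_bigr => i _.
  by rewrite XE [X in X *: row _ _]mxE linearZ.
have bX : basis_of K X.
  apply/andP; split; last first.
    apply/freeP => k; rewrite sumX => /(congr1 trmx); rewrite trmxK trmx0.
    rewrite -{1}(mul0mx _ B) => /(row_free_inj (row_base_free _)) E i.
    by have /rowP/(_ i) := E; rewrite !mxE.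
  rewrite eqEsubv; apply/andP; split.
    apply/span_subvP => v /mapP[i _ ->]; apply/HK.
    suff E : row i B *m A^T = 0 by have := congr1 trmx E; rewrite trmx_mul trmxK trmx0.
    by apply/sub_kermxP; rewrite (submx_trans (row_sub i B)) // eq_row_base.
  apply/subvP => v /HK Av.
  have : (v^T <= B)%MS by rewrite eq_row_base; apply/sub_kermxP; rewrite -trmx_mul Av trmx0.
  move=> /submxP[k Ek]; have -> : v = \sum_i k 0 i *: X`_i.
    rewrite sumX -[v]trmxK Ek; congr ((_ *m _)^T).
    by apply/rowP => i; rewrite mxE.
  by apply: rpred_sum => i _; apply/rpredZ/memv_span/mem_nth; rewrite size_tuple.
by rewrite (size_basis bX) mxrank_ker mxrank_tr.
Qed.

End ConstantRank.

(** * Smoothness of phi for constant nullity *)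

Section ConstantNullity.
Context {R : realType} {n : nat} {M : smooth_manifold R n}.
Hypothesis n2 : (2 <= n)%N.
Implicit Types (g h : metric M) (c d : chart R n M) (x : M) (U : set M).

(** All the equations $W^i{}_{jkl} v^j = 0$ stacked into one matrix, with rows indexed by the
    triples [(k, l, i)]: constant nullity becomes constant rank. *)
Definition nullity_matrix (T : 'I_n -> 'I_n -> 'M[R]_n) :
  'M[R]_(#|{: 'I_n * 'I_n * 'I_n}|, n) :=
  \matrix_(p, j) weyl_of T (enum_val p).1.1 (enum_val p).1.2 (enum_val p).2 j.

Lemma nullity_matrixP T v : in_nullity T v <-> nullity_matrix T *m v = 0.
Proof.
split=> [Nv|E k l].
  apply/colP => p; have /colP/(_ (enum_val p).2) := Nv (enum_val p).1.1 (enum_val p).1.2.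
  rewrite [LHS]mxE [RHS]mxE => E; rewrite [LHS]mxE [RHS]mxE -[RHS]E.
  by apply: eq_bigr => j _; rewrite [X in X * _]mxE.
apply/colP => i; have /colP/(_ (enum_rank (k, l, i))) := E.
rewrite [LHS]mxE [RHS]mxE => E'; rewrite [LHS]mxE [RHS]mxE -[RHS]E'.
by apply: eq_bigr => j _; rewrite [nullity_matrix _ _ _]mxE enum_rankK.
Qed.

(** The dimension of the nullity is known for some metric [h] of the class, so the section and the
    formula for phi are found for [h]; [phi_canonical] passes to [g]. *)
Lemma smooth_phi_constant m U g : open U -> constant_weyl_nullity m U ->
  mps_class m g -> smooth_2tensor U (phi g).
Proof.
move=> oU [h mh [d d0 Hd]] mg c ac a b.
have mh' := metric_on_chart_image h ac oU; have [oV _ _ _] := mh'.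
pose V := chart_image c U.
pose A y := nullity_matrix (riem (gmx h c) y).
have chx y : V y -> chart_at c (cinv c y).
  by move=> [Cy _]; split => //; exact: cinv_fun.
have SW k l : smooth_mx V (fun y => weyl_of (riem (gmx h c) y) k l) by exact: smooth_weyl_of.
have SA : smooth_mx V A.
  move=> p j; rewrite (_ : (fun y => _) = (fun y => weyl_of (riem (gmx h c) y)
    (enum_val p).1.1 (enum_val p).1.2 (enum_val p).2 j)); first exact: SW.
  by apply/funext => y; rewrite mxE.
have NA y v : V y -> v \in weyl_nullity h c (cinv c y) <-> A y *m v = 0.
  move=> [Cy _]; rewrite /weyl_nullity cinvK //.
  by apply: iff_trans (proj_weyl_nullityP _ _ _) _; exact: nullity_matrixP.
have rA y : V y -> \rank (A y) = (n - d)%N.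
  move=> Vy; have [_ Uy] := Vy.
  rewrite -(Hd c _ Uy (chx y Vy)) (dim_null_space (fun v => NA y v Vy)) subKn //.
  exact: rank_leq_col.
have Nex y : V y -> exists2 v, v != 0 & v \in weyl_nullity h c (cinv c y).
  move=> Vy; have [_ Uy] := Vy.
  have dN := Hd c _ Uy (chx y Vy).
  exists (vpick (weyl_nullity h c (cinv c y))); last exact: memv_pick.
  by rewrite vpick0 -dimv_eq0 dN -lt0n.
apply: smooth_local => y0 Vy0.
have [v0 v0n0 Nv0] := Nex y0 Vy0.
have [W [v [oW Wy0 WV Sv [vy0 Av]]]] :=
  smooth_kernel_section oV SA rA Vy0 ((NA y0 v0 Vy0).1 Nv0).
have [i0 vi0] : exists i, v0 i 0 != 0.
  apply/existsP; rewrite -negb_forall; apply: contra v0n0 => /forallP E.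
  by apply/eqP/colP => i; rewrite mxE; exact/eqP.
have Nn : \forall y \near y0, v y i0 0 != 0.
  have : \forall z \near v y0 i0 0, z != 0.
    by apply: open_nbhs_nbhs; split; [exact: open_neq|rewrite vy0].
  by move=> H; exact: (smooth_continuous (Sv i0 0) Wy0 H).
pose W' := (W `&` [set y | v y i0 0 != 0])°.
have W'W : W' `<=` W by move=> y /interior_subset [].
have W'n y : W' y -> v y i0 0 != 0 by move=> /interior_subset [].
have oW' : open W' by exact: open_interior.
have W'y0 : W' y0 by apply: filterI Nn; exact: open_nbhs_nbhs.
exists W' => //.
(* Component [i0] of [nullity_phi], taken on basis vectors and solved for the entry of phi; the
   component [v y i0 0] does not vanish on [W']. *)
apply: (@eq_smooth _ _ _ (fun y => - ((\sum_k v y k 0 * weyl_of (riem (gmx h c) y) k b i0 a)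
   / v y i0 0))) => //; last first.
  have SvW i : smooth_on W' (fun y => v y i 0) by exact: smooth_sub (Sv i 0).
  apply: smoothN => //; apply: smoothM => //; last by apply: smoothV.
  apply: smooth_sum => // k; apply: smoothM => //.
  by apply: smooth_sub (SW k b i0 a) => y /W'W/WV.
move=> y; rewrite inE => W'y; have Wy := W'W _ W'y; have Vy := WV _ Wy.
have Nv : v y \in weyl_nullity h c (cinv c y) by apply/NA => //; exact: Av.
have hx : has_weyl_nullity m (cinv c y).
  exists c, (v y); split; [exact: chx| |by exists h].
  by apply/eqP => E; have := W'n y W'y; rewrite E mxE eqxx.
rewrite (phi_canonical n2 hx mg mh (chx y Vy)) -[phi h c _ a b]bform_delta.
have := nullity_phi (chx y Vy) Nv (delta_mx b 0) (delta_mx a 0).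
have [Cy _] := Vy; rewrite cinvK // => /colP/(_ i0).
rewrite ctr_sumE -colE.
rewrite [LHS]mxE summxE [RHS]mxE => E.
have -> : \sum_k v y k 0 * weyl_of (riem (gmx h c) y) k b i0 a =
    - bform (phi h c (cinv c y)) (delta_mx a 0) (delta_mx b 0) * v y i0 0.
  rewrite -[RHS]E; apply: eq_bigr => k _; rewrite [RHS]mxE; congr (_ * _).
  by rewrite ctr_delta.
by rewrite mulfK ?opprK //; exact: W'n.
Qed.

End ConstantNullity.

(** * Dimension two *)

Section DimensionTwo.
Context {R : realType}.

(** By skewness a single operator [T ord0 ord_max] remains. Its four entries are up to sign those of
    Ricci, and the divisor [n.-1] is 1, so the Schouten terms cancel it. *)
Lemma weyl_of_dim2 n (T : 'I_n -> 'I_n -> 'M[R]_n) : n = 2 ->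
  (forall k l, T l k = - T k l) -> forall k l, weyl_of T k l = 0.
Proof.
move=> n2; subst n => sT k l; apply/matrixP => i j.
have sum2 (f : 'I_2 -> R) : \sum_a f a = f ord0 + f ord_max.
  by rewrite big_ord_recl big_ord1; congr (f _ + f _); exact: val_inj.
have ord2 (a : 'I_2) : a = ord0 \/ a = ord_max.
  by case: a => [[|[|a]] Ha] //; [left|right]; exact: val_inj.
have T0 a b c : T a a b c = 0.
  by have /matrixP/(_ b c) := sT a a; rewrite mxE; lra.
have T1 b c : T ord_max ord0 b c = - T ord0 ord_max b c by rewrite sT mxE.
rewrite !mxE invr1 !mul1r !sum2.
by case: (ord2 k) => ->; case: (ord2 l) => ->; case: (ord2 i) => ->;
  rewrite ?T1 ?T0 /= ?mulr0n ?mulr1n; ring.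
Qed.

End DimensionTwo.

Section ProjectiveEquivalence.
Context {R : realType} {n : nat} {M : smooth_manifold R n}.
Implicit Types (g : metric M) (m : metric_projective_structure M).

(** Puts the reference metric into its own class; [has_weyl_nullity] asks for a metric of the
    class. *)
Lemma geodesics_included_refl g : geodesics_included g g.
Proof.
move=> I gamma oI geo; have [openI _ _] := oI.
exists I, id; split => //; split.
- by split=> [t|s t _ _|t It] //; exists t.
- move=> k; elim: k => [|k IH]; first by split => // t _; exact: cvg_id.
  by apply: (Ck_on_primitive openI (g := fun=> 1)); last exact: Ck_on_cst.
by move=> t _; rewrite derive_id oner_neq0.
Qed.

Lemma mps_class_ex m : exists g, mps_class m g.
Proof.
have [g E] := mps_classP m; exists g; rewrite E.
by split; exact: geodesics_included_refl.
Qed.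

Hypothesis n2 : n = 2%N.

Lemma dim2_nullity g c x v : chart_at c x -> v \in weyl_nullity g c x.
Proof.
move=> cx; apply/proj_weyl_nullityP => k l.
have [_ _ sT _ _] := chart_riemann_like g cx.
by rewrite weyl_of_dim2 ?mul0mx.
Qed.

Lemma dim2_has_weyl_nullity m x : has_weyl_nullity m x.
Proof.
have [g mg] := mps_class_ex m; have [c cx] := chart_at_ex x.
exists c, (const_mx 1); split => //; last by exists g => //; exact: dim2_nullity.
have i0 : 'I_n by rewrite n2; exact: ord0.
by apply/eqP => /colP/(_ i0); rewrite !mxE => /eqP; rewrite oner_eq0.
Qed.

Lemma dim2_schouten g c x : chart_at c x ->
  schouten g c x = Bscalar g x *: metric_at g c x.
Proof.
move=> cx; apply/matrixP => i j.
have /colP/(_ i) := Bscalar_eigen cx (dim2_nullity g (delta_mx j 0) cx).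
by rewrite -!colE [LHS]mxE [RHS]mxE [X in _ * X]mxE => ->; rewrite [RHS]mxE.
Qed.

(** Every vector is in the nullity, so $g^{-1}P$ is $B$ times the identity and $B$ is any of its
    diagonal entries. *)
Lemma dim2_smooth_Bscalar g : smooth_function [set: M] (Bscalar g).
Proof.
move=> c ac; have mG := metric_on_chart_image g ac openT; have [oV SG _ uG] := mG.
have i0 : 'I_n by rewrite n2; exact: ord0.
have S := smooth_mulmx oV (smooth_invmx oV uG SG) (smooth_schouten_of mG).
apply: (eq_smooth oV _ (S i0 i0)) => y; rewrite inE => Vy; have [Cy _] := Vy.
have cx : chart_at c (cinv c y) by split => //; exact: cinv_fun.
have := dim2_schouten g cx; rewrite schoutenE /metric_at cinvK // => ->.
by rewrite -scalemxAr mulVmx ?uG // !mxE eqxx mulr1.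
Qed.

End ProjectiveEquivalence.

Theorem theorem3p7 (R : realType) (n : nat) (hn : (2 <= n)%N)
    (M : smooth_manifold R n) (m : metric_projective_structure M) :
  (forall x : M, has_weyl_nullity m x ->
     (forall g gbar : metric M, mps_class m g -> mps_class m gbar ->
        forall c : chart R n M, chart_at c x ->
          schouten g c x - Bscalar g x *: metric_at g c x
          = schouten gbar c x - Bscalar gbar x *: metric_at gbar c x) /\
     (forall g : metric M, mps_class m g ->
        forall c : chart R n M, chart_at c x ->
        forall v : 'cV[R]_n, in_weyl_nullity m c x v ->
          v^T *m phi g c x = 0)) /\
  (forall g : metric M, mps_class m g ->
     forall U : set M, open U -> (forall x, U x -> has_weyl_nullity m x) ->
       smooth_function U (Bscalar g) -> smooth_2tensor U (phi g)) /\
  (forall U : set M, open U -> constant_weyl_nullity m U ->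
     forall g : metric M, mps_class m g -> smooth_2tensor U (phi g)) /\
  (n = 2%N ->
     (forall x : M, has_weyl_nullity m x) /\
     forall g : metric M, mps_class m g ->
       (forall (x : M) (c : chart R n M), chart_at c x ->
          phi g c x = 0 /\
          schouten g c x = Bscalar g x *: metric_at g c x) /\
       smooth_function [set: M] (Bscalar g)).
Proof.
split; [|split; [|split]].
- move=> x Nx; split=> [g h mg mh c cx|g mg c cx v [h mh Nv]].
    exact (phi_canonical hn Nx mg mh cx).
  exact (phi_nullity cx (class_nullity hn mh mg cx Nv)).
- by move=> g _ U oU _ SB; exact: smooth_phi.
- by move=> U oU NU g mg; exact (smooth_phi_constant hn oU NU mg).
move=> n2; split=> [x|g _]; first exact: dim2_has_weyl_nullity.
split; last exact: dim2_smooth_Bscalar.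
move=> x c cx; have E := dim2_schouten n2 g cx.
by rewrite /phi E subrr.
Qed.
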